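(* Let $G$ be an infinite (i.e. non-discrete) compact abelian group, let $p\in[1,2]$ and $\delta>0$, and let $x=\lambda\mathbf 1+f\in A_p(G)^1$ (with $\lambda\in\mathbb C$, $f\in A_p(G)$) satisfy $\|x\|_{A_p(G)^1}\le 1$ and $|\widehat x(\gamma)|\ge\delta$ for every $\gamma\in\widehat G$. Then $x$ has an inverse $x^{-1}$ in $A_p(G)^1$ and $$\|x^{-1}\|_{A_p(G)^1}\le \frac1\delta+\frac{2(1-\delta)}{\delta^2}.$$
   Context: $G$ is a compact abelian (Hausdorff) group with Haar measure normalized by $m(G)=1$; $\widehat G$ is its discrete Pontryagin dual with counting measure; $\widehat f(\gamma)=\int_G f(t)\overline{\gamma(t)}\,dt$ for $f\in L^1(G)$, $\gamma\in\widehat G$. For $1\le p<\infty$, $A_p(G)=\{f\in L^1(G):\widehat f\in \ell^p(\widehat G)\}$ with norm $\|f\|_{A_p(G)}=\|f\|_{L^1(G)}+\|\widehat f\|_{\ell^p(\widehat G)}$; it is a commutative Banach algebra under convolution. Its unitization is $A_p(G)^1=A_p(G)\oplus\mathbb C\mathbf 1$ with product $(\lambda\mathbf 1+f)(\mu\mathbf 1+g)=\lambda\mu\mathbf 1+(\lambda g+\mu f+f*g)$ and norm $\|\lambda\mathbf 1+f\|_{A_p(G)^1}=|\lambda|+\|f\|_{A_p(G)}$. For $x=\lambda\mathbf 1+f\in A_p(G)^1$ and $\gamma\in\widehat G$ one puts $\widehat x(\gamma)=\lambda+\widehat f(\gamma)$. *)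

(* Defs.v *)
From HB Require Import structures.
From mathcomp Require Import all_boot all_order all_algebra.
From mathcomp Require Import all_classical all_reals all_analysis.
From mathcomp Require Import complex.

Set Implicit Arguments.
Unset Strict Implicit.
Unset Printing Implicit Defensive.

Import Order.TTheory GRing.Theory Num.Theory.
Import numFieldNormedType.Exports.

Local Open Scope classical_set_scope.
Local Open Scope ring_scope.

(* [g_sigma_algebraType] is a [measurableType] only over a [pointedType], which
   a [topologicalZmodType] is not; hence this alias of G, pointed at 0. *)
Definition borelType (G : topologicalZmodType) : Type := G.

HB.instance Definition _ (G : topologicalZmodType) :=
  Choice.copy (borelType G) G.

HB.instance Definition _ (G : topologicalZmodType) :=
  isPointed.Build (borelType G) (0 : G).

HB.instance Definition _ (G : topologicalZmodType) :=
  @isMeasurable.Build (sigma_display (@open G)) (borelType G)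
    <<s @open G >> (@sigma_algebra0 _ setT (@open G))
    (@sigma_algebraC (borelType G) (@open G))
    (@sigma_algebra_bigcup _ setT (@open G)).

Section haar_measure.
Variables (R : realType) (G : topologicalZmodType).
Local Open Scope ereal_scope.

Definition is_haar (m : probability (borelType G) R) : Prop :=
  [/\ forall (t : G) (A : set G), measurable (A : set (borelType G)) ->
        m [set (t + s)%R | s in A] = m A,
      forall A : set G, measurable (A : set (borelType G)) ->
        m A = ereal_inf [set m U | U in [set U : set G | open U /\ A `<=` U]]
    & forall U : set G, open U ->
        m U = ereal_sup [set m K | K in [set K : set G | compact K /\ K `<=` U]]].

End haar_measure.

Section dual.
Variables (R : realType) (G : topologicalZmodType).

(* The ascription of [R[i]] selects its topology as a normed field. *)
Definition dual_group : set (G -> R[i]) :=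
  [set chi : G -> R[i] |
    [/\ continuous (chi : G -> (R[i] : numFieldType)),
        forall s t, chi (s + t) = chi s * chi t
      & forall t, `|chi t| = 1]].

End dual.
Arguments dual_group : clear implicits.

Section harmonic_analysis.
Variables (R : realType) (G : topologicalZmodType).
Variable m : probability (borelType G) R.
Implicit Types (f g chi : G -> R[i]) (p : R).

(* Complex functions on G are integrated componentwise; elements of L^1(G) are
   handled through representatives, equality being [f = g %[ae m]]. *)
Definition integrableC f : Prop :=
  m.-integrable setT (fun t : borelType G => (complex.Re (f t))%:E) /\
  m.-integrable setT (fun t : borelType G => (complex.Im (f t))%:E).

Definition integralC f : R[i] :=
  Complex (\int[m]_(t in setT) complex.Re (f t))
    (\int[m]_(t in setT) complex.Im (f t)).

Definition L1norm f : \bar R :=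
  ('N[m]_1[(fun t : borelType G => (Normc.normc (f t))%:E)])%E.

Definition fourier f chi : R[i] := integralC (fun t => f t * (chi t)^*%C).

(* The norm of l^p(dual_group) for the counting measure, for 1 <= p < +oo. *)
Definition lpnorm p (a : (G -> R[i]) -> R[i]) : \bar R :=
  ((\esum_(chi in dual_group R G) ((Normc.normc (a chi)) `^ p)%:E) `^ p^-1)%E.

Definition Ap p : set (G -> R[i]) :=
  [set f | integrableC f /\ (lpnorm p (fourier f) < +oo)%E].

Definition Apnorm p f : \bar R := (L1norm f + lpnorm p (fourier f))%E.

(* For integrable f and g the integrand is integrable for almost every t; the
   value at the other t is irrelevant. *)
Definition conv f g : G -> R[i] :=
  fun t => integralC (fun s => f (t - s) * g s).

(* The pair (lambda, f) stands for lambda 1 + f. *)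
Definition preunitization : Type := (R[i] * (G -> R[i]))%type.

Implicit Types x y : preunitization.

Definition Ap1 p : set preunitization := [set x | Ap p x.2].

Definition eq1 x y : Prop :=
  x.1 = y.1 /\ (x.2 : borelType G -> R[i]) = y.2 %[ae m].

Definition one1 : preunitization := (1, fun=> 0).

Definition mul1 x y : preunitization :=
  (x.1 * y.1, fun t => x.1 * y.2 t + y.1 * x.2 t + conv x.2 y.2 t).

Definition Ap1norm p x : \bar R := ((Normc.normc x.1)%:E + Apnorm p x.2)%E.

Definition hat1 x chi : R[i] := x.1 + fourier x.2 chi.

Definition is_inverse p x y : Prop :=
  [/\ Ap1 p y, eq1 (mul1 x y) one1 & eq1 (mul1 y x) one1].

End harmonic_analysis.

(* Main.v *)
Require Import Defs.
From HB Require Import structures.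
From mathcomp Require Import all_boot all_order all_algebra.
From mathcomp Require Import all_classical all_reals all_analysis.
From mathcomp Require Import measurable_realfun complex.
From mathcomp Require Import ring lra zify.

Import Order.TTheory GRing.Theory Num.Theory.
Import numFieldNormedType.Exports.

Local Open Scope classical_set_scope.
Local Open Scope ring_scope.

(* Write x = lambda + f, F for the Fourier transform of f and P for its l^p norm.
   The inverse must be 1/lambda + g, where g has Fourier transform
   - F / (lambda (lambda + F)). As p <= 2, F is square-summable, and
   g = q - f / lambda^2 where q has Fourier coefficients
   F^2 / (lambda^2 (lambda + F)), so that q is an absolutely convergent series of
   characters. The l^p norm of the transform of g is at most P / (|lambda| delta),
   and by Parseval so is |g|_1 <= |g|_2. Since G is infinite so is its dual, hence
   F takes arbitrarily small values and |lambda| >= delta; with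
   P <= 1 - |lambda| this gives the bound.

   Uniqueness of Fourier coefficients is proved without compact operators. If a is
   a continuous hermitian function, the normalized even convolution powers of a
   converge uniformly to a nonzero continuous idempotent: their squared norms are
   log-convex and submultiplicative. Among the idempotents with vanishing Fourier
   transform, one with no proper subidempotent spans a translation-invariant line,
   hence is a multiple of a character, a contradiction. *)

Set Implicit Arguments.
Unset Strict Implicit.
Unset Printing Implicit Defensive.

(** The coefficients of the inverse are only p-summable, so a Fourier series for it need not
    converge absolutely. Splitting off the linear term - F / lambda^2, the transform of a known
    function, leaves a quadratic remainder that is absolutely summable. The main obstacle is that f
    is a priori only integrable, so Parseval cannot be applied to it before it is known to lie in
    L^2. Membership in L^2 comes from duality against trigonometric polynomials; this needs their
    uniform density, which in turn needs uniqueness of Fourier coefficients for continuous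
    functions. In that uniqueness proof idempotents take the place of eigenspaces: passing to a
    proper subidempotent costs at least 1 in squared norm, so a descent stops at a minimal one. The
    constant of the theorem is 1 / |lambda| plus P / (|lambda| delta) counted twice. *)

Local Notation Re := complex.Re.
Local Notation Im := complex.Im.
Local Notation nc := Normc.normc.

(** * Moduli of complex numbers *)

Section complex_modulus.
Variable R : realType.
Implicit Types z w : R[i].

Lemma eqC z w : Re z = Re w -> Im z = Im w -> z = w.
Proof. by case: z w => [a b] [c d] /= -> ->. Qed.

Lemma ReD z w : Re (z + w) = Re z + Re w. Proof. by case: z w => [a b] [c d]. Qed.
Lemma ImD z w : Im (z + w) = Im z + Im w. Proof. by case: z w => [a b] [c d]. Qed.
Lemma ReN z : Re (- z) = - Re z. Proof. by case: z. Qed.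
Lemma ImN z : Im (- z) = - Im z. Proof. by case: z. Qed.
Lemma ReM z w : Re (z * w) = Re z * Re w - Im z * Im w.
Proof. by case: z w => [a b] [c d]. Qed.
Lemma ImM z w : Im (z * w) = Re z * Im w + Im z * Re w.
Proof. by case: z w => [a b] [c d]. Qed.
Lemma ReJ z : Re z^*%C = Re z. Proof. by case: z. Qed.
Lemma ImJ z : Im z^*%C = - Im z. Proof. by case: z. Qed.

Definition ReImE := (ReD, ImD, ReN, ImN, ReM, ImM, ReJ, ImJ).

Lemma sqr_nc z : nc z ^+ 2 = Re z ^+ 2 + Im z ^+ 2.
Proof. by case: z => a b /=; rewrite sqr_sqrtr// addr_ge0 ?sqr_ge0. Qed.

Lemma nc_ge0 z : 0 <= nc z. Proof. by case: z => a b /=; exact: sqrtr_ge0. Qed.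

Lemma ncM z w : nc (z * w) = nc z * nc w. Proof. exact: Normc.normcM. Qed.
Lemma ncD z w : nc (z + w) <= nc z + nc w. Proof. exact: le_normcD. Qed.
Lemma ncN z : nc (- z) = nc z. Proof. exact: normcN. Qed.
Lemma ncV z : nc z^-1 = (nc z)^-1. Proof. exact: Normc.normcV. Qed.
Lemma nc0 : nc (0 : R[i]) = 0. Proof. exact: Normc.normc0. Qed.
Lemma nc1 : nc (1 : R[i]) = 1. Proof. exact: Normc.normc1. Qed.
Lemma ncX z n : nc (z ^+ n) = nc z ^+ n.
Proof. by elim: n => [|n IH]; rewrite ?expr0 ?nc1// !exprS ncM IH. Qed.

Lemma ncB z w : nc (z - w) <= nc z + nc w.
Proof. by rewrite -(ncN w); exact: ncD. Qed.

Lemma nc_distC z w : nc (z - w) = nc (w - z).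
Proof. by rewrite -ncN opprB. Qed.

Lemma nc_real (x : R) : nc x%:C%C = `|x|.
Proof. by rewrite /= expr0n/= addr0 sqrtr_sqr. Qed.

Lemma ncJ z : nc z^*%C = nc z.
Proof. by case: z => a b /=; rewrite sqrrN. Qed.

Lemma nc_eq0 z : (nc z == 0) = (z == 0).
Proof.
apply/eqP/eqP => [/Normc.eq0_normc//|->]; exact: nc0.
Qed.

Lemma nc_gt0 z : (0 < nc z) = (z != 0).
Proof. by rewrite lt_def nc_ge0 andbT nc_eq0. Qed.

Lemma nc_Re z : `|Re z| <= nc z.
Proof.
rewrite -(@ler_pXn2r _ 2)// ?nnegrE ?nc_ge0// sqr_nc -normrX ger0_norm ?sqr_ge0//.
by rewrite lerDl sqr_ge0.
Qed.

Lemma nc_Im z : `|Im z| <= nc z.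
Proof.
rewrite -(@ler_pXn2r _ 2)// ?nnegrE ?nc_ge0// sqr_nc -normrX ger0_norm ?sqr_ge0//.
by rewrite lerDr sqr_ge0.
Qed.

Lemma nc_leReIm z : nc z <= `|Re z| + `|Im z|.
Proof.
rewrite -(@ler_pXn2r _ 2)// ?nnegrE ?nc_ge0 ?addr_ge0// sqr_nc.
rewrite -(real_normK (num_real (Re z))) -(real_normK (num_real (Im z))) sqrrD.
by rewrite addrAC lerDl mulrn_wge0// mulr_ge0.
Qed.

Lemma nc_sum (I : Type) (r : seq I) (P : pred I) (F : I -> R[i]) :
  nc (\sum_(i <- r | P i) F i) <= \sum_(i <- r | P i) nc (F i).
Proof.
elim/big_rec2: _ => [|i y x _ h]; first by rewrite nc0.
by apply: le_trans (ncD _ _) _; rewrite lerD2l.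
Qed.

Lemma mulCJ z : z * z^*%C = (nc z ^+ 2)%:C%C.
Proof. by apply: eqC; rewrite ?ReImE sqr_nc/=; ring. Qed.

Lemma Re_sum (I : Type) (r : seq I) (P : pred I) (F : I -> R[i]) :
  Re (\sum_(i <- r | P i) F i) = \sum_(i <- r | P i) Re (F i).
Proof. by elim/big_rec2: _ => // i y x _ <-; rewrite ReD. Qed.

Lemma conjCM z w : (z * w)^*%C = z^*%C * w^*%C. Proof. exact: rmorphM. Qed.
Lemma conjCD z w : (z + w)^*%C = z^*%C + w^*%C. Proof. exact: rmorphD. Qed.
Lemma conjCB z w : (z - w)^*%C = z^*%C - w^*%C. Proof. exact: rmorphB. Qed.

Lemma sqr_ncD_le z w : nc (z + w) ^+ 2 <= 2 * nc z ^+ 2 + 2 * nc w ^+ 2.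
Proof.
apply: (@le_trans _ _ ((nc z + nc w) ^+ 2)).
  by rewrite ler_pXn2r ?nnegrE ?nc_ge0 ?addr_ge0 ?nc_ge0//; exact: ncD.
rewrite -subr_ge0.
by have := sqr_ge0 (nc z - nc w); congr (_ <= _); ring.
Qed.

End complex_modulus.

(** * Integration of complex functions *)

Section complex_integral.
Variables (R : realType) (G : topologicalZmodType).
Variable m : probability (borelType G) R.
Implicit Types (f g : G -> R[i]) (u v : G -> R) (c : R[i]).

Definition measC f : Prop :=
  measurable_fun [set: borelType G] (fun t : borelType G => Re (f t)) /\
  measurable_fun [set: borelType G] (fun t : borelType G => Im (f t)).

Local Notation integrableR u :=
  (m.-integrable [set: borelType G] (fun t : borelType G => (u t)%:E)).
Local Notation intR u := (\int[m]_(t in [set: borelType G]) u t).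

Lemma measC_cst c : measC (fun=> c).
Proof. by split; exact: measurable_cst. Qed.

Lemma measCD f g : measC f -> measC g -> measC (fun t => f t + g t).
Proof.
move=> [f1 f2] [g1 g2]; split.
  by under eq_fun do rewrite ReD; exact: measurable_funD.
by under eq_fun do rewrite ImD; exact: measurable_funD.
Qed.

Lemma measCM f g : measC f -> measC g -> measC (fun t => f t * g t).
Proof.
move=> [f1 f2] [g1 g2]; split.
  by under eq_fun do rewrite ReM; apply: measurable_funB; exact: measurable_funM.
by under eq_fun do rewrite ImM; apply: measurable_funD; exact: measurable_funM.
Qed.

Lemma measCZ c f : measC f -> measC (fun t => c * f t).
Proof. by move=> mf; apply: measCM => //; exact: measC_cst. Qed.

Lemma measCJ f : measC f -> measC (fun t => (f t)^*%C).
Proof.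
move=> [f1 f2]; split.
  by under eq_fun do rewrite ReJ.
by under eq_fun do rewrite ImJ; exact: measurable_funN.
Qed.

Lemma measCB f g : measC f -> measC g -> measC (fun t => f t - g t).
Proof.
move=> mf mg; have := measCD mf (measCZ (-1) mg).
by under eq_fun do rewrite mulN1r.
Qed.

Lemma measC_sqr_nc f : measC f ->
  measurable_fun [set: borelType G] (fun t : borelType G => nc (f t) ^+ 2).
Proof.
move=> [f1 f2]; under eq_fun do rewrite sqr_nc.
by apply: measurable_funD; exact: measurable_funX.
Qed.

Lemma measC_nc f : measC f ->
  measurable_fun [set: borelType G] (fun t : borelType G => nc (f t)).
Proof.
move=> mf; have -> : (fun t : borelType G => nc (f t)) =
    Num.sqrt \o (fun t : borelType G => nc (f t) ^+ 2).
  by apply/funext => t /=; rewrite sqrtr_sqr ger0_norm ?nc_ge0.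
apply: measurableT_comp; last exact: measC_sqr_nc.
by apply: continuous_measurable_fun; exact: sqrt_continuous.
Qed.

Lemma integrableR_le u v :
  measurable_fun [set: borelType G] (u : borelType G -> R) ->
  (forall t, `|u t| <= v t) -> integrableR v -> integrableR u.
Proof.
move=> mu uv iv; apply: le_integrable iv => //.
  exact/measurable_EFinP.
by move=> t _ /=; rewrite lee_fin (le_trans (uv t))// ler_norm.
Qed.

Lemma integrableRD u v : integrableR u -> integrableR v ->
  integrableR (fun t => u t + v t).
Proof.
move=> iu iv; have := integrableD measurableT iu iv.
by apply: eq_integrable => // t _; rewrite /= EFinD.
Qed.

Lemma integrableRZ k u : integrableR u -> integrableR (fun t => k * u t).
Proof.
move=> iu; have := integrableZl measurableT k iu.
by apply: eq_integrable => // t _; rewrite /= EFinM.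
Qed.

Lemma integrableR_cst k : integrableR (fun=> k).
Proof. exact: finite_measure_integrable_cst. Qed.

Lemma intR_cst k : intR (fun=> k) = k.
Proof. by rewrite Rintegral_cst//; have /= := probability_setT m => ->; rewrite mulr1. Qed.

Lemma integrableC_measC f : integrableC m f -> measC f.
Proof.
by move=> [/measurable_int/measurable_EFinP ? /measurable_int/measurable_EFinP].
Qed.

Lemma le_integrableC f u : measC f -> integrableR u ->
  (forall t, nc (f t) <= u t) -> integrableC m f.
Proof.
move=> [f1 f2] iu fu; split.
  by apply: integrableR_le iu => // t; rewrite (le_trans (nc_Re _)).
by apply: integrableR_le iu => // t; rewrite (le_trans (nc_Im _)).
Qed.

Lemma integrableC_nc f : integrableC m f -> integrableR (fun t => nc (f t)).
Proof.
move=> fi; have [f1 f2] := fi; apply: (@integrableR_le _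
    (fun t => `|Re (f t)| + `|Im (f t)|)).
- by apply: measC_nc; exact: integrableC_measC.
- by move=> t; rewrite ger0_norm ?nc_ge0 ?nc_leReIm.
- by apply: integrableRD; exact: integrable_norm.
Qed.

Lemma bounded_integrableC f k : measC f -> (forall t, nc (f t) <= k) ->
  integrableC m f.
Proof. by move=> mf; apply: le_integrableC => //; exact: integrableR_cst. Qed.

Lemma integrableCD f g : integrableC m f -> integrableC m g ->
  integrableC m (fun t => f t + g t).
Proof.
move=> fi gi; apply: (le_integrableC _
  (integrableRD (integrableC_nc fi) (integrableC_nc gi))).
  by apply: measCD; exact: integrableC_measC.
by move=> t; exact: ncD.
Qed.

Lemma integrableCZ c f : integrableC m f -> integrableC m (fun t => c * f t).
Proof.
move=> fi; apply: (le_integrableC _ (integrableRZ (nc c) (integrableC_nc fi))).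
  by apply: measCZ; exact: integrableC_measC.
by move=> t; rewrite ncM.
Qed.

Lemma integrableC_cst c : integrableC m (fun=> c).
Proof. by apply: bounded_integrableC => //; exact: measC_cst. Qed.

Lemma integralCD f g : integrableC m f -> integrableC m g ->
  integralC m (fun t => f t + g t) = integralC m f + integralC m g.
Proof.
move=> [f1 f2] [g1 g2]; apply: eqC; rewrite ?ReImE/=.
  by under eq_Rintegral do rewrite ReD; exact: RintegralD.
by under eq_Rintegral do rewrite ImD; exact: RintegralD.
Qed.

Lemma integralCZ c f : integrableC m f ->
  integralC m (fun t => c * f t) = c * integralC m f.
Proof.
move=> [f1 f2]; apply: eqC; rewrite ?ReImE/=.
  under eq_Rintegral do rewrite ReM.
  by rewrite RintegralB ?RintegralZl//; exact: integrableRZ.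
under eq_Rintegral do rewrite ImM.
by rewrite RintegralD ?RintegralZl//; exact: integrableRZ.
Qed.

Lemma integralCJ f : integrableC m f ->
  integralC m (fun t => (f t)^*%C) = (integralC m f)^*%C.
Proof.
move=> [f1 f2]; apply: eqC; rewrite ?ReImE/=.
  by under eq_Rintegral do rewrite ReJ.
under eq_Rintegral do rewrite ImJ -mulN1r.
by rewrite RintegralZl// mulN1r.
Qed.

Lemma integrableCB f g : integrableC m f -> integrableC m g ->
  integrableC m (fun t => f t - g t).
Proof.
move=> fi gi; have := integrableCD fi (integrableCZ (-1) gi).
by under eq_fun do rewrite mulN1r.
Qed.

Lemma integralCB f g : integrableC m f -> integrableC m g ->
  integralC m (fun t => f t - g t) = integralC m f - integralC m g.
Proof.
move=> fi gi; have := integralCD fi (integrableCZ (-1) gi).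
by rewrite integralCZ// mulN1r => <-; congr integralC; apply/funext => t; rewrite mulN1r.
Qed.

Lemma integralC_cst c : integralC m (fun=> c) = c.
Proof. by apply: eqC; rewrite /= intR_cst. Qed.

Lemma le_nc_integralC f : integrableC m f ->
  nc (integralC m f) <= intR (fun t => nc (f t)).
Proof.
move=> fi; set z := integralC m f; have [z0|z0] := eqVneq (nc z) 0.
  by rewrite z0; apply: Rintegral_ge0 => t _; exact: nc_ge0.
have zp : 0 < nc z by rewrite lt_def z0 nc_ge0.
rewrite -(ler_pM2l zp) -expr2.
(* Rotating by the conjugate of [z] turns the modulus of the integral into the real part of an
   integral, to which monotonicity applies. *)
have -> : nc z ^+ 2 = Re (integralC m (fun t => z^*%C * f t)).
  by rewrite integralCZ// mulrC mulCJ.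
rewrite -RintegralZl//; last exact: integrableC_nc.
apply: le_Rintegral => //.
- by case: (integrableCZ z^*%C fi).
- exact/integrableRZ/integrableC_nc.
- move=> t _; rewrite -(ncJ z) -ncM; apply: le_trans (ler_norm _) _; exact: nc_Re.
Qed.

Lemma nc_integralC_le f u : integrableC m f -> integrableR u ->
  (forall t, nc (f t) <= u t) -> nc (integralC m f) <= intR u.
Proof.
move=> fi ui fu; apply: le_trans (le_nc_integralC fi) _.
by apply: le_Rintegral => //; exact: integrableC_nc.
Qed.

Lemma nc_integralC_bounded f k : measC f -> (forall t, nc (f t) <= k) ->
  nc (integralC m f) <= k.
Proof.
move=> mf fk; rewrite -[leRHS]intR_cst; apply: nc_integralC_le => //.
  exact: bounded_integrableC fk.
exact: integrableR_cst.
Qed.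

(** * Square-integrable functions *)

Definition L2 f : Prop := measC f /\ integrableR (fun t => nc (f t) ^+ 2).
Definition ip f g : R[i] := integralC m (fun t => f t * (g t)^*%C).
Definition sqn2 f : R := intR (fun t => nc (f t) ^+ 2).

Lemma bounded_L2 f k : measC f -> (forall t, nc (f t) <= k) -> L2 f.
Proof.
move=> mf fk; split=> //; apply: (@integrableR_le _ (fun=> k ^+ 2)).
- exact: measC_sqr_nc.
- move=> t; rewrite ger0_norm ?sqr_ge0// ler_pXn2r ?nnegrE ?nc_ge0//.
  by rewrite (le_trans (nc_ge0 (f t))).
- exact: integrableR_cst.
Qed.

Lemma L2D f g : L2 f -> L2 g -> L2 (fun t => f t + g t).
Proof.
move=> [mf fi] [mg gi]; have mfg := measCD mf mg; split => //.
apply: (@integrableR_le _ (fun t => 2 * nc (f t) ^+ 2 + 2 * nc (g t) ^+ 2)).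
- exact: measC_sqr_nc.
- by move=> t; rewrite ger0_norm ?sqr_ge0//; exact: sqr_ncD_le.
- by apply: integrableRD; exact: integrableRZ.
Qed.

Lemma L2Z c f : L2 f -> L2 (fun t => c * f t).
Proof.
move=> [mf fi]; have mcf := measCZ c mf; split => //.
have := integrableRZ (nc c ^+ 2) fi; congr (m.-integrable _ _).
by apply/funext => t; rewrite ncM exprMn.
Qed.

Lemma L2B f g : L2 f -> L2 g -> L2 (fun t => f t - g t).
Proof.
move=> fi gi; have := L2D fi (L2Z (-1) gi).
by under eq_fun do rewrite mulN1r.
Qed.

Lemma L2J f : L2 f -> L2 (fun t => (f t)^*%C).
Proof.
move=> [mf fi]; have mcf := measCJ mf; split => //.
by under eq_fun do rewrite ncJ.
Qed.

Lemma L2M_integrableC f g : L2 f -> L2 g -> integrableC m (fun t => f t * g t).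
Proof.
move=> [mf fi] [mg gi].
apply: (le_integrableC (measCM mf mg) (integrableRD fi gi)) => t.
rewrite ncM -subr_ge0; have := sqr_ge0 (nc (f t) - nc (g t)).
have := mulr_ge0 (nc_ge0 (f t)) (nc_ge0 (g t)); nra.
Qed.

Lemma ip_integrableC f g : L2 f -> L2 g ->
  integrableC m (fun t => f t * (g t)^*%C).
Proof. by move=> fi gi; apply: L2M_integrableC => //; exact: L2J. Qed.

Lemma L2_integrableC f : L2 f -> integrableC m f.
Proof.
move=> fi; have : L2 (fun=> 1) by apply: (@bounded_L2 _ (nc 1)) => //; exact: measC_cst.
by move=> /(L2M_integrableC fi); under eq_fun do rewrite mulr1.
Qed.

Lemma sqn2_ge0 f : 0 <= sqn2 f.
Proof. by apply: Rintegral_ge0 => t _; exact: sqr_ge0. Qed.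

Lemma ipxx f : ip f f = (sqn2 f)%:C%C.
Proof.
apply: eqC; rewrite /ip /sqn2 /=.
  by under eq_Rintegral do rewrite mulCJ.
by under eq_Rintegral do rewrite mulCJ; rewrite intR_cst.
Qed.

Lemma ipC f g : L2 f -> L2 g -> ip g f = (ip f g)^*%C.
Proof.
move=> fi gi; rewrite /ip -integralCJ; last exact: ip_integrableC.
by congr integralC; apply/funext => t; rewrite rmorphM/= conjcK mulrC.
Qed.

Lemma ipZl c f h : L2 f -> L2 h -> ip (fun t => c * f t) h = c * ip f h.
Proof.
move=> fi hi; rewrite /ip -integralCZ; last exact: ip_integrableC.
by congr integralC; apply/funext => t; rewrite mulrA.
Qed.

Lemma ipZr c f h : L2 f -> L2 h -> ip f (fun t => c * h t) = c^*%C * ip f h.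
Proof.
move=> fi hi; rewrite ipC ?ipZl//; last exact: L2Z.
by rewrite (ipC hi fi); exact: rmorphM.
Qed.

Lemma sqn2_expand c f g : L2 f -> L2 g ->
  sqn2 (fun t => f t - c * g t) =
  sqn2 f - 2 * Re (c * ip g f) + nc c ^+ 2 * sqn2 g.
Proof.
move=> fi gi; have cgi := L2Z c gi.
have -> : sqn2 (fun t => f t - c * g t) = Re (ip (fun t => f t - c * g t) (fun t => f t - c * g t)).
  by rewrite ipxx.
rewrite /ip.
have -> : (fun t => (f t - c * g t) * (f t - c * g t)^*%C) =
    (fun t => (f t * (f t)^*%C + (nc c ^+ 2)%:C%C * (g t * (g t)^*%C))
      - (c * (g t * (f t)^*%C) + c^*%C * (f t * (g t)^*%C))).
  by apply/funext => t; rewrite -mulCJ rmorphB rmorphM/=; ring.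
have i1 := ip_integrableC fi fi; have i2 := ip_integrableC gi gi.
have i3 := ip_integrableC gi fi; have i4 := ip_integrableC fi gi.
rewrite integralCB; first last.
- by apply: integrableCD; exact: integrableCZ.
- by apply: integrableCD => //; exact: integrableCZ.
rewrite !integralCD; try by [|exact: integrableCZ].
rewrite !integralCZ// -/(ip f f) -/(ip g g) -/(ip g f) -/(ip f g).
by rewrite !ipxx (ipC gi fi) !ReImE/= ; ring.
Qed.

Lemma cauchy_schwarz f g : L2 f -> L2 g ->
  nc (ip f g) ^+ 2 <= sqn2 f * sqn2 g.
Proof.
move=> fi gi; set z := ip f g.
have gf : ip g f = z^*%C by exact: ipC.
(* The squared norm of f - (k z) g for real [k] is a nonnegative quadratic in [k], whose minimum is
   at the inverse of [sqn2 g]. *)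
have key (k : R) : 0 <= sqn2 f - 2 * (k * nc z ^+ 2) + k ^+ 2 * nc z ^+ 2 * sqn2 g.
  have := sqn2_ge0 (fun t => f t - (k%:C%C * z) * g t).
  rewrite sqn2_expand// gf -mulrA mulCJ ncM exprMn nc_real real_normK ?num_real//.
  by rewrite ReM/= mul0r subr0.
have [g0|gp] := eqVneq (sqn2 g) 0; last first.
  have gp' : 0 < sqn2 g by rewrite lt_def gp sqn2_ge0.
  have := key (sqn2 g)^-1.
  have -> : sqn2 f - 2 * ((sqn2 g)^-1 * nc z ^+ 2) + (sqn2 g)^-1 ^+ 2 * nc z ^+ 2 * sqn2 g
     = (sqn2 f * sqn2 g - nc z ^+ 2) / sqn2 g by field.
  by rewrite pmulr_lge0 ?invr_gt0// subr_ge0.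
rewrite g0 mulr0 leNgt; apply/negP => z0.
(* When [sqn2 g] vanishes the quadratic is affine in [k], and this [k] would give it the negative
   value [- sqn2 f - 2]. *)
have := key ((sqn2 f + 1) / (nc z ^+ 2)).
rewrite g0 mulr0 addr0 divfK ?gt_eqF//; have := sqn2_ge0 f; lra.
Qed.

Lemma sqn2_le f k : L2 f -> (forall t, nc (f t) <= k) -> sqn2 f <= k ^+ 2.
Proof.
move=> [mf fi] fk; rewrite -[leRHS]intR_cst; apply: le_Rintegral => //.
  exact: integrableR_cst.
move=> t _; rewrite ler_pXn2r ?nnegrE ?nc_ge0//.
by rewrite (le_trans (nc_ge0 (f t))).
Qed.

Lemma sqr_nc_integralC_le f : L2 f -> nc (integralC m f) ^+ 2 <= sqn2 f.
Proof.
move=> fi; have L1 : L2 (fun=> 1) by apply: (@bounded_L2 _ (nc 1)) => //; exact: measC_cst.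
have := cauchy_schwarz fi L1; rewrite /ip conjc1.
under eq_fun do rewrite mulr1.
move=> /le_trans; apply; rewrite ler_piMr ?sqn2_ge0//.
by rewrite /sqn2 nc1 expr1n intR_cst.
Qed.

(** Cauchy-Schwarz for |f| against the constant 1, whose norm is 1 because the total mass is 1. It
    later bounds the L^1 norm of the inverse by the L^2 norm. *)
Lemma sqr_int_nc_le f : L2 f -> (intR (fun t => nc (f t))) ^+ 2 <= sqn2 f.
Proof.
move=> fi; have [mf fi'] := fi.
set h := fun t => (nc (f t))%:C%C.
have hi : L2 h.
  split; first by split => /=; [exact: measC_nc|exact: measurable_cst].
  by rewrite /h; under eq_fun do rewrite nc_real ger0_norm ?nc_ge0//.
have -> : sqn2 f = sqn2 h.
  by rewrite /sqn2; apply: eq_Rintegral => t _; rewrite nc_real ger0_norm ?nc_ge0.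
apply: le_trans (sqr_nc_integralC_le hi).
have -> : integralC m h = (intR (fun t => nc (f t)))%:C%C.
  by apply: eqC => //=; rewrite intR_cst.
by rewrite nc_real real_normK ?num_real.
Qed.

End complex_integral.

(** * Continuous complex functions *)

Section complex_continuity.
Variables (R : realType) (X : topologicalType).
Implicit Types (f g : X -> R[i]) (c : R[i]).

(** Here epsilon ranges over [R], whereas the norm of [R[i]] as a normed field is itself
    [R[i]]-valued; real estimates then apply directly. *)
Definition contC f : Prop :=
  forall (x : X) (e : R), 0 < e -> \forall y \near x, nc (f y - f x) < e.

Lemma continuous_contC f :
  continuous (f : X -> (R[i] : numFieldType)) <-> contC f.
Proof.
split=> cf x => [e e0|].
  have e0' : 0 < e%:C%C by rewrite ltcR.
  have /cvgrPdist_lt/(_ _ e0') := cf x.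
  apply: filterS => y; rewrite normc_def -[Num.sqrt _]/(nc (Complex _ _)) ltcR.
  rewrite nc_distC; congr (nc _ < e).
  by apply: eqC; rewrite ?ReImE.
apply/cvgrPdist_lt => e; rewrite ltcE => /andP[/eqP/= e1 e0].
have := cf x _ e0; apply: filterS => y h.
have -> : e = (Re e)%:C%C by apply: eqC.
rewrite normc_def -[Num.sqrt _]/(nc (Complex _ _)) ltcR.
move: h; rewrite nc_distC; congr (nc _ < _).
by apply: eqC; rewrite ?ReImE.
Qed.

Lemma contC_ReIm f : contC f <->
  continuous (fun x => Re (f x)) /\ continuous (fun x => Im (f x)).
Proof.
split=> [cf|[c1 c2] x e e0].
  split=> x; apply/cvgrPdist_lt => e e0; have := cf x _ e0; apply: filterS => y.
    by apply: le_lt_trans; rewrite distrC -ReN -ReD nc_Re.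
  by apply: le_lt_trans; rewrite distrC -ImN -ImD nc_Im.
have e20 : 0 < e / 2 by rewrite divr_gt0.
have /cvgrPdist_lt/(_ _ e20) h1 := c1 x.
have /cvgrPdist_lt/(_ _ e20) h2 := c2 x.
apply: filterS2 h1 h2 => y h1 h2.
rewrite (le_lt_trans (nc_leReIm _))// ReD ImD ReN ImN [ltRHS]splitr ltrD//.
  by rewrite distrC.
by rewrite distrC.
Qed.

Lemma contC_cst c : contC (fun=> c).
Proof. by apply/contC_ReIm; split=> x; exact: cvg_cst. Qed.

Lemma contC_real (u : X -> R) : continuous u -> contC (fun x => (u x)%:C%C).
Proof. by move=> cu; apply/contC_ReIm; split=> // x; exact: cvg_cst. Qed.

Lemma contCD f g : contC f -> contC g -> contC (fun x => f x + g x).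
Proof.
move=> /contC_ReIm[f1 f2] /contC_ReIm[g1 g2]; apply/contC_ReIm; split=> x.
  by under eq_fun do rewrite ReD; apply: cvgD; [exact: f1|exact: g1].
by under eq_fun do rewrite ImD; apply: cvgD; [exact: f2|exact: g2].
Qed.

Lemma contCM f g : contC f -> contC g -> contC (fun x => f x * g x).
Proof.
move=> /contC_ReIm[f1 f2] /contC_ReIm[g1 g2]; apply/contC_ReIm; split=> x.
  under eq_fun do rewrite ReM.
  by apply: cvgB; apply: cvgM; [exact: f1|exact: g1|exact: f2|exact: g2].
under eq_fun do rewrite ImM.
by apply: cvgD; apply: cvgM; [exact: f1|exact: g2|exact: f2|exact: g1].
Qed.

Lemma contCZ c f : contC f -> contC (fun x => c * f x).
Proof. by apply: contCM; exact: contC_cst. Qed.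

Lemma contCB f g : contC f -> contC g -> contC (fun x => f x - g x).
Proof.
by move=> cf /(contCZ (-1)) /(contCD cf); under eq_fun do rewrite mulN1r.
Qed.

Lemma contCJ f : contC f -> contC (fun x => (f x)^*%C).
Proof.
move=> cf x e e0; have := cf x _ e0; apply: filterS => y.
by rewrite -rmorphB/= ncJ.
Qed.

Lemma contC_unif f :
  (forall e : R, 0 < e -> exists2 g, contC g & forall x, nc (f x - g x) <= e) ->
  contC f.
Proof.
move=> H x e e0; have e40 : 0 < e / 4 by rewrite divr_gt0.
have [g cg fg] := H _ e40; have := cg x _ e40; apply: filterS => y gy.
have -> : f y - f x = (f y - g y) + (g y - g x) + (g x - f x) by ring.
have := ncD ((f y - g y) + (g y - g x)) (g x - f x).
have := ncD (f y - g y) (g y - g x).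
by have := fg y; have := fg x; rewrite (nc_distC (f x)); lra.
Qed.

Lemma contC_complete (q : nat -> X -> R[i]) :
  (forall n, contC (q n)) ->
  (forall e : R, 0 < e -> exists N, forall n k, (N <= n)%N -> (N <= k)%N ->
     forall x, nc (q n x - q k x) <= e) ->
  exists2 f, contC f & forall e : R, 0 < e ->
    exists N, forall n, (N <= n)%N -> forall x, nc (q n x - f x) <= e.
Proof.
move=> cq Cq.
have cv (u : nat -> R) : (forall e : R, 0 < e -> exists N, forall n, (N <= n)%N ->
    `|u n - u N| <= e) -> exists l : R, forall e : R, 0 < e ->
    exists M, forall n, (M <= n)%N -> `|u n - l| <= e.
  move=> Cu; have : cvgn u.
    apply: cauchy_cvg; apply: cauchy_exP => e e0.
    have [|N hN] := Cu (e / 2); first by rewrite divr_gt0.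
    exists (u N); rewrite /fmapE -ball_normE /ball_/=.
    exists N => // n /= Nn; rewrite distrC (le_lt_trans (hN _ Nn))//.
    by rewrite ltr_pdivrMr// ltr_pMr// ltr1n.
  move=> /cvgrPdist_le cvu; exists (limn u) => e e0.
  have [N _ hN] := cvu _ e0; exists N => n Nn.
  by rewrite distrC; exact: hN.
have cvR x : exists l : R[i], forall e : R, 0 < e ->
    exists M, forall n, (M <= n)%N -> nc (q n x - l) <= e.
  have [e e0|a ha] := cv (fun n => Re (q n x)).
    have [N hN] := Cq _ e0; exists N => n Nn.
    by rewrite -ReN -ReD (le_trans (nc_Re _))// hN.
  have [e e0|b hb] := cv (fun n => Im (q n x)).
    have [N hN] := Cq _ e0; exists N => n Nn.
    by rewrite -ImN -ImD (le_trans (nc_Im _))// hN.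
  exists (Complex a b) => e e0.
  have e20 : 0 < e / 2 by rewrite divr_gt0.
  have [M1 h1] := ha _ e20; have [M2 h2] := hb _ e20.
  exists (maxn M1 M2) => n; rewrite geq_max => /andP[/h1 + /h2].
  move=> k1 k2; rewrite (le_trans (nc_leReIm _))// !ReImE/= [leRHS]splitr.
  exact: lerD.
pose f x := projT1 (cid (cvR x)).
have hf x : forall e : R, 0 < e ->
    exists M, forall n, (M <= n)%N -> nc (q n x - f x) <= e.
  exact: projT2 (cid (cvR x)).
have unif (e : R) : 0 < e ->
    exists N, forall n, (N <= n)%N -> forall x, nc (q n x - f x) <= e.
  move=> e0; have [N hN] := Cq _ e0; exists N => n Nn x.
  (* The index [M] depends on [x], but it enters only through the auxiliary accuracy [d], which is
     arbitrary; [N] stays uniform. *)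
  apply/ler_addgt0Pr => d d0; have [M hM] := hf x _ d0.
  have -> : q n x - f x = (q n x - q (maxn N M) x) + (q (maxn N M) x - f x) by ring.
  apply: le_trans (ncD _ _) _; apply: lerD.
    by apply: hN => //; exact: leq_maxl.
  by apply: hM; exact: leq_maxr.
exists f => //; apply: contC_unif => e e0; have [N hN] := unif _ e0.
by exists (q N) => // x; rewrite nc_distC; exact: hN.
Qed.

Lemma contC_bounded f : compact [set: X] -> contC f ->
  exists2 k : R, 0 < k & forall x, nc (f x) <= k.
Proof.
move=> cX cf; have /compact_near_coveringP nX := cX.
have H (x : X) : [set: X] x -> \forall x' \near x & k \near (@pinfty_nbhs R), nc (f x') <= k.
  move=> _; have h1 := cf x _ (@ltr01 R).
  exists ([set y | nc (f y - f x) < 1], [set k | nc (f x) + 1 < k]) => /=.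
    split => //; exists (nc (f x) + 1); split => //; exact: num_real.
  move=> [y k] /= [h2 h3]; rewrite -(subrK (f x) (f y)).
  by rewrite (le_trans (ncD _ _))//; lra.
have [M [Mr hM]] := nX R (@pinfty_nbhs R) (fun k x => nc (f x) <= k) _ H.
exists (`|M| + 1); first by rewrite ltr_wpDl.
have Mlt : M < `|M| + 1 by rewrite (le_lt_trans (ler_norm M))// ltrDl.
by move=> x; exact: (hM _ Mlt x I).
Qed.

End complex_continuity.

Lemma contC_comp (R : realType) (X Y : topologicalType) (f : Y -> R[i])
  (h : X -> Y) : continuous h -> contC f -> contC (fun x => f (h x)).
Proof. by move=> ch cf x e e0; have := ch x _ (cf (h x) _ e0). Qed.

(** Compactness of [Y] makes the neighbourhood of [x] independent of [y] (tube lemma), so the slice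
    [K x] varies continuously in the sup norm. Continuity of parametrized integrals and the exchange
    of integrals rest on this. *)
Lemma contC_unif_slice (R : realType) (X Y : topologicalType) (K : X -> Y -> R[i]) :
  compact [set: Y] -> contC (fun p : X * Y => K p.1 p.2) ->
  forall x (e : R), 0 < e ->
    \forall x' \near x, forall y, nc (K x' y - K x y) < e.
Proof.
move=> cY cK x e e0; have /compact_near_coveringP nY := cY.
have H (y : Y) : [set: Y] y ->
    \forall y' \near y & x' \near x, nc (K x' y' - K x y') < e.
  move=> _; have e20 : 0 < e / 2 by rewrite divr_gt0.
  have [[A B] /= [Ax By] AB] := cK (x, y) _ e20.
  exists (B, A) => //= -[y' x'] /= [By' Ax'].
  have h1 := AB (x', y') (conj Ax' By').
  have h2 := AB (x, y') (conj (nbhs_singleton Ax) By').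
  have -> : K x' y' - K x y' = (K x' y' - K x y) - (K x y' - K x y) by ring.
  by have := ncB (K x' y' - K x y) (K x y' - K x y); move: h1 h2 => /=; lra.
have hh := nY X (nbhs x) (fun x' y => nc (K x' y - K x y) < e) (nbhs_filter x) H.
by apply: (filterS _ hh) => x' h y; exact: (h y I).
Qed.

(** * Continuous functions on the group *)

Section group_continuity.
Variables (R : realType) (G : topologicalZmodType).
Implicit Types (f : G -> R[i]).

Lemma contC_measC f : contC f -> measC f.
Proof.
have H (u : G -> R) : continuous u ->
    measurable_fun [set: borelType G] (u : borelType G -> R).
  move=> /continuousP cu; apply: (measurability _ (RGenOpens.measurableE R)).
  move=> _ [_ [a [b ->] <-]]; apply: measurableI => //.
  by apply: sub_sigma_algebra; apply: cu; exact: interval_open.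
by move=> /contC_ReIm[f1 f2]; split; exact: H.
Qed.

Lemma pair_continuous (X Y Z : topologicalType) (f : X -> Y) (g : X -> Z) :
  continuous f -> continuous g -> continuous (fun x => (f x, g x)).
Proof. by move=> cf cg x; apply: cvg_pair; [exact: cf|exact: cg]. Qed.

Lemma addr2_continuous (X : topologicalType) (h k : X -> G) :
  continuous h -> continuous k -> continuous (fun x => h x + k x).
Proof.
move=> ch ck x.
apply: (@continuous_comp _ _ _ (fun x => (h x, k x)) (fun p : G * G => p.1 + p.2)).
  exact: pair_continuous.
exact: add_continuous.
Qed.

Lemma subr2_continuous (X : topologicalType) (h k : X -> G) :
  continuous h -> continuous k -> continuous (fun x => h x - k x).
Proof.
move=> ch ck x.
apply: (@continuous_comp _ _ _ (fun x => (h x, k x)) (fun p : G * G => p.1 - p.2)).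
  exact: pair_continuous.
exact: sub_continuous.
Qed.

Lemma contC_unif_cont f : compact [set: G] -> contC f -> forall e : R, 0 < e ->
  \forall u \near (0 : G), forall t, nc (f (t + u) - f t) < e.
Proof.
move=> cG cf e e0.
have cK : contC (fun p : G * G => f (p.2 + p.1)).
  apply: (@contC_comp _ _ _ f (fun p : G * G => p.2 + p.1)) => //.
  by apply: addr2_continuous => x; [exact: cvg_snd|exact: cvg_fst].
have := @contC_unif_slice R G G (fun u t => f (t + u)) cG cK 0 e e0.
by apply: filterS => u h t; have := h t; rewrite addr0.
Qed.

End group_continuity.

(** * Invariance and Fubini for continuous functions *)

(** The sets whose complement satisfies [P] form a filter. Every point has a neighbourhood whose
    complement belongs to this filter, and compactness then forces the empty set into it. *)
Lemma compact_union_ind (X : topologicalType) (P : set X -> Prop) :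
  compact [set: X] -> P set0 ->
  (forall A B, A `<=` B -> P B -> P A) ->
  (forall A B, P A -> P B -> P (A `|` B)) ->
  (forall x : X, exists2 U : set X, nbhs x U & P U) -> P setT.
Proof.
move=> cX P0 PS PU Pn; have /compact_near_coveringP nX := cX.
pose F : set_system X := [set A | P (~` A)].
have FF : Filter F.
  split; rewrite /F /=; first by rewrite setCT.
    by move=> A B PA PB; change (P (~` (A `&` B))); rewrite setCI; exact: PU.
  by move=> A B AB /=; apply: PS; exact: subsetC.
have H (x : X) : [set: X] x -> \forall x' \near x & i \near F, i != x'.
  move=> _; have [U nU UP] := Pn x.
  exists (U, ~` U); first by split => //; change (P (~` (~` U))); rewrite setCK.
  by move=> [x' i] /= [Ux' Ui]; apply/eqP => ix; apply: Ui; rewrite ix.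
have := nX _ F (fun i x => i != x) FF H; rewrite /F.
apply: PS => x _ /= /(_ x I); by rewrite eqxx.
Qed.

(** * Measure-preserving maps *)

Section measure_preserving.
Variables (R : realType) (G : topologicalZmodType).
Variable m : probability (borelType G) R.

Lemma open_measurableG (U : set G) : open U -> measurable (U : set (borelType G)).
Proof. by move=> oU; exact: sub_sigma_algebra. Qed.

Lemma closed_measurableG (U : set G) :
  closed U -> measurable (U : set (borelType G)).
Proof.
move=> cU; rewrite -(setCK U); apply: measurableC.
by apply: open_measurableG; exact: closed_openC.
Qed.

Lemma continuous_measurableG (h : G -> G) : continuous h ->
  measurable_fun [set: borelType G] (h : borelType G -> borelType G).
Proof.
move=> /continuousP ch; apply: (@measurability _ _ (borelType G) (borelType G) _ _ (@open G)) => //.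
move=> _ [B oB <-]; apply: measurableI => //.
by apply: open_measurableG; exact: ch.
Qed.

(* Stated for continuous maps, so that measurability is automatic. *)
Definition preserving (h : G -> G) : Prop :=
  continuous h /\ forall A : set G, measurable (A : set (borelType G)) ->
    m (h @^-1` A) = m A.

Local Notation integrableR u :=
  (m.-integrable [set: borelType G] (fun t : borelType G => (u t)%:E)).
Local Notation intR u := (\int[m]_(t in [set: borelType G]) u t).

Lemma preserving_ge0_integral (h : G -> G) (u : G -> \bar R) : preserving h ->
  measurable_fun [set: borelType G] (u : borelType G -> \bar R) ->
  (forall t, 0 <= u t)%E ->
  (\int[m]_(t in [set: borelType G]) u (h t) =
   \int[m]_(t in [set: borelType G]) u t)%E.
Proof.
move=> [ch hm] mu u0; have mh := continuous_measurableG ch.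
have := @ge0_integral_pushforward _ _ (borelType G) (borelType G) R h mh m
  setT u measurableT mu (fun y _ => u0 y).
rewrite preimage_setT => <-; apply: eq_measure_integral => A mA _.
exact: hm.
Qed.

Lemma preserving_integrableR (h : G -> G) (u : G -> R) : preserving h ->
  integrableR u -> integrableR (fun t => u (h t)).
Proof.
move=> ph /integrableP[mu iu]; have [ch hm] := ph.
have mh := continuous_measurableG ch; apply/integrableP; split.
  exact: (measurableT_comp mu mh).
rewrite (@preserving_ge0_integral h (fun t => `|(u t)%:E|%E))//.
exact: measurableT_comp.
Qed.

Lemma preserving_intR (h : G -> G) (u : G -> R) : preserving h ->
  integrableR u -> intR (fun t => u (h t)) = intR u.
Proof.
move=> ph iu; have [ch hm] := ph; have mh := continuous_measurableG ch.
have iuh := preserving_integrableR ph iu; congr fine.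
have := @integral_pushforward _ _ (borelType G) (borelType G) R h mh m
  setT (fun t => (u t)%:E) (measurable_int _ iu).
rewrite preimage_setT => /(_ iuh measurableT) /= <-.
by apply: eq_measure_integral => A mA _; exact: hm.
Qed.

Lemma preserving_integralC (h : G -> G) (f : G -> R[i]) : preserving h ->
  integrableC m f -> integralC m (fun t => f (h t)) = integralC m f.
Proof.
move=> ph [f1 f2]; apply: eqC => /=.
  exact: (@preserving_intR h (fun t => Re (f t))).
exact: (@preserving_intR h (fun t => Im (f t))).
Qed.

Lemma preserving_measC (h : G -> G) (f : G -> R[i]) : preserving h ->
  measC f -> measC (fun t => f (h t)).
Proof.
move=> [ch _] [f1 f2]; have mh := continuous_measurableG ch; split.
  exact: (measurableT_comp f1 mh).
exact: (measurableT_comp f2 mh).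
Qed.

Lemma preserving_L2 (h : G -> G) (f : G -> R[i]) : preserving h ->
  L2 m f -> L2 m (fun t => f (h t)).
Proof.
move=> ph [mf fi]; split; first exact: preserving_measC.
exact: (@preserving_integrableR h (fun t => nc (f t) ^+ 2)).
Qed.

Lemma preserving_sqn2 (h : G -> G) (f : G -> R[i]) : preserving h ->
  L2 m f -> sqn2 m (fun t => f (h t)) = sqn2 m f.
Proof. by move=> ph [mf fi]; exact: (@preserving_intR h (fun t => nc (f t) ^+ 2)). Qed.

Lemma preserving_comp (h k : G -> G) : preserving h -> preserving k ->
  preserving (fun t => h (k t)).
Proof.
move=> [ch ph] [ck pk]; split=> [x|A mA].
  by apply: continuous_comp; [exact: ck|exact: ch].
rewrite -(ph A mA) -(pk (h @^-1` A))//.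
rewrite -[X in measurable X]setTI.
exact: (continuous_measurableG ch).
Qed.

Lemma contC_L2 (f : G -> R[i]) : compact [set: G] -> contC f -> L2 m f.
Proof.
move=> cG cf; have [k _ fk] := contC_bounded cG cf.
by apply: bounded_L2 fk; exact: contC_measC.
Qed.

Lemma intR_indic (A : set G) : measurable (A : set (borelType G)) ->
  intR (fun t => \1_A t : R) = fine (m A).
Proof. by move=> mA; rewrite /Rintegral integral_indic// setIT. Qed.

Lemma integrableR_indic (A : set G) : measurable (A : set (borelType G)) ->
  integrableR (fun t => \1_A t : R).
Proof. by move=> mA; exact: integrable_indic. Qed.

Lemma preserving_shift (t : G) : is_haar m -> preserving (fun s => t + s).
Proof.
move=> [mt _ _]; split=> [|A mA].
  by apply: addr2_continuous => x; [exact: cvg_cst|exact: cvg_id].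
rewrite -(mt (- t) A mA); congr (m _).
apply/seteqP; split=> s /= => [As|[u Au <-]].
  by exists (t + s) => //; rewrite addKr.
by rewrite addNKr.
Qed.

End measure_preserving.

(** Splitting a set along the first of two open sets carries the bound |D B| <= e m(B) from these
    sets to their union. By compactness it reaches the whole group, which has mass 1, and [e] is
    arbitrary. *)
Lemma small_additive_eq0 (R : realType) (G : topologicalZmodType)
  (m : probability (borelType G) R) (D : set G -> R[i]) :
  compact [set: G] ->
  (forall A B : set G, measurable (A : set (borelType G)) ->
    measurable (B : set (borelType G)) -> A `&` B = set0 ->
    D (A `|` B) = D A + D B) ->
  (forall (s : G) (e : R), 0 < e -> exists2 U : set G, open U /\ U s &
    forall B : set G, measurable (B : set (borelType G)) -> B `<=` U ->
    nc (D B) <= e * fine (m B)) ->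
  D setT = 0.
Proof.
move=> cG DU Dsmall; apply/eqP; rewrite -nc_eq0 eq_le nc_ge0 andbT.
apply/ler_addgt0Pr => e e0; rewrite add0r.
(* [S] need not be measurable; its open enlargement [S'] is, so that a measurable set can be cut
   along it. *)
pose good (S : set G) := exists2 S' : set G, open S' /\ S `<=` S' &
  forall B : set G, measurable (B : set (borelType G)) -> B `<=` S' ->
    nc (D B) <= e * fine (m B).
suff [S' [_ TS]] : good setT.
  move=> /(_ setT measurableT TS) /le_trans; apply.
  by rewrite probability_setT mulr1.
apply: (@compact_union_ind G good cG).
- have [U [Uo _] UH] := Dsmall 0 e e0; exists U => //; split => //.
- move=> A B AB [S' [oS BS] H]; exists S' => //; split => //.
  exact: subset_trans BS.
- move=> A B [S1 [S1o A1] H1] [S2 [S2o B2] H2]; exists (S1 `|` S2).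
    by split; [exact: openU|exact: setUSS].
  move=> C mC C12; have m1 := open_measurableG S1o.
  have mC1 : measurable (C `&` S1 : set (borelType G)) by exact: measurableI.
  have mC2 : measurable (C `\` S1 : set (borelType G)) by exact: measurableD.
  have dj : (C `&` S1) `&` (C `\` S1) = set0.
    by apply/seteqP; split => // s /= [[_ ?] [_ ?]].
  rewrite -(setUIDK C S1) DU// measureU// fineD ?fin_num_measure// mulrDr.
  apply: le_trans (ncD _ _) _; apply: lerD.
    by apply: H1 => // s [].
  apply: H2 => // s [Cs nS]; by case: (C12 s Cs) => [/nS|].
- move=> s; have [U [Uo Us] UH] := Dsmall s e e0.
  exists U; first exact: open_nbhs_nbhs.
  by exists U => //; split.
Qed.

(** * Exchange of integrals for continuous kernels *)

Section fubini.
Variables (R : realType) (G : topologicalZmodType).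
Hypothesis cG : compact [set: G].
Variable m : probability (borelType G) R.
Variable K : G -> G -> R[i].
Hypothesis cK : contC (fun p : G * G => K p.1 p.2).

Let cK1 s : contC (K s).
Proof.
apply: (@contC_comp _ _ _ (fun p : G * G => K p.1 p.2) (fun t => (s, t))) => //.
by apply: pair_continuous => x; [exact: cvg_cst|exact: cvg_id].
Qed.

Let cK2 t : contC (K^~ t).
Proof.
apply: (@contC_comp _ _ _ (fun p : G * G => K p.1 p.2) (fun s => (s, t))) => //.
by apply: pair_continuous => x; [exact: cvg_id|exact: cvg_cst].
Qed.

Let cKC : contC (fun p : G * G => K p.2 p.1).
Proof.
apply: (@contC_comp _ _ _ (fun p : G * G => K p.1 p.2) (fun p : G * G => (p.2, p.1))) => //.
by apply: pair_continuous => x; [exact: cvg_snd|exact: cvg_fst].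
Qed.

Let iK1 s : integrableC m (K s).
Proof. by apply: L2_integrableC; exact: contC_L2. Qed.

Lemma contC_integralC : contC (fun s => integralC m (K s)).
Proof.
move=> s e e0; have e20 : 0 < e / 2 by rewrite divr_gt0.
have := contC_unif_slice cG cK s e20; apply: filterS => s' h.
rewrite -integralCB//; apply: (@le_lt_trans _ _ (e / 2)); last by lra.
apply: nc_integralC_bounded => [|t]; last by apply/ltW.
by apply: contC_measC; apply: contCB.
Qed.

Let iB (B : set G) (s : G) : R[i] := (\1_B s)%:C%C.

Let nc_iB B s : nc (iB B s) = \1_B s.
Proof. by rewrite nc_real ger0_norm// indicE ler0n. Qed.

Let miB (B : set G) : measurable (B : set (borelType G)) -> measC (iB B).
Proof. by move=> mB; split => /=; [exact: measurable_indic|exact: measurable_cst]. Qed.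

Let iBf B f : measurable (B : set (borelType G)) -> contC f ->
  integrableC m (fun s => iB B s * f s).
Proof.
move=> mB cf; apply: L2M_integrableC; last exact: contC_L2.
apply: (@bounded_L2 _ _ _ _ 1); first exact: miB.
by move=> s; rewrite nc_iB indicE; case: (_ \in _).
Qed.

Let nc_iBf B f (e : R) : measurable (B : set (borelType G)) -> contC f ->
  (forall s, B s -> nc (f s) <= e) ->
  nc (integralC m (fun s => iB B s * f s)) <= e * fine (m B).
Proof.
move=> mB cf fe; rewrite -intR_indic// -RintegralZl//; last exact: integrableR_indic.
apply: nc_integralC_le; first exact: iBf.
  by apply: integrableRZ; exact: integrableR_indic.
move=> s; rewrite ncM nc_iB indicE; have [|] := boolP (s \in B); last by rewrite mul0r mulr0.
by rewrite inE mul1r mulr1; exact: fe.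
Qed.

Let contC_partial B : measurable (B : set (borelType G)) ->
  contC (fun t => integralC m (fun s => iB B s * K s t)).
Proof.
move=> mB t e e0; have e20 : 0 < e / 2 by rewrite divr_gt0.
have := @contC_unif_slice _ _ _ (fun t s => K s t) cG cKC t _ e20; apply: filterS => t' h.
rewrite -integralCB; try exact: iBf.
apply: (@le_lt_trans _ _ (e / 2)); last by lra.
under eq_fun do rewrite -mulrBr.
have cB : contC (fun s => K s t' - K s t) by exact: contCB.
apply: nc_integralC_bounded => [|s].
  by apply: measCM; [exact: miB|exact: contC_measC].
rewrite ncM nc_iB; apply: (@le_trans _ _ (1 * nc (K s t' - K s t))).
  by apply: ler_wpM2r; [exact: nc_ge0|rewrite indicE; case: (_ \in _)].
by rewrite mul1r; apply/ltW.
Qed.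

(** Only the first variable is cut off by [B], so no subset of the product has to be measurable. The
    exchange is the vanishing of the defect on the whole group. *)
Let defect B := integralC m (fun s => iB B s * integralC m (K s)) -
  integralC m (fun t => integralC m (fun s => iB B s * K s t)).

Let defectU A B : measurable (A : set (borelType G)) ->
  measurable (B : set (borelType G)) -> A `&` B = set0 ->
  defect (A `|` B) = defect A + defect B.
Proof.
move=> mA mB AB.
have iBU s : iB (A `|` B) s = iB A s + iB B s.
  rewrite /iB -rmorphD/= !indicE in_setU; congr (_%:C%C).
  have [sA|sA] := boolP (s \in A); have [sB|sB] := boolP (s \in B);
    rewrite ?addr0 ?add0r//.
  exfalso; have : (A `&` B) s by split; apply: set_mem.
  by rewrite AB.
have iL2 B' : measurable (B' : set (borelType G)) ->
    integrableC m (fun t => integralC m (fun s => iB B' s * K s t)).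
  by move=> mB'; apply: L2_integrableC; apply: contC_L2 => //; exact: contC_partial.
rewrite /defect addrACA -opprD -!integralCD; first last.
- exact/iBf/contC_integralC.
- exact/iBf/contC_integralC.
- exact: iL2.
- exact: iL2.
congr (_ - _); congr integralC; apply/funext => s.
  by rewrite iBU mulrDl.
rewrite -integralCD; try exact: iBf.
by congr integralC; apply/funext => t; rewrite iBU mulrDl.
Qed.

(** For a kernel independent of [s] the two iterated integrals agree. Replacing [K s] by [K s0] on
    [B] costs at most [e * fine (m B)] in each of them, whence the factor 2. *)
Let defect_small B s0 (e : R) : measurable (B : set (borelType G)) ->
  0 < e -> (forall s, B s -> forall t, nc (K s t - K s0 t) <= e) ->
  nc (defect B) <= 2 * e * fine (m B).
Proof.
move=> mB e0 Be.
have iiB : integrableC m (iB B).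
  have := iBf mB (@contC_cst R G 1).
  by under eq_fun do rewrite mulr1.
have E1 : integralC m (fun s => iB B s * integralC m (K s)) =
    integralC m (fun s => iB B s * (integralC m (K s) - integralC m (K s0)))
    + integralC m (K s0) * integralC m (iB B).
  rewrite -integralCZ// -integralCD//; first last.
  - exact: integrableCZ.
  - by apply: iBf => //; apply: contCB; [exact: contC_integralC|exact: contC_cst].
  by congr integralC; apply/funext => s; ring.
have E2 : integralC m (fun t => integralC m (fun s => iB B s * K s t)) =
    integralC m (fun t => integralC m (fun s => iB B s * (K s t - K s0 t)))
    + integralC m (K s0) * integralC m (iB B).
  rewrite mulrC -integralCZ// -integralCD//; last exact: integrableCZ.
    congr integralC; apply/funext => t.
    rewrite [X in _ = _ + X]mulrC -integralCZ// -integralCD//; last exact: integrableCZ.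
      by congr integralC; apply/funext => s; ring.
    by apply: iBf => //; apply: contCB => //; exact: contC_cst.
  have -> : (fun t => integralC m (fun s => iB B s * (K s t - K s0 t))) =
     (fun t => integralC m (fun s => iB B s * K s t) - integralC m (iB B) * K s0 t).
    apply/funext => t; rewrite mulrC -integralCZ// -integralCB//.
    - by congr integralC; apply/funext => s; ring.
    - exact: iBf.
    - exact: integrableCZ.
  apply: L2_integrableC; apply: contC_L2 => //; apply: contCB.
    exact: contC_partial.
  exact: contCZ.
rewrite /defect E1 E2 opprD addrACA subrr addr0.
apply: le_trans (ncB _ _) _; rewrite -mulrA mulr2n mulrDl mul1r; apply: lerD.
  apply: nc_iBf => //.
    by apply: contCB; [exact: contC_integralC|exact: contC_cst].
  move=> s Bs; rewrite -integralCB//; apply: nc_integralC_bounded.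
    by apply: contC_measC; exact: contCB.
  exact: Be.
have cKs0 t : contC (fun s => K s t - K s0 t) by apply: contCB => //; exact: contC_cst.
apply: nc_integralC_bounded => [|t].
  apply: contC_measC.
  have -> : (fun t => integralC m (fun s => iB B s * (K s t - K s0 t))) =
     (fun t => integralC m (fun s => iB B s * K s t) - integralC m (iB B) * K s0 t).
    apply/funext => t; rewrite mulrC -integralCZ// -integralCB//.
    - by congr integralC; apply/funext => s; ring.
    - exact: iBf.
    - exact: integrableCZ.
  by apply: contCB; [exact: contC_partial|exact: contCZ].
by apply: nc_iBf => // s Bs; exact: Be.
Qed.

(* The product sigma-algebra may be smaller than the Borel sigma-algebra of
   G * G, so the exchange is proved from uniform continuity of the slices. *)
Lemma integralC_exchange :
  integralC m (fun s => integralC m (K s)) =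
  integralC m (fun t => integralC m (fun s => K s t)).
Proof.
have iBT s z : iB setT s * z = z by rewrite /iB indicT mul1r.
have E1 : (fun s => iB setT s * integralC m (K s)) = (fun s => integralC m (K s)).
  by apply/funext => s; exact: iBT.
have E2 t : (fun s => iB setT s * K s t) = (fun s => K s t).
  by apply/funext => s; exact: iBT.
have E3 : (fun t => integralC m (fun s => iB setT s * K s t)) =
    (fun t => integralC m (fun s => K s t)).
  by apply/funext => t; rewrite E2.
have E : defect setT = integralC m (fun s => integralC m (K s)) -
  integralC m (fun t => integralC m (fun s => K s t)).
  exact: (f_equal2 (fun u v => integralC m u - integralC m v) E1 E3).
apply/eqP; rewrite -subr_eq0 -E; apply/eqP.
apply: (small_additive_eq0 cG defectU) => s e e0.
have e20 : 0 < e / 2 by rewrite divr_gt0.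
have : nbhs s [set s' | forall t, nc (K s' t - K s t) < e / 2].
  exact: contC_unif_slice.
rewrite nbhsE => -[U [Uo Us] UH].
exists U; first by split.
move=> B mB BU; have -> : e = 2 * (e / 2) by rewrite mulrC divfK.
by apply: (@defect_small B s _ mB e20) => r Br t; apply/ltW; apply: UH; exact: BU.
Qed.

End fubini.

(** * Haar measure and convolution *)

Section haar.
Variables (R : realType) (G : topologicalZmodType).
Hypotheses (cG : compact [set: G]) (hG : hausdorff_space G).
Variable m : probability (borelType G) R.
Hypothesis mH : is_haar m.
Implicit Types f g h : G -> R[i].

Local Notation intR u := (\int[m]_(t in [set: borelType G]) u t).

Lemma urysohn_compact (F U : set G) : closed F -> open U -> F `<=` U ->
  exists u : G -> R, [/\ continuous u, forall x, 0 <= u x <= 1,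
    forall x, F x -> u x = 1 & forall x, ~ U x -> u x = 0].
Proof.
move=> cF oU FU; have nG := compact_normal hG cG.
have /(@normal_separatorP R) sep := nG.
have cU : closed (~` U) by exact: open_closedC.
have UF0 : ~` U `&` F = set0.
  by apply/seteqP; split => // x /= [nU /FU].
have /(@uniform_separatorP _ R) [u [cu u01 u0 u1]] := sep _ _ cU cF UF0.
exists u; split => // x.
- have /u01 : range u (u x) by exists x.
  by rewrite /= in_itv.
- by move=> Fx; apply: u1; exists x.
- by move=> nU; apply: u0; exists x.
Qed.

(** Integrate [f (t - s)] in both orders. By invariance the integral over [s] does not depend on [t]
    and is the left side, while the integral over [t] does not depend on [s] and is the right
    side. *)
Lemma integralC_opp_contC f : contC f ->
  integralC m (fun s => f (- s)) = integralC m f.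
Proof.
move=> cf; have cK : contC (fun p : G * G => f (p.1 - p.2)).
  apply: (@contC_comp _ _ _ f (fun p : G * G => p.1 - p.2)) => //.
  by apply: subr2_continuous => x; [exact: cvg_fst|exact: cvg_snd].
have cN : contC (fun s : G => f (- s)).
  by apply: (@contC_comp _ _ _ f -%R) => //; exact: opp_continuous.
have := @integralC_exchange R G cG m (fun t s => f (t - s)) cK.
have -> : (fun t => integralC m (fun s => f (t - s))) =
    fun=> integralC m (fun s => f (- s)).
  apply/funext => t.
  rewrite -(preserving_integralC (preserving_shift (- t) mH) (f := fun s => f (- s))).
    by congr integralC; apply/funext => s; rewrite opprD opprK.
  by apply: L2_integrableC; exact: contC_L2.
have -> : (fun s => integralC m (fun t => f (t - s))) = fun=> integralC m f.
  apply/funext => s.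
  rewrite -(preserving_integralC (preserving_shift (- s) mH) (f := f)).
    by congr integralC; apply/funext => t; rewrite addrC.
  by apply: L2_integrableC; exact: contC_L2.
by rewrite !integralC_cst.
Qed.

Lemma fine_leG (A B : set G) : measurable (A : set (borelType G)) ->
  measurable (B : set (borelType G)) -> (fine (m A) <= fine (m B)) = (m A <= m B)%E.
Proof.
by move=> mA mB; rewrite -lee_fin !fineK// fin_num_measure.
Qed.

(** For a compact [K] inside [V], a Urysohn function [u] between them satisfies m(K) <= int u(t) =
    int u(-t) <= m(-V). Inner regularity gives one inequality, and the reflected set gives the
    other. *)
Lemma haar_opp_open (U : set G) : open U -> m (-%R @^-1` U) = m U.
Proof.
suff H (V : set G) : open V -> (m V <= m (-%R @^-1` V))%E.
  move=> oU; have oU' : open (-%R @^-1` U).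
    by move/continuousP : (@opp_continuous G); apply.
  apply/eqP; rewrite eq_le H// andbT.
  rewrite [in leRHS](_ : U = -%R @^-1` (-%R @^-1` U)); first exact: H.
  by apply/seteqP; split=> x /=; rewrite opprK.
move=> oV; have oV' : open (-%R @^-1` V).
  by move/continuousP : (@opp_continuous G); apply.
have [_ _ mi] := mH; rewrite mi//; apply: ub_ereal_sup => _ [K [cK KV] <-].
have clK : closed K by exact: compact_closed.
have [u [cu u01 u1 u0]] := urysohn_compact clK oV KV.
have mK := closed_measurableG clK; have mV := open_measurableG oV'.
rewrite -fine_leG// -!intR_indic//.
have cuC : contC (fun x => (u x)%:C%C) by exact: contC_real.
have cuN : contC (fun x => (u (- x))%:C%C).
  by apply: (@contC_comp _ _ _ (fun x => (u x)%:C%C) -%R) => //; exact: opp_continuous.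
have iu : m.-integrable [set: borelType G] (fun t : borelType G => (u t)%:E).
  by have [] := L2_integrableC (contC_L2 m cG cuC).
have iuN : m.-integrable [set: borelType G] (fun t : borelType G => (u (- t))%:E).
  by have [] := L2_integrableC (contC_L2 m cG cuN).
apply: (@le_trans _ _ (intR u)).
  apply: le_Rintegral => //; first exact: integrableR_indic.
  move=> x _; rewrite indicE; have [|_] := boolP (x \in K).
    by rewrite inE => /u1 ->.
  by have /andP[] := u01 x.
have -> : intR u = intR (fun s => u (- s)).
  by have /(congr1 (@complex.Re R)) /= := integralC_opp_contC cuC.
apply: le_Rintegral => //; first exact: integrableR_indic.
move=> x _; rewrite indicE; have [_|] := boolP (x \in -%R @^-1` V).
  by have /andP[] := u01 (- x).
by rewrite notin_setE /= => /u0 ->.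
Qed.

Lemma preserving_opp : preserving m (-%R : G -> G).
Proof.
split; first exact: opp_continuous.
have mN (A : set G) : measurable (A : set (borelType G)) ->
    measurable (-%R @^-1` A : set (borelType G)).
  move=> mA; rewrite -[X in measurable X]setTI.
  exact: (continuous_measurableG (@opp_continuous G)).
suff H (A : set G) : measurable (A : set (borelType G)) ->
    (m (-%R @^-1` A) <= m A)%E.
  move=> A mA; apply/eqP; rewrite eq_le H// andTb.
  rewrite [in leLHS](_ : A = -%R @^-1` (-%R @^-1` A)); first by apply: H; exact: mN.
  by apply/seteqP; split=> x /=; rewrite opprK.
move=> mA; have [_ mo _] := mH; rewrite [leRHS]mo//.
apply: le_ereal_inf_tmp => _ [U [oU AU] <-]; rewrite -(haar_opp_open oU).
apply: le_measure; rewrite ?inE.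
- exact: mN.
- by apply: mN; exact: open_measurableG.
- by move=> x /= /AU.
Qed.

Lemma preserving_subl (t : G) : preserving m (fun s => t - s).
Proof. exact: preserving_comp (preserving_shift t mH) preserving_opp. Qed.

(** The translates of a null open set are null and cover the group, so compactness would make the
    group null. *)
Lemma haar_open_gt0 (U : set G) (s : G) : open U -> U s -> (0 < m U)%E.
Proof.
move=> oU Us; rewrite lt0e measure_ge0 andbT; apply/eqP => mU0.
have : exists2 S : set G, measurable (S : set (borelType G)) /\ setT `<=` S & m S = 0%E.
  apply: (@compact_union_ind G (fun B => exists2 S : set G,
    measurable (S : set (borelType G)) /\ B `<=` S & m S = 0%E)) => //.
  - by exists set0; [split=> //; exact: measurable0|exact: measure0].
  - move=> A B AB [S [mS BS] S0]; exists S => //; split => //.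
    exact: subset_trans BS.
  - move=> A B [S [mS AS] S0] [S' [mS' BS'] S0']; exists (S `|` S').
      by split; [exact: measurableU|exact: setUSS].
    apply/eqP; rewrite eq_le measure_ge0 andbT.
    have SS' := measureU2 m mS mS'; apply: (le_trans SS').
    apply: (@le_trans _ _ (m S + m S')%E) => //.
    by rewrite S0 S0' adde0.
  - move=> x; pose V := (fun y => (s - x) + y) @^-1` U.
    have [cs ps] := preserving_shift (s - x) mH.
    have oV : open V by move/continuousP : cs; apply.
    exists V; first by apply: open_nbhs_nbhs; split => //; rewrite /V /= subrK.
    exists V; first by split => //; exact: open_measurableG.
    by rewrite /V ps//; exact: open_measurableG.
move=> [S [mS TS] S0]; have := probability_setT m.
have -> : [set: borelType G] = S by apply/seteqP; split.
by rewrite S0 => /eqP; rewrite eq_sym onee_eq0.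
Qed.

Lemma sqn2_gt0 f x : contC f -> f x != 0 -> 0 < sqn2 m f.
Proof.
move=> cf; rewrite -nc_gt0 => fx0; have e0 : 0 < nc (f x) / 2 by rewrite divr_gt0.
have : nbhs x [set y | nc (f y - f x) < nc (f x) / 2] by exact: cf.
rewrite nbhsE => -[U [oU Ux] UH]; have mU := open_measurableG oU.
have [_ fi] := contC_L2 m cG cf.
apply: (@lt_le_trans _ _ ((nc (f x) / 2) ^+ 2 * fine (m U))).
  rewrite mulr_gt0 ?exprn_gt0// fine_gt0//; apply/andP; split.
    exact: haar_open_gt0 Ux.
  by rewrite ltey_eq fin_num_measure.
rewrite -intR_indic// -RintegralZl//; last exact: integrableR_indic.
apply: le_Rintegral => //.
  by apply: integrableRZ; exact: integrableR_indic.
move=> y _; rewrite indicE; have [|_] := boolP (y \in U); last first.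
  by rewrite mulr0 sqr_ge0.
rewrite inE mulr1 => /UH /= h; rewrite ler_pXn2r ?nnegrE ?nc_ge0//; last exact/ltW.
have := ncD (f y) (f x - f y); rewrite addrC subrK nc_distC; move: h; lra.
Qed.

Local Notation "f *% g" := (Defs.conv m f g) (at level 40, left associativity).
(** The involution of the group algebra: convolution by [rev f] is adjoint to convolution by [f], so
    [rev a = a] makes convolution by [a] self-adjoint. *)
Definition rev f : G -> R[i] := fun t => (f (- t))^*%C.

Lemma contC_shift f t : contC f -> contC (fun s => f (t + s)).
Proof.
apply: (@contC_comp _ _ _ f (fun s => t + s)).
by apply: addr2_continuous => x; [exact: cvg_cst|exact: cvg_id].
Qed.

Lemma contC_rev f : contC f -> contC (rev f).
Proof.
move=> cf; apply: contCJ.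
by apply: (@contC_comp _ _ _ f -%R) => //; exact: opp_continuous.
Qed.

Lemma contC_conv f g : contC f -> contC g -> contC (f *% g).
Proof.
move=> cf cg; apply: (@contC_integralC R G cG m (fun t s => f (t - s) * g s)).
apply: contCM.
  apply: (@contC_comp _ _ _ f (fun p : G * G => p.1 - p.2)) => //.
  by apply: subr2_continuous => x; [exact: cvg_fst|exact: cvg_snd].
by apply: (@contC_comp _ _ _ g (fun p : G * G => p.2)) => // x; exact: cvg_snd.
Qed.

Lemma conv_integrableC f g t : L2 m f -> L2 m g ->
  integrableC m (fun s => f (t - s) * g s).
Proof.
move=> fi gi; apply: L2M_integrableC => //.
exact: (preserving_L2 (preserving_subl t)).
Qed.

Lemma convC f g : L2 m f -> L2 m g -> f *% g = g *% f.
Proof.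
move=> fi gi; apply/funext => t; rewrite /Defs.conv.
rewrite -(preserving_integralC (preserving_subl t)); last exact: conv_integrableC.
by congr integralC; apply/funext => s; rewrite opprB addrC subrK mulrC.
Qed.

(** Cauchy-Schwarz at each point. This is what upgrades L^2 closeness of one factor to uniform
    closeness of the convolutions. *)
Lemma sqr_nc_conv_le f g t : L2 m f -> L2 m g ->
  nc ((f *% g) t) ^+ 2 <= sqn2 m f * sqn2 m g.
Proof.
move=> fi gi; have fti := preserving_L2 (preserving_subl t) fi.
rewrite -(preserving_sqn2 (preserving_subl t) fi).
have := cauchy_schwarz fti (L2J gi).
have -> : ip m (fun s => f (t - s)) (fun s => (g s)^*%C) = (f *% g) t.
  by congr integralC; apply/funext => s; rewrite conjcK.
by congr (_ <= _ * _); apply: eq_Rintegral => s _; rewrite ncJ.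
Qed.

Lemma convDl f g h : L2 m f -> L2 m g -> L2 m h ->
  (fun t => f t + g t) *% h = (fun t => (f *% h) t + (g *% h) t).
Proof.
move=> fi gi hi; apply/funext => t; rewrite /Defs.conv -integralCD; try exact: conv_integrableC.
by congr integralC; apply/funext => s; rewrite mulrDl.
Qed.

Lemma convZl c f h : L2 m f -> L2 m h ->
  (fun t => c * f t) *% h = (fun t => c * (f *% h) t).
Proof.
move=> fi hi; apply/funext => t; rewrite /Defs.conv -integralCZ; last exact: conv_integrableC.
by congr integralC; apply/funext => s; rewrite mulrA.
Qed.

Lemma convBl f g h : L2 m f -> L2 m g -> L2 m h ->
  (fun t => f t - g t) *% h = (fun t => (f *% h) t - (g *% h) t).
Proof.
move=> fi gi hi; apply/funext => t; rewrite /Defs.conv -integralCB; try exact: conv_integrableC.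
by congr integralC; apply/funext => s; rewrite mulrBl.
Qed.

Lemma convA f g h : contC f -> contC g -> contC h ->
  f *% (g *% h) = (f *% g) *% h.
Proof.
move=> cf cg ch; have cL := contC_L2 m cG.
have fi := cL _ cf; have gi := cL _ cg; have hi := cL _ ch.
apply/funext => t; rewrite /Defs.conv.
have -> : (fun u => f (t - u) * integralC m (fun s => g (u - s) * h s)) =
   (fun u => integralC m (fun s => f (t - u) * (g (u - s) * h s))).
  by apply/funext => u; rewrite -integralCZ//; exact: conv_integrableC.
rewrite (@integralC_exchange R G cG m (fun u s => f (t - u) * (g (u - s) * h s))).
  congr integralC; apply/funext => s.
  have cfs : contC (fun u => f (t - u) * g (u - s)).
    apply: contCM.
      apply: (@contC_comp _ _ _ f (fun u => t - u)) => //.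
      by apply: subr2_continuous => x; [exact: cvg_cst|exact: cvg_id].
    apply: (@contC_comp _ _ _ g (fun u => u - s)) => //.
    by apply: subr2_continuous => x; [exact: cvg_id|exact: cvg_cst].
  transitivity (h s * integralC m (fun u => f (t - u) * g (u - s))).
    rewrite -integralCZ; last exact/L2_integrableC/cL.
    by congr integralC; apply/funext => u; ring.
  rewrite mulrC; congr (_ * _).
  rewrite -(preserving_integralC (preserving_shift s mH)); last exact/L2_integrableC/cL.
  by congr integralC; apply/funext => u; rewrite (addrC s u) addrK opprD addrA (addrAC t).
have c1 : continuous (fst : G * G -> G) by move=> x; exact: cvg_fst.
have c2 : continuous (snd : G * G -> G) by move=> x; exact: cvg_snd.
apply: contCM.
  apply: (@contC_comp _ _ _ f (fun p : G * G => t - p.1)) => //.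
  by apply: subr2_continuous => // x; exact: cvg_cst.
apply: contCM; last exact: (@contC_comp _ _ _ h snd).
apply: (@contC_comp _ _ _ g (fun p : G * G => p.1 - p.2)) => //.
exact: subr2_continuous.
Qed.

Lemma rev_conv f g : L2 m f -> L2 m g -> rev (f *% g) = rev f *% rev g.
Proof.
move=> fi gi; apply/funext => t; rewrite /rev /Defs.conv.
rewrite -(preserving_integralC preserving_opp); last exact: conv_integrableC.
rewrite -integralCJ.
  by congr integralC; apply/funext => s; rewrite rmorphM/= !opprB opprK addrC.
apply: L2M_integrableC; last exact: (preserving_L2 preserving_opp).
exact: (preserving_L2 (preserving_comp (preserving_subl (- t)) preserving_opp)).
Qed.

Lemma conv_rev0 f g : L2 m f -> L2 m g -> (f *% rev g) 0 = ip m f g.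
Proof.
move=> fi gi; rewrite /ip -(preserving_integralC preserving_opp); last exact: ip_integrableC.
by congr integralC; apply/funext => s; rewrite sub0r.
Qed.

End haar.

(** * Power iteration *)

Section log_convex_sequence.
Variable R : realType.
Variable s : nat -> R.
Hypothesis s_gt0 : forall n, 0 < s n.
Hypothesis s_logconvex : forall n, s n.+1 ^+ 2 <= s n * s n.+2.
Hypothesis s_submul : forall i j, s (i + j).+1 <= s i * s j.

Let r n := s n.+1 / s n.

Let r_gt0 n : 0 < r n. Proof. exact: divr_gt0. Qed.

Let r_nondecreasing : {homo r : n k / (n <= k)%N >-> n <= k}.
Proof.
apply/nondecreasing_seqP => n; rewrite /r.
rewrite ler_pdivrMr// mulrAC ler_pdivlMr// -expr2 mulrC.
exact: s_logconvex.
Qed.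

Let r_le n : r n <= s 0.
Proof. by rewrite ler_pdivrMr// mulrC; have := s_submul n 0; rewrite addn0. Qed.

Let s_geometric N j : s N * r N ^+ j <= s (N + j).
Proof.
elim: j => [|j IH]; first by rewrite mulr1 addn0.
rewrite exprSr mulrA addnS.
apply: (@le_trans _ _ (s (N + j) * r N)).
  by rewrite ler_pM2r.
rewrite -[leRHS](mulfVK (lt0r_neq0 (s_gt0 (N + j)))) mulrC ler_pM2r//.
by apply: r_nondecreasing; exact: leq_addr.
Qed.

(** [s n] belongs to the exponent n + 1, so the exponent (k + 1)(n + 1) has index [k * n.+1 + n]. *)
Let s_pow n k : s (k * n.+1 + n)%N <= s n ^+ k.+1.
Proof.
elim: k => [|k IH]; first by rewrite mul0n expr1.
have -> : (k.+1 * n.+1 + n = (k * n.+1 + n + n).+1)%N by rewrite mulSn; lia.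
by rewrite exprSr (le_trans (s_submul _ _))// ler_pM2r.
Qed.

(* By log-convexity the ratios [r n] increase to [rho], so [s n / rho ^+ n.+1]
   decreases; submultiplicativity keeps it above 1. *)
Lemma log_convex_growth : exists2 rho : R, 0 < rho &
  exists2 l : R, forall n, l <= s n / rho ^+ n.+1 & 1 <= l /\
  forall e : R, 0 < e -> exists N, forall n, (N <= n)%N ->
    s n / rho ^+ n.+1 <= l + e.
Proof.
have r_cvg : cvgn r.
  apply: nondecreasing_is_cvgn; first exact: r_nondecreasing.
  by exists (s 0) => _ [n _ <-]; exact: r_le.
set rho := limn r; have r_rho n : r n <= rho.
  by apply: nondecreasing_cvgn_le.
have rho_gt0 : 0 < rho by apply: lt_le_trans (r_rho 0%N).
pose t n := s n / rho ^+ n.+1.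
(* Otherwise some [r N] satisfies [s n < r N ^+ n.+1]. Along the indices [k * n.+1 + n] the sequence
   grows at least like powers of [r N] and at most like powers of [s n], so the positive constant
   [c] would stay below powers of [y / x], which tend to 0. *)
have t_ge1 n : 1 <= t n.
  rewrite ler_pdivlMr ?exprn_gt0// mul1r leNgt; apply/negP => sn.
  have [N hN] : exists N, s n < r N ^+ n.+1.
    have : (fun k => r k ^+ n.+1) @ \oo --> rho ^+ n.+1.
      have cX : {for rho, continuous (fun x : R => x ^+ n.+1)} by exact: exprn_continuous.
      exact: (continuous_cvg _ cX r_cvg).
    move=> /cvgrPdist_lt /(_ (rho ^+ n.+1 - s n)).
    rewrite subr_gt0 => /(_ sn) [N _ /(_ N (leqnn _))] /= h.
    exists N; have := le_lt_trans (ler_norm _) h; lra.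
  set x := r N ^+ n.+1 in hN; set y := s n in hN.
  have y0 : 0 < y by exact: s_gt0.
  have x0 : 0 < x by exact: lt_trans hN.
  pose c := s N / r N ^+ N.+1.
  have c0 : 0 < c by rewrite divr_gt0// exprn_gt0.
  have ck k : (N <= k)%N -> c <= (y / x) ^+ k.+1.
    move=> Nk; rewrite expr_div_n ler_pdivlMr ?exprn_gt0//.
    apply: le_trans (s_pow n k); rewrite /x -exprM.
    have Ni : (N <= k * n.+1 + n)%N by nia.
    have := s_geometric N (k * n.+1 + n - N); rewrite subnKC//.
    congr (_ <= _); rewrite /c -mulrA; congr (_ * _).
    have -> : (n.+1 * k.+1 = N.+1 + (k * n.+1 + n - N))%N by lia.
    by rewrite exprD mulKf// expf_neq0// gt_eqF.
  have yx : `|y / x| < 1 by rewrite ger0_norm ?divr_ge0 ?ltW// ltr_pdivrMr// mul1r.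
  have /cvgrPdist_lt/(_ _ c0) [M _ hM] := cvg_expr yx.
  have := hM (maxn N M).+1 (leq_trans (leq_maxr N M) (leqnSn _)).
  rewrite /= sub0r normrN => h.
  have := le_lt_trans (le_trans (ck _ (leq_maxl N M)) (ler_norm _)) h.
  by rewrite ltxx.
have t_noninc : {homo t : n k / (n <= k)%N >-> k <= n}.
  apply/nonincreasing_seqP => n; rewrite /t ler_pdivrMr ?exprn_gt0//.
  have -> : s n / rho ^+ n.+1 * rho ^+ n.+2 = s n * rho.
    by rewrite [rho ^+ n.+2]exprSr mulrA divfK// expf_neq0// gt_eqF.
  by rewrite mulrC -ler_pdivrMr//; exact: r_rho.
have t_cvg : cvgn t.
  apply: nonincreasing_is_cvgn; first exact: t_noninc.
  by exists 1 => _ [n _ <-]; exact: t_ge1.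
exists rho => //; exists (limn t) => [n|]; first exact: nonincreasing_cvgn_ge.
split; first by apply: limr_ge => //; apply: nearW.
move=> e e0; have /cvgrPdist_lt/(_ _ e0) [N _ hN] := t_cvg.
exists N => n /hN /=; rewrite distrC => /(le_lt_trans (ler_norm _)).
by rewrite /t => h; rewrite addrC -lerBlDr ltW.
Qed.

End log_convex_sequence.

Section power_iteration.
Variables (R : realType) (G : topologicalZmodType).
Hypotheses (cG : compact [set: G]) (hG : hausdorff_space G).
Variable m : probability (borelType G) R.
Hypothesis mH : is_haar m.
Implicit Types f g h : G -> R[i].

Local Notation "f *% g" := (Defs.conv m f g) (at level 40, left associativity).
Let cL f (cf : contC f) : L2 m f := contC_L2 m cG cf.

Variable a : G -> R[i].
Hypotheses (ca : contC a) (ra : rev a = a).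

(* [cpow n] is the convolution power of a with exponent n + 1. *)
Let cpow n := iter n (fun h => a *% h) a.

Let contC_cpow n : contC (cpow n).
Proof. by elim: n => [|n IH] //=; exact: contC_conv. Qed.

Let cpowD i j : cpow i *% cpow j = cpow (i + j).+1.
Proof.
elim: i => [//|i IH]; rewrite addSn -[RHS]/(a *% cpow (i + j).+1) -IH.
by rewrite convA.
Qed.

Let rev_cpow n : rev (cpow n) = cpow n.
Proof.
elim: n => [|n IH] //=; rewrite rev_conv//; try exact: cL.
by rewrite ra IH.
Qed.

Let ip_cpow i j : ip m (cpow i) (cpow j) = cpow (i + j).+1 0.
Proof.
rewrite -cpowD -[X in _ *% X]rev_cpow conv_rev0//; apply: cL; exact: contC_cpow.
Qed.

Let sg n := sqn2 m (cpow n).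

Let cpow0 n : cpow (n + n).+1 0 = (sg n)%:C%C.
Proof. by rewrite -ip_cpow ipxx. Qed.

Let cpow_bound n t : nc (cpow (n + n).+1 t) <= sg n.
Proof.
rewrite -cpowD -(@ler_pXn2r _ 2)// ?nnegrE ?nc_ge0 ?sqn2_ge0//.
by rewrite expr2; apply: sqr_nc_conv_le => //; apply: cL; exact: contC_cpow.
Qed.

(** The squared norm of a^(i+j+2) is the inner product of a^(2i+2) and a^(2j+2), whose sup norms are
    at most [sg i] and [sg j]. *)
Let sg_submul i j : sg (i + j).+1 <= sg i * sg j.
Proof.
have -> : sg (i + j).+1 = nc (ip m (cpow (i + i).+1) (cpow (j + j).+1)).
  rewrite ip_cpow; have -> : ((i + i).+1 + (j + j).+1).+1 =
    ((i + j).+1 + (i + j).+1).+1 by lia.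
  by rewrite cpow0 nc_real ger0_norm// sqn2_ge0.
apply: nc_integralC_bounded => [|t].
  apply: contC_measC; apply: contCM; first exact: contC_cpow.
  by apply: contCJ; exact: contC_cpow.
by rewrite ncM ncJ; apply: ler_pM; rewrite ?nc_ge0.
Qed.

(** Cauchy-Schwarz for a^(n+1) and a^(n+3), whose inner product is the squared norm of a^(n+2). *)
Let sg_logconvex n : sg n.+1 ^+ 2 <= sg n * sg n.+2.
Proof.
have -> : sg n.+1 = nc (ip m (cpow n) (cpow n.+2)).
  rewrite ip_cpow; have -> : (n + n.+2).+1 = (n.+1 + n.+1).+1 by lia.
  by rewrite cpow0 nc_real ger0_norm// sqn2_ge0.
by apply: cauchy_schwarz; apply: cL; exact: contC_cpow.
Qed.

Hypothesis a_neq0 : exists x, a x != 0.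

Let sg_gt0 n : 0 < sg n.
Proof.
(* Log-convexity passes positivity from two consecutive terms to the next, hence the induction on
   pairs. [sg 1] is positive because [a *% a] takes the value [sg 0] at 0. *)
suff : 0 < sg n /\ 0 < sg n.+1 by case.
have s0 : 0 < sg 0 by have [x ax] := a_neq0; exact: sqn2_gt0 ca ax.
elim: n => [|n [IH1 IH2]].
  split => //; apply: (sqn2_gt0 cG mH (x := 0)); first exact: contC_cpow.
  by rewrite (cpow0 0%N) -nc_eq0 nc_real normr_eq0 gt_eqF.
split; first exact: IH2.
have : 0 < sg n * sg n.+2.
  by apply: lt_le_trans (sg_logconvex n); exact: exprn_gt0.
by rewrite pmulr_rgt0.
Qed.

(** In spectral terms [rho] is the largest eigenvalue of convolution by [a *% a], and [b] is the
    kernel of the projection onto its eigenspace. Even powers keep eigenvalues of [a] of opposite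
    signs from making the sequence oscillate. *)
Lemma power_iteration : exists (b : G -> R[i]) (rho : R),
  [/\ contC b, rev b = b, b *% b = b, b 0 != 0 &
      (a *% a) *% b = (fun t => rho%:C%C * b t) /\ 0 < rho].
Proof.
have arith (x y z l d : R) : l <= z -> x <= l + d -> y <= l + d ->
  x - 2 * z + y <= 2 * d by lra.
have [rho rho0 [l l_le [l1 l_lim]]] := log_convex_growth sg_gt0 sg_logconvex sg_submul.
pose k n : R[i] := ((rho ^+ n.+1)^-1)%:C%C.
have nck n : nc (k n) = (rho ^+ n.+1)^-1.
  by rewrite nc_real ger0_norm// invr_ge0 exprn_ge0// ltW.
have kS n : rho%:C%C * k n.+1 = k n.
  by rewrite /k -rmorphM/= exprS invfM mulrA divff ?mul1r// gt_eqF.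
pose q n : G -> R[i] := fun t => k n * cpow (n + n).+1 t.
have cq n : contC (q n) by apply: contCZ; exact: contC_cpow.
have conv_q n : (a *% a) *% q n = (fun t => rho%:C%C * q n.+1 t).
  rewrite (convC cG hG mH (cL (contC_conv cG m ca ca)) (cL (cq n))).
  rewrite (convZl cG hG mH (k n) (cL (contC_cpow _)) (cL (contC_conv cG m ca ca))).
  rewrite (_ : a *% a = cpow 1); last by [].
  rewrite cpowD; apply/funext => t; rewrite /q mulrA kS.
  by have -> : ((n + n).+1 + 1).+1 = (n.+1 + n.+1).+1 by lia.
(* The inner product of [q i] and [q j] depends on [i + j] only. Hence the squared norm of
   [q i - q j] is a combination of terms of the convergent sequence [tau] with coefficients 1, -2,
   1, and tends to 0. *)
pose tau n := sg n / rho ^+ n.+1.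
have ip_q i j : ip m (q i) (q j) = (tau (i + j).+1)%:C%C.
  have Lc n : L2 m (cpow n) by apply: cL; exact: contC_cpow.
  rewrite /q ipZl ?ipZr//; last exact: L2Z.
  rewrite ip_cpow; have -> : ((i + i).+1 + (j + j).+1).+1 =
    ((i + j).+1 + (i + j).+1).+1 by lia.
  rewrite cpow0 conjc_real -!rmorphM/=; congr (_%:C%C); rewrite /tau.
  have -> : (i + j).+2 = (i.+1 + j.+1)%N by lia.
  by rewrite exprD invfM; ring.
have sqn2_q i j : sqn2 m (fun t => q i t - q j t) =
    tau (i + i).+1 - 2 * tau (i + j).+1 + tau (j + j).+1.
  have -> : (fun t => q i t - q j t) = (fun t => q i t - 1 * q j t).
    by apply/funext => t; rewrite mul1r.
  have sqn2E g : sqn2 m g = Re (ip m g g) by rewrite ipxx.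
  rewrite sqn2_expand; try exact: cL.
  by rewrite mul1r nc1 expr1n mul1r !sqn2E !ip_q /= addnC.
(* [q n.+1] is the convolution of [q n] by [a *% a] divided by [rho], so L^2 closeness becomes
   uniform closeness one index later. *)
have [b cb qb] : exists2 b, contC b & forall e : R, 0 < e ->
    exists N, forall n, (N <= n)%N -> forall t, nc (q n.+1 t - b t) <= e.
  apply: (contC_complete (q := fun n => q n.+1)) => // e e0.
  pose M := sqn2 m (a *% a); have M0 : 0 <= M by exact: sqn2_ge0.
  (* Chosen so that [M * (2 * d)] is at most [(e * rho) ^+ 2]; adding 1 to [M] keeps the denominator
     positive. *)
  pose d := (e * rho) ^+ 2 / (2 * (M + 1)).
  have d0 : 0 < d by rewrite divr_gt0 ?exprn_gt0 ?mulr_gt0// ltr_wpDl.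
  have [N hN] := l_lim _ d0; exists N => i j Ni Nj t.
  have small : sqn2 m (fun t => q i t - q j t) <= 2 * d.
    rewrite sqn2_q.
    have h1 := hN (i + i).+1 (leq_trans Ni (leq_trans (leq_addr i i) (leqnSn _))).
    have h2 := hN (j + j).+1 (leq_trans Nj (leq_trans (leq_addr j j) (leqnSn _))).
    exact: arith (l_le (i + j).+1) h1 h2.
  have cqij : contC (fun t => q i t - q j t) by exact: contCB.
  have caa : contC (a *% a) by exact: contC_conv.
  have := sqr_nc_conv_le cG hG mH t (cL caa) (cL cqij).
  rewrite (convC cG hG mH (cL caa) (cL cqij)) (convBl cG hG mH (cL (cq i)) (cL (cq j)) (cL caa)).
  rewrite !(convC cG hG mH _ (cL caa)) ?conv_q; try exact: cL.
  rewrite -mulrBr ncM exprMn nc_real (ger0_norm (ltW rho0)) -/M => h.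
  rewrite -(@ler_pXn2r _ 2)// ?nnegrE ?nc_ge0 ?(ltW e0)//.
  rewrite -(ler_pM2l (exprn_gt0 2 rho0)) (le_trans h)//.
  apply: (@le_trans _ _ (M * (2 * d))); first exact: ler_wpM2l.
  rewrite -exprMn [rho * e]mulrC /d.
  have -> : M * (2 * ((e * rho) ^+ 2 / (2 * (M + 1)))) = (M / (M + 1)) * (e * rho) ^+ 2.
    by field; rewrite gt_eqF// ltr_wpDl.
  by rewrite ler_piMl ?sqr_ge0// ler_pdivrMr ?mul1r ?lerDl// ltr_wpDl.
have lim_eq (z w : R[i]) : (forall e : R, 0 < e -> nc (z - w) <= e) -> z = w.
  move=> H; apply/eqP; rewrite -subr_eq0 -nc_eq0 eq_le nc_ge0 andbT.
  by apply/ler_addgt0Pr => e e0; rewrite add0r; exact: H.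
have conv_lim h (e : R) : contC h -> 0 < e -> exists N, forall n, (N <= n)%N ->
    forall t, nc ((h *% q n.+1) t - (h *% b) t) <= e.
  move=> ch e0; pose M := sqn2 m h; have M0 : 0 <= M by exact: sqn2_ge0.
  pose d := e / (M + 1); have M1 : 0 < M + 1 by rewrite ltr_wpDl.
  have d0 : 0 < d by rewrite divr_gt0.
  have [N hN] := qb _ d0; exists N => n Nn t.
  have cqb : contC (fun t => q n.+1 t - b t) by exact: contCB.
  have := sqr_nc_conv_le cG hG mH t (cL ch) (cL cqb).
  rewrite (convC cG hG mH (cL ch) (cL cqb)) (convBl cG hG mH (cL (cq n.+1)) (cL cb) (cL ch)).
  rewrite !(convC cG hG mH _ (cL ch)); try exact: cL.
  move=> h1; rewrite -(@ler_pXn2r _ 2)// ?nnegrE ?nc_ge0 ?(ltW e0)//.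
  apply: le_trans h1 _; rewrite -/M.
  apply: (@le_trans _ _ (M * d ^+ 2)).
    by apply: ler_wpM2l => //; apply: sqn2_le; [exact: cL|exact: hN].
  have -> : e ^+ 2 = (M + 1) ^+ 2 * d ^+ 2 by rewrite -exprMn /d mulrC divfK ?gt_eqF.
  by rewrite ler_wpM2r ?sqr_ge0//; nra.
have eig : (a *% a) *% b = (fun t => rho%:C%C * b t).
  apply/funext => t; apply: lim_eq => e e0.
  have [|N1 h1] := conv_lim (a *% a) (e / 2) (contC_conv cG m ca ca); first by rewrite divr_gt0.
  have [|N2 h2] := qb (e / (2 * rho)); first by rewrite divr_gt0// mulr_gt0.
  have k1 := h1 _ (leq_maxl N1 N2) t.
  have k2 := h2 _ (leq_trans (leq_maxr N1 N2) (leqnSn _)) t.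
  rewrite conv_q in k1; set n := maxn N1 N2 in k1 k2.
  have -> : ((a *% a) *% b) t - rho%:C%C * b t =
    rho%:C%C * (q n.+2 t - b t) - (rho%:C%C * q n.+2 t - ((a *% a) *% b) t) by ring.
  apply: le_trans (ncB _ _) _; rewrite ncM nc_real (ger0_norm (ltW rho0)).
  rewrite [leRHS]splitr; apply: lerD => //.
  apply: (@le_trans _ _ (rho * (e / (2 * rho)))); first by rewrite ler_pM2l.
  by rewrite le_eqVlt; apply/orP; left; apply/eqP; field; rewrite gt_eqF.
(* The eigenvalue equation gives a^(2n+2) *% b = rho^(n+1) b, so convolution by [q n] fixes [b]; in
   the limit [b *% b = b]. *)
have qn_b n : b *% q n = b.
  have cpow_b i : b *% cpow (i + i).+1 = (fun t => (rho ^+ i.+1)%:C%C * b t).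
    elim: i => [|i IH].
      by rewrite (convC cG hG mH (cL cb) (cL (contC_cpow 1))) eig expr1.
    have -> : ((i.+1 + i.+1).+1 = ((i + i).+1 + 1).+1)%N by lia.
    rewrite -cpowD convA//; try exact: contC_cpow.
    rewrite IH (convZl cG hG mH _ (cL cb) (cL (contC_cpow 1))).
    rewrite (convC cG hG mH (cL cb) (cL (contC_cpow 1))) eig; apply/funext => t.
    by rewrite mulrA -rmorphM/= -exprSr.
  have cc := contC_cpow (n + n).+1.
  rewrite (convC cG hG mH (cL cb) (cL (cq n))) (convZl cG hG mH _ (cL cc) (cL cb)).
  rewrite (convC cG hG mH (cL cc) (cL cb)) cpow_b; apply/funext => t.
  by rewrite mulrA -rmorphM/= mulVf ?mul1r// expf_neq0// gt_eqF.
exists b, rho; split => //.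
- apply/funext => t; apply: lim_eq => e e0; rewrite /rev.
  have [|N hN] := qb (e / 2); first by rewrite divr_gt0.
  have h1 := hN N (leqnn N) t; have h2 := hN N (leqnn N) (- t).
  have rq : (q N.+1 (- t))^*%C = q N.+1 t.
    rewrite /q conjCM conjc_real; congr (_ * _).
    by rewrite -[RHS](congr1 (fun f => f t) (rev_cpow _)).
  have -> : (b (- t))^*%C - b t = (q N.+1 t - b t) - (q N.+1 (- t) - b (- t))^*%C.
    by rewrite conjCB rq; ring.
  by apply: le_trans (ncB _ _) _; rewrite ncJ [leRHS]splitr lerD.
- apply/funext => t; apply: lim_eq => e e0.
  have [N hN] := conv_lim b e cb e0.
  by have := hN N (leqnn N) t; rewrite qn_b nc_distC.
(* The values [q n 0] are the [tau n], all at least [l >= 1], so their limit cannot vanish. *)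
- apply/eqP => b0; have [|N hN] := qb (1 / 2); first by rewrite divr_gt0.
  have := hN N (leqnn N) 0; rewrite b0 subr0 /q ncM nck cpow0 nc_real.
  rewrite ger0_norm ?sqn2_ge0// mulrC => h.
  have := le_trans (le_trans l1 (l_le N.+1)) h.
  by rewrite leNgt ltr_pdivrMr// mul1r ltr1n.
Qed.

End power_iteration.

(** * Completeness of the characters *)

Section peter_weyl.
Variables (R : realType) (G : topologicalZmodType).
Hypotheses (cG : compact [set: G]) (hG : hausdorff_space G).
Variable m : probability (borelType G) R.
Hypothesis mH : is_haar m.
Implicit Types f g h chi : G -> R[i].

Local Notation "f *% g" := (Defs.conv m f g) (at level 40, left associativity).
Let cL f (cf : contC f) : L2 m f := contC_L2 m cG cf.

Lemma nc_norm1 (z : R[i]) : (`|z| == 1) = (nc z == 1).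
Proof. by case: z => a b; rewrite normc_def /= eq_complex /= eqxx andbT. Qed.

Lemma dual_contC chi : dual_group R G chi -> contC chi.
Proof. by case=> /continuous_contC. Qed.

Lemma dual_nc chi t : dual_group R G chi -> nc (chi t) = 1.
Proof. by case=> _ _ /(_ t)/eqP; rewrite nc_norm1 => /eqP. Qed.

Lemma dualD chi s t : dual_group R G chi -> chi (s + t) = chi s * chi t.
Proof. by case=> _ H _; exact: H. Qed.

Lemma dual_neq0 chi t : dual_group R G chi -> chi t != 0.
Proof. by move=> Hc; rewrite -nc_gt0 dual_nc. Qed.

Lemma dual0 chi : dual_group R G chi -> chi 0 = 1.
Proof.
move=> Hc; apply: (mulfI (dual_neq0 0 Hc)).
by rewrite -dualD// addr0 mulr1.
Qed.

Lemma dual_mulJ chi t : dual_group R G chi -> chi t * (chi t)^*%C = 1.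
Proof. by move=> Hc; rewrite mulCJ dual_nc// expr1n. Qed.

Lemma dualN chi t : dual_group R G chi -> chi (- t) = (chi t)^*%C.
Proof.
move=> Hc; apply: (mulfI (dual_neq0 t Hc)).
by rewrite -dualD// subrr dual0// dual_mulJ.
Qed.

Lemma integrableCM_bounded f g (k : R) : integrableC m f -> measC g ->
  (forall t, nc (g t) <= k) -> integrableC m (fun t => f t * g t).
Proof.
move=> fi mg gk; apply: (le_integrableC _ (integrableRZ k (integrableC_nc fi))).
  by apply: measCM => //; exact: integrableC_measC fi.
by move=> t; rewrite ncM mulrC; apply: ler_wpM2r; rewrite ?nc_ge0.
Qed.

Lemma fourier_integrableC f chi : dual_group R G chi -> integrableC m f ->
  integrableC m (fun t => f t * (chi t)^*%C).
Proof.
move=> Hc fi; apply: (@integrableCM_bounded _ _ 1) => //.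
  by apply: measCJ; apply: contC_measC; exact: dual_contC.
by move=> t; rewrite ncJ dual_nc.
Qed.

Lemma conv_dual f chi : dual_group R G chi -> integrableC m f ->
  chi *% f = (fun t => fourier m f chi * chi t).
Proof.
move=> Hc fi; apply/funext => t; rewrite mulrC /fourier -integralCZ; last first.
  exact: fourier_integrableC.
by congr integralC; apply/funext => s; rewrite dualD// dualN//; ring.
Qed.

Lemma fourier_conv0 f chi : dual_group R G chi -> contC f ->
  fourier m f chi = (f *% chi) 0.
Proof.
move=> Hc cf; have cc := dual_contC Hc.
rewrite (convC cG hG mH (cL cf) (cL cc)) conv_dual//; last by apply: L2_integrableC; exact: cL.
by rewrite dual0// mulr1.
Qed.

(** A coefficient is the value at 0 of the convolution with [chi], and [chi] is an eigenvector of
    every convolution, so multiplicativity comes down to associativity. *)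
Lemma fourier_conv f g chi : dual_group R G chi -> contC f -> contC g ->
  fourier m (f *% g) chi = fourier m f chi * fourier m g chi.
Proof.
move=> Hc cf cg; have cc := dual_contC Hc.
rewrite fourier_conv0//; last exact: contC_conv.
rewrite -convA// (convC cG hG mH (cL cg) (cL cc)) (conv_dual Hc (L2_integrableC (cL cg))).
rewrite (convC cG hG mH (cL cf) (cL (contCZ _ cc))) (convZl cG hG mH _ (cL cc) (cL cf)).
by rewrite (convC cG hG mH (cL cc) (cL cf)) -fourier_conv0// mulrC.
Qed.

Lemma fourierB f g chi : dual_group R G chi -> integrableC m f -> integrableC m g ->
  fourier m (fun t => f t - g t) chi = fourier m f chi - fourier m g chi.
Proof.
move=> Hc fi gi; rewrite /fourier -integralCB; try exact: fourier_integrableC.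
by congr integralC; apply/funext => t; rewrite mulrBl.
Qed.

Lemma fourierZ c f chi : dual_group R G chi -> integrableC m f ->
  fourier m (fun t => c * f t) chi = c * fourier m f chi.
Proof.
move=> Hc fi; rewrite /fourier -integralCZ; last exact: fourier_integrableC.
by congr integralC; apply/funext => t; rewrite mulrA.
Qed.

Lemma fourierD f g chi : dual_group R G chi -> integrableC m f -> integrableC m g ->
  fourier m (fun t => f t + g t) chi = fourier m f chi + fourier m g chi.
Proof.
move=> Hc fi gi; rewrite /fourier -integralCD; try exact: fourier_integrableC.
by congr integralC; apply/funext => t; rewrite mulrDl.
Qed.

(** * Projections in the convolution algebra *)

Definition fourier_null f : Prop :=
  forall chi, dual_group R G chi -> fourier m f chi = 0.

(* Convolution by [b] is the orthogonal projection onto an ideal of dimension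
   [b 0]. *)
Definition is_projection b : Prop :=
  [/\ contC b, rev b = b, b *% b = b & b 0 != 0].

Lemma projection0 b : is_projection b -> b 0 = (sqn2 m b)%:C%C.
Proof.
case=> cb rb bb _; rewrite -[in LHS]bb -[X in (_ *% X) _]rb.
by rewrite (conv_rev0 cG hG mH (cL cb) (cL cb)) ipxx.
Qed.

Lemma projection_le b t : is_projection b -> nc (b t) <= sqn2 m b.
Proof.
case=> cb rb bb _; rewrite -[in leLHS]bb -(@ler_pXn2r _ 2)// ?nnegrE ?nc_ge0 ?sqn2_ge0//.
rewrite [leRHS]expr2; exact: (sqr_nc_conv_le cG hG mH t (cL cb) (cL cb)).
Qed.

(** With [s] the squared norm, |b| <= s pointwise, hence s <= s^2. This is the unit by which the
    descent decreases. *)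
Lemma projection_sqn2_ge1 b : is_projection b -> 1 <= sqn2 m b.
Proof.
move=> pb; have [cb _ _ b0] := pb; have s0 := sqn2_gt0 cG mH cb b0.
rewrite -(ler_pM2l s0) mulr1 -expr2; apply: sqn2_le; first exact: cL.
by move=> t; exact: projection_le.
Qed.

Lemma rev_inj_eq f t : rev f = f -> (f (- t))^*%C = f t.
Proof. by move=> {2}<-. Qed.

Lemma conv_shift f g t : (fun s => f (t + s)) *% g = (fun s => (f *% g) (t + s)).
Proof.
by apply/funext => x; congr integralC; apply/funext => s; rewrite addrA.
Qed.

(** Power iteration on [d] yields a projection [b'] with [rho b' = (d *% d) *% b']. It lies under
    [b] because [d] does, so [b' = b] by minimality, and then [d *% d = (d *% d) *% b = rho b]. *)
Lemma projection_sub_square b d : is_projection b -> contC d -> rev d = d ->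
  d *% b = d -> (forall b', is_projection b' -> b' *% b = b' -> b' = b) ->
  exists c : R[i], d *% d = (fun t => c * b t).
Proof.
move=> pb cd rd db bmin; have [cb rb bb b0] := pb.
have [d0|/existsNP[x /eqP dx]] := pselect (forall x, d x = 0).
  exists 0; apply/funext => t; rewrite mul0r -[RHS](integralC_cst m).
  by congr integralC; apply/funext => s; rewrite !d0 mulr0.
have [b' [rho [cb' rb' bb' b'0 [eig rho0]]]] :=
  power_iteration cG hG mH cd rd (ex_intro _ x dx).
have cdd : contC (d *% d) by exact: contC_conv.
have ddb : (d *% d) *% b = d *% d by rewrite -convA// db.
have rhoC0 : rho%:C%C != 0 by rewrite -nc_eq0 nc_real normr_eq0 gt_eqF.
have b'b : b' *% b = b'.
  apply/funext => t; apply: (mulfI rhoC0).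
  have E : (fun t => rho%:C%C * b' t) *% b = (fun t => rho%:C%C * b' t).
    rewrite -eig -(convA cG hG mH cdd cb' cb) (convC cG hG mH (cL cb') (cL cb)).
    by rewrite (convA cG hG mH cdd cb cb') ddb.
  have := congr1 (fun f => f t) E.
  by rewrite (convZl cG hG mH _ (cL cb') (cL cb)).
have -> : b = b' by apply/esym/bmin.
by exists rho%:C%C; rewrite -eig -[in LHS]ddb; congr (_ *% _); apply/esym/bmin.
Qed.

(* Polarization: compare the squares of [d] and of [d + b]. *)
Lemma projection_sub_scalar b d : is_projection b -> contC d -> rev d = d ->
  d *% b = d -> (forall b', is_projection b' -> b' *% b = b' -> b' = b) ->
  exists c : R[i], d = (fun t => c * b t).
Proof.
move=> pb cd rd db bmin; have [cb rb bb b0] := pb.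
have [c0 dd] := projection_sub_square pb cd rd db bmin.
have cdb : contC (fun t => d t + b t) by exact: contCD.
have dbE : (fun t => d t + b t) *% b = (fun t => d t + b t).
  by rewrite (convDl cG hG mH (cL cd) (cL cb) (cL cb)) db bb.
have rdb : rev (fun t => d t + b t) = (fun t => d t + b t).
  apply/funext => t; rewrite -[in RHS]rd -[in RHS]rb; exact: rmorphD.
have [c1 dbdb] := projection_sub_square pb cdb rdb dbE bmin.
(* Solved from (d + b)^2 = d^2 + 2 d + b, that is, c1 b = c0 b + 2 d + b. *)
exists ((c1 - c0 - 1) / 2); apply/funext => t.
have := congr1 (fun f => f t) dbdb.
rewrite (convDl cG hG mH (cL cd) (cL cb) (cL cdb)).
rewrite (convC cG hG mH (cL cd) (cL cdb)) (convC cG hG mH (cL cb) (cL cdb)) dbE.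
rewrite (convDl cG hG mH (cL cd) (cL cb) (cL cd)) dd.
rewrite (convC cG hG mH (cL cb) (cL cd)) db => E.
have -> : d t = ((c0 * b t + d t + (d t + b t)) - c0 * b t - b t) / 2.
  by field.
by rewrite E; field.
Qed.

(** A translate of [b] is fixed by convolution with [b] but need not be hermitian; its two hermitian
    parts, made from the translates by [t] and [- t], are multiples of [b], hence so is the
    translate. Evaluation at 0 gives [b (t + s) * b 0 = b t * b s]. The modulus is 1 because it is
    at most 1 and the values at [t] and [- t] multiply to 1. *)
Lemma minimal_projection_dual b : is_projection b ->
  (forall b', is_projection b' -> b' *% b = b' -> b' = b) ->
  dual_group R G (fun t => b t / b 0).
Proof.
move=> pb bmin; have [cb rb bb b0] := pb.
have csh t : contC (fun s => b (t + s)) by exact: contC_shift.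
have shb t : (fun s => b (t + s)) *% b = (fun s => b (t + s)).
  by rewrite conv_shift bb.
have revb t s : (b (t - s))^*%C = b (- t + s).
  by rewrite -(rev_inj_eq (- t + s) rb) opprD opprK.
have scal t : exists c : R[i], (fun s => b (t + s)) = (fun s => c * b s).
  have [c1 E1] : exists c : R[i], (fun s => b (t + s) + b (- t + s)) = (fun s => c * b s).
    apply: projection_sub_scalar => //; first exact: contCD.
    - apply/funext => s; rewrite /rev conjCD !revb opprK.
      exact: addrC.
    - by rewrite (convDl cG hG mH (cL (csh t)) (cL (csh (- t))) (cL cb)) !shb.
  have [c2 E2] : exists c : R[i],
      (fun s => 'i%C * (b (t + s) - b (- t + s))) = (fun s => c * b s).
    have cB : contC (fun s => b (t + s) - b (- t + s)) by exact: contCB.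
    apply: projection_sub_scalar => //; first exact: contCZ.
    - apply/funext => s; rewrite /rev conjCM conjCB !revb opprK.
      by apply: eqC; rewrite !ReImE /=; ring.
    - rewrite (convZl cG hG mH _ (cL cB) (cL cb)).
      by rewrite (convBl cG hG mH (cL (csh t)) (cL (csh (- t))) (cL cb)) !shb.
  exists ((c1 - 'i%C * c2) / 2); apply/funext => s.
  have e1 := congr1 (fun f => f s) E1; have e2 := congr1 (fun f => f s) E2.
  rewrite /= in e1 e2.
  have -> : (c1 - 'i%C * c2) / 2 * b s = (c1 * b s - 'i%C * (c2 * b s)) / 2 by field.
  rewrite -e1 -e2.
  have -> : 'i%C * ('i%C * (b (t + s) - b (- t + s))) = - (b (t + s) - b (- t + s)).
    by rewrite mulrA -expr2 sqr_i mulN1r.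
  by field.
have mulb t s : b (t + s) * b 0 = b t * b s.
  have [c E] := scal t; have e0 := congr1 (fun f => f 0) E.
  have es := congr1 (fun f => f s) E; rewrite /= addr0 in e0 es.
  by rewrite es e0; ring.
have hom s t : b (s + t) / b 0 = (b s / b 0) * (b t / b 0).
  by apply: (mulIf b0); rewrite divfK// mulrACA -mulb -mulrA -mulrA; field.
have le1 t : nc (b t / b 0) <= 1.
  rewrite ncM ncV ler_pdivrMr ?nc_gt0// mul1r.
  rewrite [leRHS](_ : _ = sqn2 m b); first exact: projection_le.
  by rewrite (projection0 pb) nc_real ger0_norm ?sqn2_ge0.
split.
- apply/continuous_contC; have := contCZ (b 0)^-1 cb.
  by under eq_fun do rewrite mulrC.
- exact: hom.
- move=> t; apply/eqP; rewrite nc_norm1 eq_le le1 /=.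
  have : nc (b t / b 0) * nc (b (- t) / b 0) = 1.
    by rewrite -ncM -hom subrr divff// nc1.
  move=> E; rewrite -E -[leRHS]mulr1; apply: ler_wpM2l; rewrite ?nc_ge0//.
Qed.

(* A proper subprojection [b'] of [b] leaves a projection [b - b'], of squared
   norm at least 1, so the squared norm drops by at least 1 from [b] to [b']. *)
Lemma no_fourier_null_projection b : is_projection b -> ~ fourier_null b.
Proof.
move=> pb nb; have := Num.Theory.archi_boundP (sqn2_ge0 m b).
move: (Num.Def.archi_bound _) => n; elim: n b pb nb => [|n IH] b pb nb sb.
  by have := sqn2_ge0 m b; rewrite leNgt sb.
have [cb rb bb b0] := pb.
have bmin b' : is_projection b' -> b' *% b = b' -> b' = b.
  move=> pb' b'b; have [cb' rb' bb' b'0] := pb'.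
  have [//|nbb'] := pselect (b' = b); exfalso.
  have nb' : fourier_null b'.
    by move=> chi Hc; rewrite -b'b fourier_conv// (nb _ Hc) mulr0.
  pose e t := b t - b' t.
  have ce : contC e by exact: contCB.
  have [x ex] : exists x, e x != 0.
    apply: contrapT => /forallNP H; apply: nbb'; apply/funext => x.
    have /negP := H x; rewrite negbK subr_eq0 => /eqP; exact: esym.
  have re : rev e = e.
    apply/funext => t; rewrite /rev conjCB.
    by rewrite (rev_inj_eq t rb) (rev_inj_eq t rb').
  have ee : e *% e = e.
    rewrite {1}/e (convBl cG hG mH (cL cb) (cL cb') (cL ce)).
    rewrite (convC cG hG mH (cL cb) (cL ce)) (convC cG hG mH (cL cb') (cL ce)).
    rewrite {1 2}/e !(convBl cG hG mH (cL cb) (cL cb') (cL _))//.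
    rewrite (convC cG hG mH (cL cb) (cL cb')) bb bb' b'b.
    by apply/funext => t; rewrite subrr subr0.
  have e0 : e 0 != 0.
    rewrite -ee -[X in (_ *% X) _]re (conv_rev0 cG hG mH (cL ce) (cL ce)) ipxx.
    by rewrite -nc_eq0 nc_real normr_eq0 gt_eqF//; exact: (sqn2_gt0 cG mH ce ex).
  have pe : is_projection e by split.
  have : b 0 = e 0 + b' 0 by rewrite /e subrK.
  rewrite (projection0 pb) (projection0 pe) (projection0 pb') -rmorphD => -[Es].
  apply: (IH b' pb' nb'); have := projection_sqn2_ge1 pe.
  by move: sb; rewrite Es -natr1; lra.
(* The coefficient of [b] at this character is the squared norm of [b] divided by the conjugate of
   [b 0], which is not zero. *)
have /nb := minimal_projection_dual pb bmin.
rewrite /fourier.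
have -> : (fun t => b t * (b t / b 0)^*%C) = (fun t => ((b 0)^-1)^*%C * (b t * (b t)^*%C)).
  by apply/funext => t; rewrite conjCM; ring.
rewrite integralCZ; last by apply: ip_integrableC; exact: cL.
rewrite -/(ip m b b) ipxx => /eqP; rewrite mulf_eq0 conjc_eq0 invr_eq0 (negbTE b0) /=.
by rewrite -nc_eq0 nc_real normr_eq0 gt_eqF//; exact: (sqn2_gt0 cG mH cb b0).
Qed.

(** If [f] is not zero, the hermitian function [rev f *% f] is positive at 0. The projection [b]
    obtained from it satisfies [rho b = (a *% a) *% b], so its coefficients are multiples of those
    of [f] and vanish. *)
Theorem fourier_null_eq0 f : contC f -> fourier_null f -> forall t, f t = 0.
Proof.
move=> cf nf t; apply: contrapT => /eqP ft.
have crf := contC_rev cf; pose a := rev f *% f.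
have ca : contC a by exact: contC_conv.
have rrf : rev (rev f) = f by apply/funext => s; rewrite /rev opprK conjcK.
have ra : rev a = a.
  rewrite (rev_conv cG hG mH (cL crf) (cL cf)) rrf.
  exact: (convC cG hG mH (cL cf) (cL crf)).
have a0 : a 0 != 0.
  rewrite /a (convC cG hG mH (cL crf) (cL cf)) (conv_rev0 cG hG mH (cL cf) (cL cf)) ipxx.
  by rewrite -nc_eq0 nc_real normr_eq0 gt_eqF//; exact: (sqn2_gt0 cG mH cf ft).
have [b [rho [cb rb bb b0 [eig rho0]]]] :=
  power_iteration cG hG mH ca ra (ex_intro _ 0 a0).
apply: (@no_fourier_null_projection b) => // chi Hc.
have caa : contC (a *% a) by exact: contC_conv.
have rhoC0 : rho%:C%C != 0 by rewrite -nc_eq0 nc_real normr_eq0 gt_eqF.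
apply: (mulfI rhoC0); rewrite mulr0 -fourierZ//; last by apply: L2_integrableC; exact: cL.
rewrite -eig !fourier_conv// ?(nf _ Hc).
by rewrite !mulr0 mul0r.
Qed.

End peter_weyl.

(** * Trigonometric polynomials *)

(** The index set may be uncountable, so summability is expressed by finite lists. [F0] nearly
    attains the supremum of the finite sums, and a list disjoint from it can add at most [e]. *)
Lemma bounded_sums_tail (R : realType) (I : eqType) (D : I -> Prop) (a : I -> R)
  (N : R) : (forall i, 0 <= a i) ->
  (forall F : seq I, uniq F -> (forall i, i \in F -> D i) -> \sum_(i <- F) a i <= N) ->
  forall e : R, 0 < e -> exists F0 : seq I,
    [/\ uniq F0, forall i, i \in F0 -> D i &
      forall F : seq I, uniq F -> (forall i, i \in F -> D i) ->
        (forall i, i \in F -> i \notin F0) -> \sum_(i <- F) a i <= e].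
Proof.
move=> a0 aN e e0.
pose S := [set x : R | exists2 F : seq I, uniq F /\ (forall i, i \in F -> D i) &
  x = \sum_(i <- F) a i].
have hS : has_sup S.
  split; first by exists 0, [::]; rewrite ?big_nil.
  by exists N => _ [F [uF DF] ->]; exact: aN.
have [_ [F0 [uF0 DF0] ->] hF0] := sup_adherent e0 hS.
exists F0; split=> // F uF DF FF0.
have : \sum_(i <- F0 ++ F) a i <= sup S.
  apply: ub_le_sup; first by case: hS.
  exists (F0 ++ F) => //; split.
    rewrite cat_uniq uF0 uF andbT /=; apply/hasPn => i iF; exact: FF0.
  by move=> i; rewrite mem_cat => /orP[/DF0|/DF].
by rewrite big_cat /=; move: hF0; lra.
Qed.

Section trigonometric_polynomials.
Variables (R : realType) (G : topologicalZmodType).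
Hypotheses (cG : compact [set: G]) (hG : hausdorff_space G).
Variable m : probability (borelType G) R.
Hypothesis mH : is_haar m.
Implicit Types (f g h chi psi : G -> R[i]) (c : (G -> R[i]) -> R[i]).
Implicit Types F : seq (G -> R[i]).

Local Notation "f *% g" := (Defs.conv m f g) (at level 40, left associativity).
Let cL f (cf : contC f) : L2 m f := contC_L2 m cG cf.

Definition dual_seq F : Prop :=
  uniq F /\ forall chi, chi \in F -> dual_group R G chi.

Definition trig c F : G -> R[i] := fun t => \sum_(chi <- F) c chi * chi t.

(** Translation by [t] multiplies the integral of chi times the conjugate of psi by the value of
    that product at [t], which differs from 1 for some [t] when the characters are distinct. *)
Lemma fourier_dual chi psi : dual_group R G chi -> dual_group R G psi ->
  fourier m chi psi = (chi == psi)%:R.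
Proof.
move=> Hc Hp; have cc := dual_contC Hc; have cp := dual_contC Hp.
have [<-|ne] := eqVneq chi psi.
  rewrite /fourier -[RHS](integralC_cst m); congr integralC; apply/funext => t.
  exact: dual_mulJ.
have [t ct] : exists t, chi t != psi t.
  apply: contrapT => /forallNP H; move/eqP: ne; apply; apply/funext => t.
  by have /negP := H t; rewrite negbK => /eqP.
pose w t := chi t * (psi t)^*%C.
have iw : integrableC m w by apply: fourier_integrableC => //; exact/L2_integrableC/cL.
have wt : w t != 1.
  apply: contra ct => /eqP E; rewrite -[chi t]mulr1 -(dual_mulJ t Hp).
  by rewrite [psi t * _]mulrC mulrA -/(w t) E mul1r.
have : integralC m w = w t * integralC m w.
  rewrite -integralCZ// -[LHS](preserving_integralC (preserving_shift t mH) iw).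
  by congr integralC; apply/funext => s; rewrite /w !dualD// conjCM; ring.
move/eqP; rewrite -subr_eq0 -{1}[integralC m w]mul1r -mulrBl mulf_eq0.
by rewrite subr_eq0 eq_sym (negbTE wt) /= => /eqP.
Qed.

Lemma contC_trig c F : dual_seq F -> contC (trig c F).
Proof.
move=> [_]; rewrite /trig; elim: F => [|chi F IH] DF.
  by under eq_fun do rewrite big_nil; exact: contC_cst.
under eq_fun do rewrite big_cons.
apply: contCD; first by apply/contCZ/dual_contC/DF; rewrite mem_head.
by apply: IH => psi pF; apply: DF; rewrite in_cons pF orbT.
Qed.

Lemma ip_trig f c F : dual_seq F -> integrableC m f ->
  ip m f (trig c F) = \sum_(chi <- F) (c chi)^*%C * fourier m f chi.
Proof.
move=> [_]; rewrite /ip /trig; elim: F => [|chi F IH] DF fi.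
  rewrite big_nil -[RHS](integralC_cst m); congr integralC; apply/funext => t.
  by rewrite big_nil conjc0 mulr0.
have Hc : dual_group R G chi by apply: DF; rewrite mem_head.
have DF' psi : psi \in F -> dual_group R G psi.
  by move=> pF; apply: DF; rewrite in_cons pF orbT.
rewrite big_cons -IH// -integralCZ; last exact: fourier_integrableC.
rewrite -integralCD.
- congr integralC; apply/funext => t; rewrite big_cons conjCD conjCM; ring.
- by apply: integrableCZ; exact: fourier_integrableC.
- elim: F {IH DF} DF' => [|psi F IH] DF.
    by under eq_fun do rewrite big_nil conjc0 mulr0; exact: integrableC_cst.
  have -> : (fun t => f t * (\sum_(j <- psi :: F) c j * j t)^*%C) =
     (fun t => (c psi)^*%C * (f t * (psi t)^*%C) + f t * (\sum_(j <- F) c j * j t)^*%C).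
    by apply/funext => t; rewrite big_cons conjCD conjCM; ring.
  apply: integrableCD.
    by apply/integrableCZ/fourier_integrableC => //; apply: DF; rewrite mem_head.
  by apply: IH => j jF; apply: DF; rewrite in_cons jF orbT.
Qed.

Lemma fourier_trig c F psi : dual_seq F -> dual_group R G psi ->
  fourier m (trig c F) psi = if psi \in F then c psi else 0.
Proof.
move=> [uF DF] Hp; rewrite /trig; elim: F uF DF => [|chi F IH] /=.
  move=> _ _; rewrite -[RHS](integralC_cst m); congr integralC.
  by apply/funext => t; rewrite big_nil mul0r.
move=> /andP[cF uF] DF.
have Hc : dual_group R G chi by apply: DF; rewrite mem_head.
have DF' j : j \in F -> dual_group R G j by move=> jF; apply: DF; rewrite in_cons jF orbT.
under eq_fun do rewrite big_cons.
have ic : integrableC m chi by apply/L2_integrableC/cL/dual_contC.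
rewrite fourierD ?fourierZ//; last 2 first.
- exact: integrableCZ.
- by apply/L2_integrableC/cL/contC_trig.
rewrite IH// fourier_dual// in_cons eq_sym.
have [->|_] := eqVneq psi chi; last by rewrite mulr0 add0r.
by rewrite (negbTE cF) mulr1 addr0.
Qed.

Lemma sqn2_trig c F : dual_seq F -> sqn2 m (trig c F) = \sum_(chi <- F) nc (c chi) ^+ 2.
Proof.
move=> DF; apply: (@complexI R); rewrite -ipxx ip_trig//; last first.
  by apply/L2_integrableC/cL/contC_trig.
rewrite rmorph_sum/= big_seq [RHS]big_seq; apply: eq_bigr => chi cF.
by rewrite fourier_trig ?cF//; [rewrite mulrC mulCJ|case: DF => _; apply].
Qed.

Lemma sqn2_sub_trig f F : dual_seq F -> L2 m f ->
  sqn2 m (fun t => f t - trig (fourier m f) F t) =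
  sqn2 m f - \sum_(chi <- F) nc (fourier m f chi) ^+ 2.
Proof.
move=> DF fi; set g := trig _ _.
have gi : L2 m g by apply/cL/contC_trig.
have -> : (fun t => f t - g t) = (fun t => f t - 1 * g t).
  by apply/funext => t; rewrite mul1r.
rewrite sqn2_expand// mul1r nc1 expr1n mul1r sqn2_trig// (ipC fi gi) ReJ.
rewrite ip_trig//; last exact: L2_integrableC.
have -> : Re (\sum_(chi <- F) (fourier m f chi)^*%C * fourier m f chi) =
    \sum_(chi <- F) nc (fourier m f chi) ^+ 2.
  by rewrite Re_sum; apply: eq_bigr => chi _; rewrite mulrC mulCJ.
ring.
Qed.

Lemma bessel f F : dual_seq F -> L2 m f ->
  \sum_(chi <- F) nc (fourier m f chi) ^+ 2 <= sqn2 m f.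
Proof. by move=> DF fi; rewrite -subr_ge0 -sqn2_sub_trig// sqn2_ge0. Qed.

Lemma nc_trig_le c F t : dual_seq F -> nc (trig c F t) <= \sum_(chi <- F) nc (c chi).
Proof.
move=> [_ DF]; apply: le_trans (nc_sum _ _ _) _.
rewrite big_seq [leRHS]big_seq; apply: ler_sum => chi cF.
by rewrite ncM dual_nc ?mulr1//; exact: DF.
Qed.

Lemma trig_diff c F F' t : dual_seq F -> dual_seq F' ->
  trig c F t - trig c F' t =
  trig c [seq chi <- F | chi \notin F'] t - trig c [seq chi <- F' | chi \notin F] t.
Proof.
move=> [uF _] [uF' _].
have spl (E E' : seq (G -> R[i])) : trig c E t = trig c [seq chi <- E | chi \notin E'] t +
    trig c [seq chi <- E | chi \in E'] t.
  by rewrite /trig !big_filter addrC (bigID (fun chi => chi \in E')).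
rewrite (spl F F') (spl F' F).
have -> : trig c [seq chi <- F | chi \in F'] t = trig c [seq chi <- F' | chi \in F] t.
  apply: perm_big; apply: uniq_perm; rewrite ?filter_uniq// => chi.
  by rewrite !mem_filter andbC.
ring.
Qed.

Lemma dual_seq_filter (p : pred (G -> R[i])) F : dual_seq F -> dual_seq [seq chi <- F | p chi].
Proof.
move=> [uF DF]; split; first exact: filter_uniq.
by move=> chi; rewrite mem_filter => /andP[_ /DF].
Qed.

(** A sequence of lists suffices even for an uncountable dual: lists leaving tails at most 1/(n+1)
    and 1/(k+1) have partial sums that differ by at most the sum of these tails, uniformly in
    [t]. *)
Lemma absolutely_summable_trig c (N : R) :
  (forall F, dual_seq F -> \sum_(chi <- F) nc (c chi) <= N) ->
  exists q, [/\ contC q,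
    forall chi, dual_group R G chi -> fourier m q chi = c chi &
    forall e : R, 0 < e -> exists2 F, dual_seq F & forall t, nc (q t - trig c F t) <= e].
Proof.
move=> cN.
have tail (n : nat) : exists F0, dual_seq F0 /\ forall F, dual_seq F ->
    (forall chi, chi \in F -> chi \notin F0) -> \sum_(chi <- F) nc (c chi) <= n.+1%:R^-1.
  have e0 : 0 < n.+1%:R^-1 :> R by rewrite invr_gt0.
  have [F0 [uF DF H]] := @bounded_sums_tail R _ (dual_group R G) (fun chi => nc (c chi)) N
    (fun chi => nc_ge0 _) (fun F uF DF => cN F (conj uF DF)) _ e0.
  by exists F0; split=> // F [uF' DF']; exact: H.
pose E n := projT1 (cid (tail n)).
have DE n : dual_seq (E n) by case: (projT2 (cid (tail n))).
have HE n F : dual_seq F -> (forall chi, chi \in F -> chi \notin E n) ->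
    \sum_(chi <- F) nc (c chi) <= n.+1%:R^-1.
  by case: (projT2 (cid (tail n))) => _; apply.
have inv_le (n k : nat) : (n <= k)%N -> (k.+1%:R^-1 <= n.+1%:R^-1 :> R).
  by move=> nk; rewrite lef_pV2 ?posrE// ler_nat.
have close n k t : nc (trig c (E n) t - trig c (E k) t) <= k.+1%:R^-1 + n.+1%:R^-1.
  rewrite (trig_diff c t (DE n) (DE k)); apply: le_trans (ncB _ _) _; apply: lerD.
    apply: le_trans (nc_trig_le _ _ (dual_seq_filter _ (DE n))) _.
    apply: HE; first exact: dual_seq_filter.
    by move=> chi; rewrite mem_filter => /andP[].
  apply: le_trans (nc_trig_le _ _ (dual_seq_filter _ (DE k))) _.
  apply: HE; first exact: dual_seq_filter.
  by move=> chi; rewrite mem_filter => /andP[].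
have small (e : R) : 0 < e -> exists n : nat, n.+1%:R^-1 <= e.
  move=> e0; exists (Num.Def.archi_bound e^-1).
  rewrite invf_ple ?posrE//; apply: ltW; apply: lt_le_trans (archi_boundP _) _.
    by rewrite invr_ge0 ltW.
  by rewrite ler_nat.
have cauchyE (e : R) : 0 < e -> exists N0 : nat, forall n k, (N0 <= n)%N -> (N0 <= k)%N ->
    forall t, nc (trig c (E n) t - trig c (E k) t) <= e.
  move=> e0; have [|N0 hN0] := small (e / 2); first by rewrite divr_gt0.
  exists N0 => n k Nn Nk t; apply: le_trans (close n k t) _.
  by rewrite [leRHS]splitr; apply: lerD; apply: le_trans hN0; exact: inv_le.
have [q cq qE] := contC_complete (fun n => contC_trig c (DE n)) cauchyE.
exists q; split => //; last first.
  by move=> e e0; have [N0 hN0] := qE _ e0; exists (E N0) => // t; rewrite nc_distC hN0.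
move=> chi Hc; apply/eqP; rewrite -subr_eq0 -nc_eq0 eq_le nc_ge0 andbT.
apply/ler_addgt0Pr => e e0; rewrite add0r.
have e20 : 0 < e / 2 by rewrite divr_gt0.
have [N1 h1] := qE _ e20; have [N2 h2] := small _ e20.
set n := maxn N1 N2; have cE := contC_trig c (DE n).
have iq := L2_integrableC (cL cq); have iE := L2_integrableC (cL cE).
have -> : fourier m q chi - c chi = fourier m (fun t => q t - trig c (E n) t) chi
    + (fourier m (trig c (E n)) chi - c chi).
  by rewrite fourierB//; ring.
apply: le_trans (ncD _ _) _; rewrite [leRHS]splitr; apply: lerD.
  apply: nc_integralC_bounded => [|t].
    apply: measCM; first by apply: contC_measC; exact: contCB.
    by apply: measCJ; apply: contC_measC; exact: dual_contC.
  by rewrite ncM ncJ dual_nc// mulr1 nc_distC; apply: h1; exact: leq_maxl.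
rewrite (fourier_trig c (DE n) Hc); case: ifPn => cE'; first by rewrite subrr nc0 ltW.
(* A character missed by [E n] is by itself a tail, so its coefficient is at most 1/(n+1). *)
rewrite sub0r ncN; apply: (@le_trans _ _ (\sum_(psi <- [:: chi]) nc (c psi))).
  by rewrite big_seq1.
apply: (@le_trans _ _ n.+1%:R^-1).
  apply: HE; first by split => // psi; rewrite inE => /eqP ->.
  by move=> psi; rewrite inE => /eqP ->.
by apply: le_trans h2; apply: inv_le; exact: leq_maxr.
Qed.

(** The coefficients of [f *% g] are products of square-summable families, hence absolutely
    summable; by uniqueness the continuous sum of their series is [f *% g]. *)
Lemma conv_approx f g (e : R) : contC f -> contC g -> 0 < e ->
  exists c F, dual_seq F /\ forall t, nc ((f *% g) t - trig c F t) <= e.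
Proof.
move=> cf cg e0; have cfg := contC_conv cG m cf cg.
pose c chi := fourier m f chi * fourier m g chi.
have cN F : dual_seq F -> \sum_(chi <- F) nc (c chi) <= sqn2 m f + sqn2 m g.
  move=> DF; apply: le_trans (lerD (bessel DF (cL cf)) (bessel DF (cL cg))).
  rewrite -big_split; apply: ler_sum => chi _; rewrite ncM /=.
  have := sqr_ge0 (nc (fourier m f chi) - nc (fourier m g chi)).
  have := mulr_ge0 (nc_ge0 (fourier m f chi)) (nc_ge0 (fourier m g chi)).
  nra.
have [q [cq qc qa]] := absolutely_summable_trig cN.
have fgq t : (f *% g) t = q t.
  apply/eqP; rewrite -subr_eq0; apply/eqP.
  apply: (fourier_null_eq0 cG hG mH (f := fun t => (f *% g) t - q t)).
    exact: contCB.
  move=> chi Hc; rewrite fourierB//; try by apply: L2_integrableC; exact: cL.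
  by rewrite qc// (fourier_conv cG hG mH Hc cf cg) subrr.
have [F DF qF] := qa _ e0; exists c, F; split => // t.
by rewrite fgq.
Qed.

(** Convolve [u] with a normalized bump [phi] near 0: uniform continuity keeps [u *% phi] close to
    [u], and [conv_approx] handles [u *% phi]. *)
Lemma trig_dense u (e : R) : contC u -> 0 < e ->
  exists c F, dual_seq F /\ forall t, nc (u t - trig c F t) <= e.
Proof.
move=> cu e0; have e20 : 0 < e / 2 by rewrite divr_gt0.
have : nbhs (0 : G) [set s | forall t, nc (u (t + s) - u t) < e / 2].
  exact: (contC_unif_cont cG cu).
rewrite nbhsE => -[U [Uo U0] UH].
(* The convolution evaluates [u] at [t - s], so the bump must live where [- s] lies in [U]. *)
have Vo : open (-%R @^-1` U) by move/continuousP : (@opp_continuous G); apply.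
have c0 : closed [set (0 : G)] by apply: compact_closed => //; exact: compact_set1.
have [|v [cv v01 v1 vU]] := @urysohn_compact R G cG hG _ _ c0 Vo.
  by move=> x ->; rewrite /= oppr0.
pose w t := (v t)%:C%C.
have cw : contC w by exact: contC_real.
have v0 t : 0 <= v t by case/andP: (v01 t).
have ncw t : nc (w t) = v t by rewrite nc_real ger0_norm.
have iw := L2_integrableC (cL cw).
pose I := \int[m]_(t in [set: borelType G]) v t.
have I0 : 0 < I.
  have w0 : w 0 != 0 by rewrite -nc_eq0 ncw v1// oner_eq0.
  apply: lt_le_trans (sqn2_gt0 cG mH cw w0) _; apply: le_Rintegral => //.
  - by case: (cL cw).
  - by case: iw.
  - move=> t _; rewrite ncw expr2 ler_piMr//; by case/andP: (v01 t).
have IC : integralC m w = I%:C%C by apply: eqC => //=; rewrite intR_cst.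
have IC0 : I%:C%C != 0 by rewrite -nc_eq0 nc_real normr_eq0 gt_eqF.
pose phi t := (I^-1)%:C%C * w t.
have cphi : contC phi by exact: contCZ.
have [c [F [DF H]]] := conv_approx cu cphi e20.
exists c, F; split => // t.
have -> : u t - trig c F t = ((u *% phi) t - trig c F t) - ((u *% phi) t - u t) by ring.
apply: le_trans (ncB _ _) _; rewrite [leRHS]splitr; apply: lerD => //.
have iphi := L2_integrableC (cL cphi).
have iuphi := conv_integrableC cG hG mH t (cL cu) (cL cphi).
have -> : (u *% phi) t - u t = integralC m (fun s => u (t - s) * phi s - u t * phi s).
  rewrite integralCB//; last exact: integrableCZ.
  by rewrite [X in _ = _ - X]integralCZ// integralCZ// IC -rmorphM/= mulVf ?gt_eqF// mulr1.
have -> : e / 2 = \int[m]_(s in [set: borelType G]) (e / 2 * I^-1 * v s).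
  by rewrite RintegralZl//; [rewrite -/I divfK// gt_eqF|case: iw].
apply: nc_integralC_le.
- by apply: integrableCB => //; exact: integrableCZ.
- by apply: integrableRZ; case: iw.
move=> s; rewrite -mulrBl ncM /phi ncM ncw nc_real ger0_norm ?invr_ge0 ?(ltW I0)//.
rewrite mulrA; have [Us|nU] := pselect (U (- s)).
  apply: ler_wpM2r => //; apply: ler_wpM2r; first by rewrite invr_ge0 ltW.
  by apply/ltW; exact: UH.
by rewrite vU// !mulr0.
Qed.

End trigonometric_polynomials.

(** * Approximation of bounded measurable functions *)

Section approximation.
Variables (R : realType) (G : topologicalZmodType).
Hypotheses (cG : compact [set: G]) (hG : hausdorff_space G).
Variable m : probability (borelType G) R.
Hypothesis mH : is_haar m.

Local Notation integrableR u :=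
  (m.-integrable [set: borelType G] (fun t : borelType G => (u t)%:E)).
Local Notation intR u := (\int[m]_(t in [set: borelType G]) u t).

Lemma haar_outer (A : set G) (d : R) : measurable (A : set (borelType G)) -> 0 < d ->
  exists U : set G, [/\ open U, A `<=` U & (m (U `\` A) < d%:E)%E].
Proof.
move=> mA d0; have [_ mo _] := mH.
have fA : m A \is a fin_num by exact: fin_num_measure.
have : (m A < m A + d%:E)%E by rewrite -(fineK fA) -EFinD lte_fin ltrDl.
rewrite {1}mo// => /ereal_inf_lt[_ [U [oU AU] <-] mU]; exists U; split => //.
have mU' := open_measurableG oU.
have := @measureD _ _ _ m U A mU' mA; rewrite setIidr// => ->.
  by rewrite lteBlDr// addeC.
by rewrite ltey_eq fin_num_measure.
Qed.

Variable w : G -> R.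
Hypotheses (w_ge0 : forall t, 0 <= w t) (w_int : integrableR w).

Let w_meas : measurable_fun [set: borelType G] (w : borelType G -> R).
Proof. by move/measurable_int/measurable_EFinP : w_int. Qed.

Let weighted_int (h : G -> R) :
  measurable_fun [set: borelType G] (h : borelType G -> R) ->
  (forall t, `|h t| <= 1) -> integrableR (fun t => w t * `|h t|).
Proof.
move=> mh h1; apply: (integrableR_le _ _ w_int).
  by apply: measurable_funM => //; exact: measurableT_comp.
by move=> t; rewrite ger0_norm ?mulr_ge0// ler_piMr.
Qed.

Let continuous_meas (u : G -> R) : continuous u ->
  measurable_fun [set: borelType G] (u : borelType G -> R).
Proof. by move=> cu; case: (contC_measC (contC_real cu)). Qed.

(** Take open sets [U] and [V] slightly larger than [A] and its complement, and a Urysohn function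
    equal to 1 off [V] and to 0 off [U]. It differs from the indicator only on their intersection,
    and absolute continuity of the integral of [w] turns small measure into small weighted error. *)
Lemma approx_indic (A : set G) (e : R) : measurable (A : set (borelType G)) -> 0 < e ->
  exists u : G -> R, [/\ continuous u, forall t, 0 <= u t <= 1 &
    intR (fun t => w t * `|\1_A t - u t|) <= e].
Proof.
move=> mA e0; have [d [d0 wd]] := integral_normr_continuous w_int e0.
have d20 : 0 < d / 2 by rewrite divr_gt0.
have [U [oU AU mU]] := haar_outer mA d20.
have mA' : measurable (~` A : set (borelType G)) by exact: measurableC.
have [V [oV AV mV]] := haar_outer mA' d20.
have cV : closed (~` V) by exact: open_closedC.
have VU : ~` V `<=` U.
  by move=> x nV; apply: AU; apply: contrapT => nA; apply: nV; exact: AV.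
have [u [cu u01 u1 u0]] := @urysohn_compact R G cG hG _ _ cV oU VU.
exists u; split => //.
have mU' := open_measurableG oU; have mV' := open_measurableG oV.
pose E : set G := U `&` V.
have mE : measurable (E : set (borelType G)) by exact: measurableI.
have Ed : (m E < d%:E)%E.
  have mUA : measurable (U `\` A : set (borelType G)) by exact: measurableD.
  have mVA : measurable (V `\` ~` A : set (borelType G)) by exact: measurableD.
  apply: (@le_lt_trans _ _ (m ((U `\` A) `|` (V `\` ~` A)))).
    apply: le_measure; rewrite ?inE//; first exact: measurableU.
    move=> x [Ux Vx]; have [Ax|nAx] := pselect (A x); last by left.
    by right; split => //= /(_ Ax).
  apply: (le_lt_trans (measureU2 m mUA mVA)).
  by rewrite [d]splitr EFinD; exact: lteD.
apply: ltW; apply: le_lt_trans (wd E mE Ed); rewrite [leRHS]Rintegral_mkcond.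
apply: le_Rintegral => //.
- apply: (@weighted_int (fun t => \1_A t - u t)).
    by apply: measurable_funB; [exact: measurable_indic|exact: continuous_meas].
  move=> t; rewrite indicE; have /andP[] := u01 t; rewrite ler_norml.
  by case: (t \in A) => /=; lra.
- have wE : integrableR (fun t => (fun t => `|w t|) t) by exact: integrable_norm.
  apply: (integrableR_le _ _ wE).
    apply/(measurable_restrictT _ _).1 => //.
    by apply: measurable_funTS; exact: measurableT_comp.
  by move=> t; rewrite patchE; case: ifP => _; rewrite ?normr_id// normr0.
move=> t _; rewrite patchE; have /andP[v0 v1] := u01 t.
case: ifPn => [_|].
  rewrite (ger0_norm (w_ge0 t)) ler_piMr// indicE ler_norml.
  by case: (t \in A) => /=; lra.
rewrite notin_setE => /not_andP[nU|nV].
  have nA : ~ A t by move=> /AU.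
  by rewrite (u0 _ nU) indicE (memNset nA) subr0 normr0 mulr0.
have At : A t by apply: contrapT => nA; exact/nV/AV.
by rewrite (u1 _ nV) indicE (mem_set At) subrr normr0 mulr0.
Qed.

Lemma approx_unit (h : G -> R) (e : R) :
  measurable_fun [set: borelType G] (h : borelType G -> R) ->
  (forall t, 0 <= h t <= 1) -> 0 < e ->
  exists u : G -> R, [/\ continuous u, forall t, 0 <= u t <= 1 &
    intR (fun t => w t * `|h t - u t|) <= e].
Proof.
move=> mh h01 e0; set W := intR w.
have W0 : 0 <= W by apply: Rintegral_ge0 => t _.
have dist1 (a b : R) : 0 <= a <= 1 -> 0 <= b <= 1 -> `|a - b| <= 1.
  by move=> /andP[a0 a1] /andP[b0 b1]; rewrite ler_norml; apply/andP; split; lra.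
have arith (x y z d : R) : x <= d -> y <= z + d -> 2^-1 * (x + y) <= 2^-1 * z + d by lra.
(* Binary expansion: each step halves the error. *)
have step (n : nat) (g : G -> R) (d : R) :
    measurable_fun [set: borelType G] (g : borelType G -> R) ->
    (forall t, 0 <= g t <= 1) -> 0 < d ->
    exists u : G -> R, [/\ continuous u, forall t, 0 <= u t <= 1 &
      intR (fun t => w t * `|g t - u t|) <= W / 2 ^+ n + d].
  elim: n g d => [|n IH] g d mg g01 d0.
    exists (fun=> 0); split; first by move=> t; exact: cvg_cst.
      by move=> t; rewrite lexx ler01.
    rewrite expr0 divr1; apply: (@le_trans _ _ W); last by rewrite lerDl ltW.
    apply: le_Rintegral => //.
      apply: (@weighted_int (fun t => g t - 0)) => [|t].
        by under eq_fun do rewrite subr0.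
      by apply: dist1 => //; rewrite lexx ler01.
    by move=> t _; rewrite ler_piMr// dist1// lexx ler01.
  (* [A] is where the first binary digit of [g] is 1, and [g] is the mean of its indicator and [g'].
     The two errors [d] average to [d], so they do not accumulate. *)
  pose A : set G := [set t | 1 / 2 <= g t].
  have mA : measurable (A : set (borelType G)).
    have := mg measurableT _ (measurable_itv `[1 / 2, +oo[).
    by rewrite setTI; congr measurable; apply/seteqP; split => t /=; rewrite in_itv/= andbT.
  pose g' t := 2 * g t - \1_A t.
  have g'01 t : 0 <= g' t <= 1.
    rewrite /g' indicE; have /andP[g0 g1] := g01 t.
    have [|] := boolP (t \in A); rewrite ?inE ?notin_setE /A /= => hA.
      by apply/andP; split; lra.
    by move/negP: hA; rewrite -ltNge => hA; apply/andP; split; lra.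
  have mg' : measurable_fun [set: borelType G] (g' : borelType G -> R).
    by apply: measurable_funB; [exact: measurable_funM|exact: measurable_indic].
  have [v [cv v01 vA]] := approx_indic mA d0.
  have [u [cu u01 ug]] := IH g' d mg' g'01 d0.
  exists (fun t => 2^-1 * (v t + u t)); split.
  - by move=> t; apply: cvgM; [exact: cvg_cst|apply: cvgD; [exact: cv|exact: cu]].
  - by move=> t; have /andP[? ?] := v01 t; have /andP[? ?] := u01 t; apply/andP; split; lra.
  have i1 : integrableR (fun t => w t * `|\1_A t - v t|).
    apply: (@weighted_int (fun t => \1_A t - v t)) => [|t].
      by apply: measurable_funB; [exact: measurable_indic|exact: continuous_meas].
    by apply: dist1 => //; rewrite indicE ler0n lern1 leq_b1.
  have i2 : integrableR (fun t => w t * `|g' t - u t|).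
    apply: (@weighted_int (fun t => g' t - u t)) => [|t].
      by apply: measurable_funB => //; exact: continuous_meas.
    exact: dist1.
  apply: (@le_trans _ _ (intR (fun t => 2^-1 * (w t * `|\1_A t - v t| + w t * `|g' t - u t|)))).
    apply: le_Rintegral => //.
    - apply: (@weighted_int (fun t => g t - 2^-1 * (v t + u t))) => [|t].
        apply: measurable_funB => //; apply: measurable_funM => //.
        by apply: measurable_funD; exact: continuous_meas.
      apply: dist1 => //; have /andP[? ?] := v01 t; have /andP[? ?] := u01 t.
      by apply/andP; split; lra.
    - by apply: integrableRZ; exact: integrableRD.
    move=> t _; rewrite -mulrDr mulrCA; apply: ler_wpM2l => //.
    have -> : g t - 2^-1 * (v t + u t) = 2^-1 * ((\1_A t - v t) + (g' t - u t)).
      by rewrite /g'; field.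
    rewrite normrM ger0_norm ?invr_ge0//; apply: ler_wpM2l; first by rewrite invr_ge0.
    exact: ler_normD.
  rewrite RintegralZl//; last exact: integrableRD.
  rewrite RintegralD//.
  have -> : W / 2 ^+ n.+1 = 2^-1 * (W / 2 ^+ n) by rewrite exprS invfM mulrCA.
  exact: arith vA ug.
have e20 : 0 < e / 2 by rewrite divr_gt0.
have [n Wn] : exists n : nat, W / 2 ^+ n <= e / 2.
  pose n := Num.Def.archi_bound (W / (e / 2)); exists n.
  have Wb : W / (e / 2) < n%:R by apply: archi_boundP; rewrite divr_ge0// ltW.
  rewrite ler_pdivrMr ?exprn_gt0// mulrC -ler_pdivrMr//.
  apply/ltW/(lt_le_trans Wb); rewrite -natrX ler_nat; exact/ltnW/ltn_expl.
have [u [cu u01 hu]] := step n h _ mh h01 e20.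
exists u; split => //; apply: le_trans hu _.
by rewrite [leRHS]splitr lerD2r.
Qed.

(** Real and imaginary parts are rescaled to [0, 1]. The sup bound [2 * k] is independent of [e], as
    [ip_bound_closed] requires of its approximants. *)
Lemma approx_bounded (h : G -> R[i]) (k e : R) : measC h -> 0 < k ->
  (forall t, nc (h t) <= k) -> 0 < e ->
  exists u : G -> R[i], [/\ contC u, forall t, nc (u t) <= 2 * k &
    intR (fun t => w t * nc (h t - u t)) <= e].
Proof.
move=> [mh1 mh2] k0 hk e0.
pose a t := Re (h t) / (2 * k) + 1 / 2; pose b t := Im (h t) / (2 * k) + 1 / 2.
have k20 : 0 < 2 * k by rewrite mulr_gt0.
have unit01 (x : R) : `|x| <= k -> 0 <= x / (2 * k) + 1 / 2 <= 1.
  rewrite ler_norml => /andP[x1 x2].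
  have -> : x / (2 * k) + 1 / 2 = (x + k) / (2 * k) by field; rewrite gt_eqF.
  by rewrite divr_ge0 ?ler_pdivrMr ?(ltW k20)//=; lra.
have a01 t : 0 <= a t <= 1 by apply: unit01; apply: le_trans (hk t); exact: nc_Re.
have b01 t : 0 <= b t <= 1 by apply: unit01; apply: le_trans (hk t); exact: nc_Im.
have ma : measurable_fun [set: borelType G] (a : borelType G -> R).
  by apply: measurable_funD => //; exact: measurable_funM.
have mb : measurable_fun [set: borelType G] (b : borelType G -> R).
  by apply: measurable_funD => //; exact: measurable_funM.
pose d := e / (4 * k); have d0 : 0 < d by rewrite divr_gt0// mulr_gt0.
have [u [cu u01 ua]] := approx_unit ma a01 d0.
have [v [cv v01 vb]] := approx_unit mb b01 d0.
pose q t := Complex (2 * k * (u t - 1 / 2)) (2 * k * (v t - 1 / 2)).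
have half (x : R) : 0 <= x <= 1 -> `|2 * k * (x - 1 / 2)| <= k.
  move=> /andP[x0 x1]; rewrite normrM (ger0_norm (ltW k20)).
  have : `|x - 1 / 2| <= 1 / 2 by rewrite ler_norml; apply/andP; split; lra.
  by move=> H; apply: (le_trans (ler_wpM2l (ltW k20) H)); lra.
exists q; split.
- apply/contC_ReIm; split => t.
    apply: cvgM; first exact: cvg_cst.
    by apply: cvgB; [exact: cu|exact: cvg_cst].
  apply: cvgM; first exact: cvg_cst.
  by apply: cvgB; [exact: cv|exact: cvg_cst].
- move=> t; apply: le_trans (nc_leReIm _) _ => /=.
  by apply: (le_trans (lerD (half _ (u01 t)) (half _ (v01 t)))); lra.
have dist1 (x y : R) : 0 <= x <= 1 -> 0 <= y <= 1 -> `|x - y| <= 1.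
  by move=> /andP[x0 x1] /andP[y0 y1]; rewrite ler_norml; apply/andP; split; lra.
have i1 : integrableR (fun t => w t * `|a t - u t|).
  apply: (@weighted_int (fun t => a t - u t)) => [|t]; last exact: dist1.
  by apply: measurable_funB => //; exact: continuous_meas.
have i2 : integrableR (fun t => w t * `|b t - v t|).
  apply: (@weighted_int (fun t => b t - v t)) => [|t]; last exact: dist1.
  by apply: measurable_funB => //; exact: continuous_meas.
have hq t : nc (h t - q t) <= 2 * k * (`|a t - u t| + `|b t - v t|).
  apply: le_trans (nc_leReIm _) _; rewrite !ReImE /=.
  have -> : Re (h t) - 2 * k * (u t - 1 / 2) = 2 * k * (a t - u t).
    by rewrite /a; field; rewrite gt_eqF.
  have -> : Im (h t) - 2 * k * (v t - 1 / 2) = 2 * k * (b t - v t).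
    by rewrite /b; field; rewrite gt_eqF.
  rewrite (normrM (2 * k) (a t - u t)) (normrM (2 * k) (b t - v t)).
  by rewrite (ger0_norm (ltW k20)) -mulrDr.
apply: (@le_trans _ _ (intR (fun t => 2 * k * (w t * `|a t - u t| + w t * `|b t - v t|)))).
  apply: le_Rintegral => //; last first.
  - by move=> t _; rewrite -mulrDr mulrCA; apply: ler_wpM2l.
  - by apply: integrableRZ; exact: integrableRD.
  - have iq : integrableR (fun t => 2 * k * (w t * `|a t - u t| + w t * `|b t - v t|)).
      by apply: integrableRZ; exact: integrableRD.
    apply: (integrableR_le _ _ iq).
      apply: measurable_funM => //; apply: measC_nc; apply: measCB; first by split.
      by split; apply: measurable_funM => //; apply: measurable_funB => //; exact: continuous_meas.
    move=> t; rewrite ger0_norm ?mulr_ge0 ?nc_ge0// -mulrDr mulrCA.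
    exact: ler_wpM2l.
rewrite RintegralZl//; last exact: integrableRD.
rewrite RintegralD//; apply: (le_trans (ler_wpM2l (ltW k20) (lerD ua vb))).
by rewrite /d le_eqVlt; apply/orP; left; apply/eqP; field; rewrite gt_eqF.
Qed.

End approximation.

(** * Square-integrability from Fourier coefficients *)

Section square_integrability.
Variables (R : realType) (G : topologicalZmodType).
Hypotheses (cG : compact [set: G]) (hG : hausdorff_space G).
Variable m : probability (borelType G) R.
Hypothesis mH : is_haar m.
Implicit Types (f g h chi : G -> R[i]).

Local Notation integrableR u :=
  (m.-integrable [set: borelType G] (fun t : borelType G => (u t)%:E)).
Local Notation intR u := (\int[m]_(t in [set: borelType G]) u t).
Local Notation "f *% g" := (Defs.conv m f g) (at level 40, left associativity).
Let cL f (cf : contC f) : L2 m f := contC_L2 m cG cf.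

Lemma le_of_small_perturbation (x s N K : R) : 0 <= x -> 0 <= N -> 0 <= K ->
  (forall e : R, 0 < e -> exists y r : R,
    [/\ x - e <= y, 0 <= y, y ^+ 2 <= N * r & r <= s + K * e]) ->
  x ^+ 2 <= N * s.
Proof.
move=> x0 N0 K0 H; rewrite leNgt; apply/negP => xs.
pose g := x ^+ 2 - N * s; have g0 : 0 < g by rewrite subr_gt0.
(* The total loss caused by [e] is at most [e * (2 * x + N * K)], so [e := g / D] loses less than
   the supposed gap [g]. *)
pose D := 2 * x + N * K + 1; have D0 : 0 < D by rewrite /D; nra.
have [y [r [xy y0 yr rs]]] := H (g / D) (divr_gt0 g0 D0).
have e0 : 0 < g / D by rewrite divr_gt0.
have eD : g / D * D = g by rewrite divfK// gt_eqF.
set e := g / D in xy yr rs e0 eD *.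
have h1 : y ^+ 2 <= N * s + N * (K * e).
  by apply: le_trans yr _; rewrite -mulrDr; exact: ler_wpM2l.
have h2 : x ^+ 2 - 2 * x * e <= y ^+ 2.
  have [xe|xe] := leP x e.
    apply: le_trans (sqr_ge0 y); rewrite expr2 -mulrA.
    have -> : x * x - 2 * (x * e) = x * (x - 2 * e) by ring.
    by rewrite mulr_ge0_le0//; lra.
  apply: (@le_trans _ _ ((x - e) ^+ 2)).
    rewrite -subr_ge0; have -> : (x - e) ^+ 2 - (x ^+ 2 - 2 * x * e) = e ^+ 2 by ring.
    exact: sqr_ge0.
  by rewrite ler_pXn2r// nnegrE subr_ge0 ltW.
have : g <= e * (2 * x + N * K).
  have -> : e * (2 * x + N * K) = 2 * x * e + N * (K * e) by ring.
  by rewrite /g; lra.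
by rewrite -[leLHS]eD /D ler_pM2l//; lra.
Qed.

(** The weight |f| + 1 does two jobs: |f| controls the change of the pairing with [f], and 1,
    together with the sup bounds, controls the change of the squared norm through |u|^2 - |h|^2 <=
    (k + k')|h - u|. *)
Lemma ip_bound_closed f h (k k' N : R) : integrableC m f -> measC h ->
  (forall t, nc (h t) <= k) -> 0 <= k' -> 0 <= N ->
  (forall e : R, 0 < e -> exists u, [/\ measC u, forall t, nc (u t) <= k',
     intR (fun t => (nc (f t) + 1) * nc (h t - u t)) <= e &
     nc (ip m f u) ^+ 2 <= N * sqn2 m u]) ->
  nc (ip m f h) ^+ 2 <= N * sqn2 m h.
Proof.
move=> fi mh hk k'0 N0 H.
have k0 : 0 <= k by apply: le_trans (hk 0); exact: nc_ge0.
apply: (@le_of_small_perturbation _ _ _ (k + k')); rewrite ?nc_ge0 ?addr_ge0// => e e0.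
have [u [mu uk' ue hu]] := H _ e0.
have iw : integrableR (fun t => (k + k') * (nc (f t) + 1)).
  by apply/integrableRZ/integrableRD; [exact: integrableC_nc|exact: integrableR_cst].
have mhu : measC (fun t => h t - u t) by exact: measCB.
have ihu : integrableR (fun t => (nc (f t) + 1) * nc (h t - u t)).
  apply: (integrableR_le _ _ iw).
    apply: measurable_funM; last exact: measC_nc.
    by apply: measurable_funD => //; apply: measC_nc; exact: integrableC_measC fi.
  move=> t; rewrite ger0_norm ?mulr_ge0 ?addr_ge0 ?nc_ge0// mulrC.
  apply: ler_wpM2r; first by rewrite addr_ge0 ?nc_ge0.
  by apply: le_trans (ncB _ _) _; exact: lerD.
have L2h : L2 m h by exact: bounded_L2 hk.
have L2u : L2 m u by exact: bounded_L2 uk'.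
have ifh : integrableC m (fun t => f t * (h t)^*%C).
  by apply: (integrableCM_bounded fi (measCJ mh)) => t; rewrite ncJ; exact: hk.
have ifu : integrableC m (fun t => f t * (u t)^*%C).
  by apply: (integrableCM_bounded fi (measCJ mu)) => t; rewrite ncJ; exact: uk'.
exists (nc (ip m f u)), (sqn2 m u); split; rewrite ?nc_ge0//.
- rewrite lerBlDr addrC -lerBlDr; apply: (@le_trans _ _ (nc (ip m f h - ip m f u))).
    rewrite lerBlDr; apply: le_trans (ncD _ _).
    by rewrite subrK.
  rewrite /ip -integralCB//; apply: le_trans ue.
  apply: nc_integralC_le => //; first exact: integrableCB.
  move=> t; rewrite -mulrBr -conjCB ncM ncJ; apply: ler_wpM2r; rewrite ?nc_ge0//.
  by rewrite lerDl.
- have L2hi := L2h.2; have L2ui := L2u.2.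
  apply: (@le_trans _ _ (sqn2 m h + (k + k') * intR (fun t => (nc (f t) + 1) * nc (h t - u t)))).
    rewrite -RintegralZl// -RintegralD//; last exact: integrableRZ.
    apply: le_Rintegral => //.
      by apply: integrableRD => //; exact: integrableRZ.
    move=> t _; rewrite -lerBlDl.
    apply: (@le_trans _ _ (nc (h t - u t) * (k + k'))).
      have := ncD (u t - h t) (h t); rewrite subrK (nc_distC (u t)) => tri.
      have := hk t; have := uk' t; have := nc_ge0 (h t); have := nc_ge0 (u t).
      have := nc_ge0 (h t - u t).
      move: (nc (h t)) (nc (u t)) (nc (h t - u t)) tri => a b c; clear; nra.
    rewrite mulrC; apply: ler_wpM2l; first by rewrite addr_ge0.
    by rewrite ler_peMl ?nc_ge0// lerDr nc_ge0.
  by rewrite lerD2l; apply: ler_wpM2l => //; rewrite addr_ge0.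
Qed.

Variables (f : G -> R[i]) (N : R).
Hypothesis fi : integrableC m f.
Hypothesis fN : forall F, dual_seq F -> \sum_(chi <- F) nc (fourier m f chi) ^+ 2 <= N.

Let N_ge0 : 0 <= N.
Proof. by have := @fN [::]; rewrite big_nil; apply; split. Qed.

(** The pairing sees only the coefficients of [f] on [F], so [f], which is merely integrable, may be
    replaced by its partial sum [g], of squared norm at most [N]. *)
Let ip_bound_trig c F : dual_seq F ->
  nc (ip m f (trig c F)) ^+ 2 <= N * sqn2 m (trig c F).
Proof.
move=> DF; pose g := trig (fourier m f) F.
have cg : contC g by exact: contC_trig.
have -> : ip m f (trig c F) = ip m g (trig c F).
  rewrite !ip_trig//; last exact/L2_integrableC/cL.
  rewrite big_seq [RHS]big_seq; apply: eq_bigr => chi cF; congr (_ * _).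
  by rewrite fourier_trig// ?cF//; case: DF => _; apply.
have ct : contC (trig c F) by exact: contC_trig.
apply: (le_trans (cauchy_schwarz (cL cg) (cL ct))).
by apply: ler_wpM2r; rewrite ?sqn2_ge0// sqn2_trig//; exact: fN.
Qed.

Let w_int : integrableR (fun t => nc (f t) + 1).
Proof. by apply: integrableRD; [exact: integrableC_nc|exact: integrableR_cst]. Qed.

Let w_ge0 t : 0 <= nc (f t) + 1. Proof. by rewrite addr_ge0 ?nc_ge0. Qed.

Let ip_bound_contC u : contC u -> nc (ip m f u) ^+ 2 <= N * sqn2 m u.
Proof.
move=> cu; have [k k0 uk] := contC_bounded cG cu.
apply: (@ip_bound_closed f u k (k + 1)) => //.
- exact: contC_measC.
- by rewrite addr_ge0// ltW.
move=> e e0; pose W := intR (fun t => nc (f t) + 1).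
have W0 : 0 <= W by apply: Rintegral_ge0 => t _.
(* The cap 1 gives the approximants the uniform bound [k + 1]; the quotient makes the weighted error
   at most [e]. *)
pose d := Num.min 1 (e / (W + 1)).
have d0 : 0 < d by rewrite lt_min ltr01 divr_gt0// ltr_wpDl.
have [c [F [DF H]]] := trig_dense cG hG mH cu d0.
have ct := contC_trig c DF; exists (trig c F); split.
- exact: contC_measC.
- move=> t; rewrite -[trig c F t](subrK (u t)); apply: le_trans (ncD _ _) _.
  rewrite addrC; apply: lerD => //; rewrite nc_distC; apply: le_trans (H t) _.
  by rewrite ge_min lexx.
- apply: (@le_trans _ _ (intR (fun t => d * (nc (f t) + 1)))).
    have dw := integrableRZ d w_int; have leq t :
        (nc (f t) + 1) * nc (u t - trig c F t) <= d * (nc (f t) + 1).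
      by rewrite mulrC; apply: ler_wpM2r.
    apply: le_Rintegral => //; apply: (integrableR_le _ _ dw).
      apply: measurable_funM; last by apply: measC_nc; apply: contC_measC; exact: contCB.
      by apply: measurable_funD => //; apply: measC_nc; exact: integrableC_measC fi.
    by move=> t; rewrite ger0_norm// mulr_ge0 ?nc_ge0.
  rewrite RintegralZl// -/W; apply: (@le_trans _ _ (e / (W + 1) * W)).
    by apply: ler_wpM2r => //; rewrite ge_min lexx orbT.
  rewrite mulrAC ler_pdivrMr ?ltr_wpDl//; apply: ler_wpM2l; first exact: ltW.
  by rewrite lerDl.
- exact: ip_bound_trig.
Qed.

Let ip_bound_bounded h (k : R) : measC h -> 0 < k -> (forall t, nc (h t) <= k) ->
  nc (ip m f h) ^+ 2 <= N * sqn2 m h.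
Proof.
move=> mh k0 hk; apply: (@ip_bound_closed f h k (2 * k)) => //.
  by rewrite mulr_ge0// ltW.
move=> e e0; have [u [cu uk ue]] := approx_bounded cG hG mH w_ge0 w_int mh k0 hk e0.
by exists u; split => //; [exact: contC_measC|exact: ip_bound_contC].
Qed.

Let trunc (n : nat) t : R[i] := if nc (f t) <= n%:R then f t else 0.

Let mf : measC f. Proof. exact: integrableC_measC fi. Qed.

Let trunc_measC n : measC (trunc n).
Proof.
pose A : set G := [set t | nc (f t) <= n%:R].
have mA : measurable (A : set (borelType G)).
  have := measC_nc mf measurableT (measurable_itv `]-oo, n%:R]).
  by rewrite setTI; congr measurable; apply/seteqP; split => t /=; rewrite in_itv.
have -> : trunc n = (fun t => (\1_A t)%:C%C * f t).
  apply/funext => t; rewrite /trunc indicE; case: ifPn => h.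
    by rewrite mem_set// mul1r.
  by rewrite memNset ?mul0r// => /(negP h).
apply: measCM => //; split => /=; first exact: measurable_indic.
exact: measurable_cst.
Qed.

(** The bound is [n.+1] and not [n] because [ip_bound_bounded] asks for a positive one. *)
Let trunc_le n t : nc (trunc n t) <= n.+1%:R.
Proof.
rewrite /trunc; case: ifPn => [h|_]; last by rewrite nc0.
by apply: le_trans h _; rewrite ler_nat.
Qed.

(** The pairing of [f] with its own truncation is the squared norm [s] of the truncation, so s^2 <=
    N s. *)
Let trunc_sqn2 n : sqn2 m (trunc n) <= N.
Proof.
have n0 : 0 < n.+1%:R :> R by rewrite ltr0n.
have := ip_bound_bounded (trunc_measC n) n0 (trunc_le n).
have -> : ip m f (trunc n) = (sqn2 m (trunc n))%:C%C.
  rewrite -ipxx; congr integralC; apply/funext => t.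
  by rewrite /trunc; case: ifP => //; rewrite conjc0 !mulr0.
rewrite nc_real real_normK ?num_real// expr2.
have := sqn2_ge0 m (trunc n); rewrite le_eqVlt => /orP[/eqP <- _|s0].
  exact: N_ge0.
by rewrite ler_pM2r.
Qed.

Let int_sqr_le : (\int[m]_(t in [set: borelType G]) (nc (f t) ^+ 2)%:E <= N%:E)%E.
Proof.
have tE n t : nc (trunc n t) ^+ 2 = if nc (f t) <= n%:R then nc (f t) ^+ 2 else 0.
  by rewrite /trunc; case: ifP => //; rewrite nc0 expr0n.
pose g n (t : borelType G) := (nc (trunc n t) ^+ 2)%:E.
have mg n : measurable_fun [set: borelType G] (g n).
  by apply/measurable_EFinP; exact: measC_sqr_nc.
have g0 n t : [set: borelType G] t -> (0 <= g n t)%E.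
  by move=> _; rewrite lee_fin sqr_ge0.
have ndg t : [set: borelType G] t -> nondecreasing_seq (g ^~ t).
  move=> _ i j ij; rewrite lee_fin !tE; case: ifPn => [h|_].
    by rewrite (le_trans h) ?ler_nat.
  by case: ifP => // _; exact: sqr_ge0.
have lg t : limn (g ^~ t) = (nc (f t) ^+ 2)%:E.
  apply: lim_near_cst => //.
  exists (Num.Def.archi_bound (nc (f t))) => // n /= hn; rewrite /g tE.
  have := archi_boundP (nc_ge0 (f t)) => h.
  by rewrite (le_trans (ltW h)) ?ler_nat.
have E : (\int[m]_(t in [set: borelType G]) limn (g ^~ t) =
    \int[m]_(t in [set: borelType G]) (nc (f t) ^+ 2)%:E)%E.
  by apply: eq_integral => t _; exact: lg.
have cvg_int : (fun n => \int[m]_(t in [set: borelType G]) g n t)%E @ \oo -->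
    (\int[m]_(t in [set: borelType G]) limn (g ^~ t))%E.
  exact: cvg_monotone_convergence.
rewrite -E -(cvg_lim _ cvg_int)//; apply: lime_le.
  by apply/cvg_ex; eexists; exact: cvg_int.
apply: nearW => n; have [_ /integrable_fin_num fn] := bounded_L2 m (trunc_measC n) (trunc_le n).
rewrite -(fineK (fn measurableT)) lee_fin.
exact: trunc_sqn2.
Qed.

(* By duality: [ip m f u] is bounded by [sqrt N] times the norm of [u], first for
   trigonometric polynomials, then for continuous [u], then for bounded
   measurable [u], in particular for the truncations of [f]. *)
Theorem L2_of_fourier : L2 m f /\ sqn2 m f <= N.
Proof.
have fi2 : integrableR (fun t => nc (f t) ^+ 2).
  apply/integrableP; split; first by apply/measurable_EFinP; exact: measC_sqr_nc.
  under eq_integral do rewrite gee0_abs ?lee_fin ?sqr_ge0//.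
  by apply: le_lt_trans int_sqr_le _; exact: ltry.
split; first by split.
by rewrite -lee_fin /sqn2 /Rintegral fineK//; exact: integrable_fin_num.
Qed.

End square_integrability.

(** * Convolution and Fourier coefficients *)

Section fourier_series.
Variables (R : realType) (G : topologicalZmodType).
Hypotheses (cG : compact [set: G]) (hG : hausdorff_space G).
Variable m : probability (borelType G) R.
Hypothesis mH : is_haar m.
Implicit Types (f g h chi : G -> R[i]).

Local Notation intR u := (\int[m]_(t in [set: borelType G]) u t).
Local Notation "f *% g" := (Defs.conv m f g) (at level 40, left associativity).
Let cL f (cf : contC f) : L2 m f := contC_L2 m cG cf.

(** Subtracting the partial sum over [F0] leaves the tail coefficients, and [L2_of_fourier] turns
    their square sum into a norm bound. [chi0] is put in the list so that its coefficient can be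
    read off; by [sqn2_sub_trig] enlarging the list never increases the error. *)
Lemma L2_trig_approx f chi0 (e : R) : L2 m f -> dual_group R G chi0 -> 0 < e ->
  exists F, [/\ dual_seq F, chi0 \in F &
    sqn2 m (fun t => f t - trig (fourier m f) F t) <= e].
Proof.
move=> fi Hc0 e0.
have [F0 [uF DF tail]] := bounded_sums_tail (fun chi => sqr_ge0 (nc (fourier m f chi)))
  (fun F uF (DF : forall chi, chi \in F -> dual_group R G chi) => bessel cG mH (conj uF DF) fi) e0.
have DF0 : dual_seq F0 by [].
have F0e : sqn2 m (fun t => f t - trig (fourier m f) F0 t) <= e.
  have ct := contC_trig (fourier m f) DF0.
  have fti := L2B fi (cL ct).
  apply: (L2_of_fourier cG hG mH (L2_integrableC fti) _).2 => F [uF' DF'].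
  apply: le_trans (tail [seq chi <- F | chi \notin F0] _ _ _).
  - rewrite [leRHS]big_filter [leRHS]big_mkcond [leLHS]big_seq [leRHS]big_seq.
    apply: ler_sum => chi cF; have Hc := DF' _ cF.
    rewrite fourierB//; [|exact: L2_integrableC|by apply: L2_integrableC; exact: cL].
    rewrite (fourier_trig cG mH _ DF0 Hc); case: ifPn => cF0.
      by rewrite subrr nc0 expr0n.
    by rewrite subr0.
  - exact: filter_uniq.
  - by move=> chi; rewrite mem_filter => /andP[_ /DF'].
  - by move=> chi; rewrite mem_filter => /andP[].
have [cF0|ncF0] := boolP (chi0 \in F0); first by exists F0.
have DF1 : dual_seq (chi0 :: F0).
  split; first by rewrite /= ncF0.
  by move=> chi; rewrite in_cons => /orP[/eqP ->|/DF].
exists (chi0 :: F0); split => //; first exact: mem_head.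
apply: le_trans F0e; rewrite !sqn2_sub_trig// lerD2l lerN2 big_cons.
by rewrite lerDr sqr_ge0.
Qed.

Lemma conv_trig c F g t : dual_seq F -> L2 m g ->
  (trig c F *% g) t = trig (fun chi => c chi * fourier m g chi) F t.
Proof.
move=> + gi; elim: F => [|chi F IH] DFc.
  rewrite /trig big_nil -[RHS](integralC_cst m); congr integralC.
  by apply/funext => s; rewrite big_nil mul0r.
have Hc : dual_group R G chi by apply: DFc.2; rewrite mem_head.
have DF : dual_seq F.
  split; first by case: DFc => /= /andP[].
  by move=> psi pF; apply: DFc.2; rewrite in_cons pF orbT.
rewrite {2}/trig big_cons -/(trig _ F t) -IH//.
have cc := dual_contC Hc.
have -> : trig c (chi :: F) = (fun s => c chi * chi s + trig c F s).
  by apply/funext => s; rewrite /trig big_cons.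
rewrite (convDl cG hG mH (cL (contCZ (c chi) cc)) (cL (contC_trig c DF)) gi).
rewrite (convZl cG hG mH _ (cL cc) gi) (conv_dual Hc (L2_integrableC gi)).
by rewrite mulrA.
Qed.

(** The exchange of integrals was proved for continuous kernels. For L^2 factors this uniform
    approximation replaces it, giving both the continuity and the coefficients of the
    convolution. *)
Lemma conv_L2_approx f g chi0 (e : R) : L2 m f -> L2 m g ->
  dual_group R G chi0 -> 0 < e ->
  exists F, [/\ dual_seq F, chi0 \in F & forall t,
    nc ((f *% g) t - trig (fun chi => fourier m f chi * fourier m g chi) F t) <= e].
Proof.
move=> fi gi Hc0 e0; pose M := sqn2 m g + 1.
have M0 : 0 < M by rewrite ltr_wpDl// sqn2_ge0.
have d0 : 0 < e ^+ 2 / M by rewrite divr_gt0// exprn_gt0.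
have [F [DF cF Fe]] := L2_trig_approx fi Hc0 d0; exists F; split => // t.
have Lt := cL (contC_trig (fourier m f) DF).
have Ld := L2B fi Lt.
rewrite -(conv_trig _ _ DF gi) -(@ler_pXn2r _ 2)// ?nnegrE ?nc_ge0 ?(ltW e0)//.
have := sqr_nc_conv_le cG hG mH t Ld gi.
rewrite (convBl cG hG mH fi Lt gi) => /le_trans; apply.
apply: (@le_trans _ _ (e ^+ 2 / M * sqn2 m g)).
  by apply: ler_wpM2r => //; exact: sqn2_ge0.
rewrite mulrAC ler_pdivrMr//; apply: ler_wpM2l; first exact: sqr_ge0.
by rewrite lerDl.
Qed.

Lemma dual_group1 : dual_group R G (fun=> 1).
Proof.
split; last by move=> t; rewrite normr1.
  by apply/continuous_contC; exact: contC_cst.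
by move=> s t; rewrite mulr1.
Qed.

Lemma contC_conv_L2 f g : L2 m f -> L2 m g -> contC (f *% g).
Proof.
move=> fi gi; apply: contC_unif => e e0.
have [F [DF _ H]] := conv_L2_approx fi gi dual_group1 e0.
by exists (trig (fun chi => fourier m f chi * fourier m g chi) F) => //; exact: contC_trig.
Qed.

Lemma fourier_conv_L2 f g chi : L2 m f -> L2 m g -> dual_group R G chi ->
  fourier m (f *% g) chi = fourier m f chi * fourier m g chi.
Proof.
move=> fi gi Hc; apply/eqP; rewrite -subr_eq0 -nc_eq0 eq_le nc_ge0 andbT.
apply/ler_addgt0Pr => e e0; rewrite add0r.
have [F [DF cF H]] := conv_L2_approx fi gi Hc e0.
have cfg := contC_conv_L2 fi gi.
pose q := trig (fun chi => fourier m f chi * fourier m g chi) F.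
have cq : contC q by exact: contC_trig.
have -> : fourier m f chi * fourier m g chi = fourier m q chi.
  by rewrite (fourier_trig cG mH _ DF Hc) cF.
rewrite -fourierB//; try by apply: L2_integrableC; exact: cL.
apply: nc_integralC_bounded => [|t].
  apply: measCM; first by apply: contC_measC; exact: contCB.
  by apply: measCJ; apply: contC_measC; exact: dual_contC.
by rewrite ncM ncJ dual_nc// mulr1.
Qed.

(** The bound of [L2_of_fourier] with [N] equal to 0. *)
Lemma fourier_injective f : L2 m f -> fourier_null m f -> sqn2 m f = 0.
Proof.
move=> fi nf; apply/eqP; rewrite eq_le sqn2_ge0 andbT.
apply: (L2_of_fourier cG hG mH (L2_integrableC fi) _).2 => F [_ DF].
rewrite big_seq big1// => chi cF; rewrite nf ?nc0 ?expr0n//; exact: DF.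
Qed.

Lemma sqn2_eq0_ae f : L2 m f -> sqn2 m f = 0 ->
  (f : borelType G -> R[i]) = (fun=> 0) %[ae m].
Proof.
move=> [mf fi] f0.
have msq : measurable_fun [set: borelType G]
    (fun t : borelType G => (nc (f t) ^+ 2)%:E : \bar R).
  by apply/measurable_EFinP; exact: measC_sqr_nc.
have /(ae_eq_integral_abs m measurableT msq) : (\int[m]_(t in [set: borelType G])
    `|(nc (f t) ^+ 2)%:E| = 0)%E.
  under eq_integral do rewrite gee0_abs ?lee_fin ?sqr_ge0//.
  have fn := integrable_fin_num measurableT fi.
  by rewrite -(fineK fn); congr (_%:E).
apply: filterS => t /(_ I) /= [] /eqP; rewrite expf_eq0/= nc_eq0 => /eqP -> _.
by [].
Qed.

Lemma haar_set1 x : m [set x : G] = m [set (0 : G)].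
Proof.
have c0 : closed [set (0 : G)] by apply: compact_closed => //; exact: compact_set1.
have [mt _ _] := mH; rewrite -(mt x _ (closed_measurableG c0)); congr (m _).
by apply/seteqP; split => y /= => [->|[s -> <-]]; [exists 0; rewrite ?addr0|rewrite addr0].
Qed.

(** By invariance all points have the same mass a, and n distinct points have total mass n a, at
    most 1, for every n. *)
Lemma haar_atomless : infinite_set [set: G] -> m [set (0 : G)] = 0%E.
Proof.
move=> infG; have c1 (x : G) : measurable ([set x] : set (borelType G)).
  apply: closed_measurableG; apply: compact_closed => //; exact: compact_set1.
have fin0 : m [set (0 : G)] \is a fin_num by exact: fin_num_measure.
have ms (s : seq G) : uniq s -> measurable ([set` s] : set (borelType G)) /\
    m [set` s] = ((size s)%:R * fine (m [set (0 : G)]))%:E.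
  elim: s => [|x s IH] /=.
    by move=> _; rewrite set_nil mul0r measure0; split => //; exact: measurable0.
  move=> /andP[xs /IH [mS mE]]; have -> : [set` x :: s] = [set x] `|` [set` s].
    apply/seteqP; split => y /=; rewrite in_cons.
      by move=> /orP[/eqP ->|]; [left|right].
    by move=> [->|->]; rewrite ?eqxx ?orbT.
  split; first exact: measurableU.
  rewrite measureU//; last first.
    by apply/seteqP; split => // y /= [-> xs']; move/negP : xs.
  have mx : m [set x] = (fine (m [set (0 : G)]))%:E by rewrite haar_set1 fineK.
  apply: (eq_trans (f_equal2 adde mx mE)).
  by apply: (congr1 EFin); rewrite -natr1 mulrDl mul1r addrC.
rewrite -(fineK fin0); congr (_%:E); apply/eqP; rewrite eq_le fine_ge0// andbT.
rewrite leNgt; apply/negP => a0; set a := fine _ in ms a0.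
pose n := Num.Def.archi_bound a^-1.
have [B _ nB] := infinite_set_fset n infG.
have [mB mE] := ms _ (finmap.fset_uniq B).
have : (m [set` finmap.enum_fset B] <= 1)%E by exact: probability_le1.
rewrite mE lee_fin; apply/negP; rewrite -ltNge.
have : a^-1 < n%:R by apply: archi_boundP; rewrite invr_ge0 ltW.
rewrite -(ltr_pM2r a0) mulVf ?gt_eqF// => /lt_le_trans; apply.
by apply: ler_wpM2r; [exact: ltW|rewrite ler_nat].
Qed.

(** If [F] contained every character, each continuous function would equal its partial sum over [F].
    Atomlessness gives a bump of height 1 at 0 whose integral, hence each coefficient, is below
    1/(size F + 1); the partial sum at 0 would then be less than 1. *)
Lemma dual_infinite F : infinite_set [set: G] -> dual_seq F ->
  exists2 chi, dual_group R G chi & chi \notin F.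
Proof.
move=> infG DF; apply: contrapT => /forall2NP H.
have Fall chi : dual_group R G chi -> chi \in F.
  by move=> Hc; case: (H chi) => // /negP; rewrite negbK.
have c0 : closed [set (0 : G)] by apply: compact_closed => //; exact: compact_set1.
pose e : R := (size F).+1%:R^-1; have e0 : 0 < e by rewrite invr_gt0 ltr0n.
have m0 := closed_measurableG c0.
have [U [oU U0 mU]] := haar_outer mH m0 e0.
have mU' := open_measurableG oU.
have Ue : fine (m U) < e.
  rewrite -lte_fin fineK ?fin_num_measure//; apply: le_lt_trans mU.
  have mD : measurable (U `\` [set (0 : G)] : set (borelType G)) by exact: measurableD.
  rewrite -[leLHS](_ : m ([set (0 : G)] `|` (U `\` [set (0 : G)])) = _).
    apply: (le_trans (measureU2 m m0 mD)).
    apply: (@le_trans _ _ (m [set (0%R : G)] + m (U `\` [set (0%R : G)]))%E) => //.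
    by rewrite haar_atomless// add0e.
  congr (m _); apply/seteqP; split => y /=; first by case=> [/U0|[]].
  by move=> Uy; have [->|y0] := pselect (y = 0); [left|right].
have [v [cv v01 v1 vU]] := @urysohn_compact R G cG hG _ _ c0 oU U0.
pose w t := (v t)%:C%C.
have cw : contC w by exact: contC_real.
have ncw t : nc (w t) = v t by rewrite nc_real ger0_norm//; case/andP: (v01 t).
have iw := L2_integrableC (cL cw); have [iv _] := iw.
have ct := contC_trig (fourier m w) DF.
have w0 : w 0 - trig (fourier m w) F 0 = 0.
  apply: (fourier_null_eq0 cG hG mH (f := fun t => w t - trig (fourier m w) F t)).
    exact: contCB.
  move=> chi Hc; rewrite fourierB//; last exact/L2_integrableC/cL.
  by rewrite (fourier_trig cG mH _ DF Hc) Fall// subrr.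
have intv : intR v <= fine (m U).
  rewrite -intR_indic//; apply: le_Rintegral => //; first exact: integrableR_indic.
  move=> t _; rewrite indicE; have [_|] := boolP (t \in U).
    by case/andP: (v01 t).
  by rewrite notin_setE => /vU ->.
have bound : nc (w 0) <= \sum_(chi <- F) fine (m U).
  move/eqP: w0; rewrite subr_eq0 => /eqP ->.
  apply: le_trans (nc_trig_le _ _ DF) _; rewrite big_seq [leRHS]big_seq.
  apply: ler_sum => chi cF; apply: le_trans intv.
  have Hc := DF.2 _ cF; apply: nc_integralC_le => //.
    exact: fourier_integrableC.
  by move=> t; rewrite ncM ncJ (dual_nc t Hc) mulr1 ncw.
move: bound; rewrite ncw v1// big_const_seq count_predT iter_addr_0 -mulr_natr.
apply/negP; rewrite -ltNge; apply: (@le_lt_trans _ _ (e * (size F)%:R)).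
  by apply: ler_wpM2r; [exact: ler0n|exact: ltW].
by rewrite /e mulrC ltr_pdivrMr ?ltr0n// mul1r ltr_nat.
Qed.

(** * The l^p norm through finite sums *)

Implicit Type a : (G -> R[i]) -> R[i].

Lemma lpnorm_ge0 (p : R) a : (0 <= lpnorm p a)%E.
Proof. exact: poweR_ge0. Qed.

Lemma le_lpnorm (p M : R) a : 1 <= p -> 0 <= M -> (lpnorm p a <= M%:E)%E ->
  forall F, dual_seq F -> \sum_(chi <- F) nc (a chi) `^ p <= M `^ p.
Proof.
move=> p1 M0 aM F [uF DF]; have p0 : 0 < p by apply: lt_le_trans p1.
rewrite -lee_fin -sumEFin.
apply: (@le_trans _ _ (\esum_(chi in dual_group R G) (nc (a chi) `^ p)%:E)%E).
  apply: esum_ge; exists [set` F]; first by split => //; exact: finite_seq.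
  by rewrite fsbig_seq.
have S0 : (0 <= \esum_(chi in dual_group R G) (nc (a chi) `^ p)%:E)%E.
  by apply: esum_ge0 => chi _; rewrite lee_fin powR_ge0.
have := @gt0_ler_poweR R p (ltW p0) (lpnorm p a) M%:E.
rewrite !in_itv /= !leey !andbT lpnorm_ge0 lee_fin M0 => /(_ isT isT aM).
by rewrite /lpnorm -poweRrM mulVf ?gt_eqF// poweRe1// poweR_EFin.
Qed.

Lemma lpnorm_le (p M : R) a : 1 <= p -> 0 <= M ->
  (forall F, dual_seq F -> \sum_(chi <- F) nc (a chi) `^ p <= M `^ p) ->
  (lpnorm p a <= M%:E)%E.
Proof.
move=> p1 M0 H; have p0 : 0 < p by apply: lt_le_trans p1.
have S0 : (0 <= \esum_(chi in dual_group R G) (nc (a chi) `^ p)%:E)%E.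
  by apply: esum_ge0 => chi _; rewrite lee_fin powR_ge0.
have SM : (\esum_(chi in dual_group R G) (nc (a chi) `^ p)%:E <= (M `^ p)%:E)%E.
  apply: ge_ereal_sup => _ [A [finA AD] <-]; rewrite fsbig_finite// sumEFin lee_fin.
  apply: H; split; first exact: finmap.fset_uniq.
  by move=> chi; rewrite in_fset_set// inE => /AD.
have := @gt0_ler_poweR R p^-1 _ _ (M `^ p)%:E _ _ SM.
rewrite !in_itv /= !leey !andbT S0 lee_fin powR_ge0 invr_ge0 (ltW p0) => /(_ isT isT isT).
by rewrite -powRrM mulfV ?gt_eqF// powRr1.
Qed.

(** Each modulus is at most [M], so for p <= 2 its square is at most M^(2-p) times its p-th
    power. *)
Lemma lp_sum_sqr_le (p M : R) a : 1 <= p <= 2 -> 0 <= M ->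
  (forall F, dual_seq F -> \sum_(chi <- F) nc (a chi) `^ p <= M `^ p) ->
  forall F, dual_seq F -> \sum_(chi <- F) nc (a chi) ^+ 2 <= M ^+ 2.
Proof.
move=> /andP[p1 p2] M0 H F DF; have p0 : 0 < p by apply: lt_le_trans p1.
have aM chi : dual_group R G chi -> nc (a chi) <= M.
  move=> Hc; have := H [:: chi]; rewrite big_seq1 => /(_ _) h.
  rewrite -[nc _]powRr1 ?nc_ge0// -[M]powRr1// -(mulfV (lt0r_neq0 p0)) !powRrM.
  apply: ge0_ler_powR; rewrite ?nnegrE ?powR_ge0 ?invr_ge0 ?(ltW p0)//.
  by apply: h; split => // psi; rewrite inE => /eqP ->.
have [M00|Mn0] := eqVneq M 0.
  rewrite big_seq big1 ?sqr_ge0// => chi cF.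
  have := aM _ (DF.2 _ cF); rewrite M00 => h.
  by have /eqP -> : nc (a chi) == 0 by [rewrite eq_le h nc_ge0]; rewrite expr0n.
have sqrE (x : R) : 0 <= x -> x ^+ 2 = x `^ 2 by move=> x0; rewrite powR_mulrn.
have -> : M ^+ 2 = M `^ (2 - p) * M `^ p.
  rewrite sqrE// -powRD ?subrK//.
  by rewrite Mn0 implybT.
apply: (@le_trans _ _ (M `^ (2 - p) * \sum_(chi <- F) nc (a chi) `^ p)); last first.
  by apply: ler_wpM2l; [exact: powR_ge0|exact: H].
rewrite mulr_sumr big_seq [leRHS]big_seq; apply: ler_sum => chi cF.
have [a0|an0] := eqVneq (nc (a chi)) 0.
  by rewrite {1}a0 expr0n mulr_ge0// powR_ge0.
have -> : nc (a chi) ^+ 2 = nc (a chi) `^ (2 - p) * nc (a chi) `^ p.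
  by rewrite sqrE ?nc_ge0// -powRD ?subrK// an0 implybT.
apply: ler_wpM2r; first exact: powR_ge0.
apply: ge0_ler_powR; rewrite ?nnegrE ?nc_ge0 ?subr_ge0//.
by apply: aM; exact: DF.2.
Qed.

End fourier_series.

(** * The inverse *)

Unset Implicit Arguments.

Theorem theorem5 (R : realType) (G : topologicalZmodType)
  (G_compact : compact [set: G]) (G_hausdorff : hausdorff_space G)
  (G_infinite : infinite_set [set: G])
  (m : probability (borelType G) R) (m_haar : is_haar m)
  (p : R) (hp : 1 <= p <= 2) (delta : R) (delta_gt0 : 0 < delta)
  (lambda : R[i]) (f : G -> R[i]) (hf : Ap m p f)
  (norm_le1 : (Ap1norm m p (lambda, f) <= 1)%E)
  (hat_ge : forall gamma, dual_group R G gamma ->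
     delta <= Normc.normc (hat1 m (lambda, f) gamma)) :
  exists y : preunitization R G,
    is_inverse m p (lambda, f) y /\
    (Ap1norm m p y <= (1 / delta + 2 * (1 - delta) / delta ^+ 2)%:E)%E.
Proof.
have /andP[p1 p2] := hp; have p0 : 0 < p by apply: lt_le_trans p1.
have [fi fp] := hf; pose l := nc lambda; pose P := fine (lpnorm p (fourier m f)).
have PE : lpnorm p (fourier m f) = P%:E.
  by rewrite fineK// ge0_fin_numE// lpnorm_ge0.
have P0 : 0 <= P by rewrite -lee_fin -PE lpnorm_ge0.
have lP : l + P <= 1.
  rewrite -lee_fin EFinD -PE; apply: le_trans norm_le1.
  by rewrite /Ap1norm /Apnorm /= leeD2l// leeDr// Lnorm_ge0.
pose F chi := fourier m f chi.
have Fp : forall E, dual_seq E -> \sum_(chi <- E) nc (F chi) `^ p <= P `^ p.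
  by apply: le_lpnorm => //; rewrite PE.
have F2 := lp_sum_sqr_le hp P0 Fp.
have L2f : L2 m f := (L2_of_fourier G_compact G_hausdorff m_haar fi F2).1.
have hat chi : dual_group R G chi -> delta <= nc (lambda + F chi) by exact: hat_ge.
(* If [l < delta], every coefficient has modulus at least [delta - l]. Outside a finite list the
   squares are at most half of [(delta - l) ^+ 2], and an infinite dual has a character there. *)
have dl : delta <= l.
  rewrite leNgt; apply/negP => ld.
  have e0 : 0 < (delta - l) ^+ 2 / 2 by rewrite divr_gt0// exprn_gt0// subr_gt0.
  have [E0 [uE DE tail]] := bounded_sums_tail (fun chi => sqr_ge0 (nc (F chi)))
    (fun E uE (DE : forall chi, chi \in E -> dual_group R G chi) => F2 E (conj uE DE)) e0.
  have [chi Hc cE] := dual_infinite G_compact G_hausdorff m_haar G_infinite (conj uE DE).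
  have := tail [:: chi]; rewrite big_seq1 => /(_ isT).
  have one psi : psi \in [:: chi] -> psi = chi by rewrite inE => /eqP.
  move=> /(_ (fun psi h => eq_ind_r (dual_group R G) Hc (one psi h))).
  move=> /(_ (fun psi h => eq_ind_r (fun psi => is_true (psi \notin E0)) cE (one psi h))).
  apply/negP; rewrite -ltNge.
  have dF : delta - l <= nc (F chi) by rewrite lerBlDl (le_trans (hat _ Hc))// ncD.
  apply: (@lt_le_trans _ _ ((delta - l) ^+ 2)).
    by rewrite ltr_pdivrMr// ltr_pMr ?ltr1n// exprn_gt0// subr_gt0.
  by rewrite ler_pXn2r// nnegrE ?nc_ge0// subr_ge0 ltW.
have l0 : 0 < l by apply: lt_le_trans dl.
have lam0 : lambda != 0 by rewrite -nc_gt0.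
have den0 chi : dual_group R G chi -> lambda + F chi != 0.
  by move=> Hc; rewrite -nc_gt0 (lt_le_trans delta_gt0)// hat.
have denV chi : dual_group R G chi -> (nc (lambda + F chi))^-1 <= delta^-1.
  by move=> Hc; rewrite lef_pV2 ?posrE ?hat// (lt_le_trans delta_gt0)// hat.
pose c chi := F chi ^+ 2 / (lambda ^+ 2 * (lambda + F chi)).
have cN E : dual_seq E -> \sum_(chi <- E) nc (c chi) <= P ^+ 2 / (l ^+ 2 * delta).
  move=> DE; apply: (@le_trans _ _ ((l ^+ 2 * delta)^-1 * \sum_(chi <- E) nc (F chi) ^+ 2)).
    rewrite mulr_sumr big_seq [leRHS]big_seq; apply: ler_sum => chi cE.
    rewrite /c ncM ncX ncV ncM ncX -/l mulrC (invfM (l ^+ 2)) (invfM (l ^+ 2)).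
    apply: ler_wpM2r; first exact: sqr_ge0.
    by apply: ler_wpM2l; [rewrite invr_ge0 sqr_ge0|apply: denV; exact: DE.2].
  rewrite mulrC; apply: ler_wpM2r; last exact: F2.
  by rewrite invr_ge0 mulr_ge0 ?sqr_ge0 ?ltW.
have [q [cq qc _]] := absolutely_summable_trig G_compact m_haar cN.
have iq := L2_integrableC (contC_L2 m G_compact cq).
pose g t := q t - (lambda ^+ 2)^-1 * f t.
have gi : integrableC m g by apply: integrableCB => //; exact: integrableCZ.
have hatg chi : dual_group R G chi -> fourier m g chi = - (F chi / (lambda * (lambda + F chi))).
  move=> Hc; rewrite /g fourierB//; last exact: integrableCZ.
  rewrite fourierZ// qc// -/(F chi) /c.
  by field; rewrite lam0 den0.
pose M := P / (l * delta).
have M0 : 0 <= M by rewrite divr_ge0// mulr_ge0// ltW.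
have nchatg chi : dual_group R G chi -> nc (fourier m g chi) <= nc (F chi) * (l * delta)^-1.
  move=> Hc; rewrite hatg// ncN ncM ncV ncM -/l !invfM.
  apply: ler_wpM2l; first exact: nc_ge0.
  by apply: ler_wpM2l; [rewrite invr_ge0 ltW|exact: denV].
have ld0 : 0 <= (l * delta)^-1 by rewrite invr_ge0 mulr_ge0// ltW.
have gp E : dual_seq E -> \sum_(chi <- E) nc (fourier m g chi) `^ p <= M `^ p.
  move=> DE; rewrite /M powRM//; apply: le_trans (ler_wpM2r _ (Fp E DE)); last exact: powR_ge0.
  rewrite mulr_suml big_seq [leRHS]big_seq; apply: ler_sum => chi cE.
  rewrite -powRM ?nc_ge0//; apply: ge0_ler_powR; rewrite ?nnegrE ?nc_ge0 ?(ltW p0)//.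
    by rewrite mulr_ge0 ?nc_ge0.
  by apply: nchatg; exact: DE.2.
have lpg : (lpnorm p (fourier m g) <= M%:E)%E by exact: lpnorm_le.
have g2 := lp_sum_sqr_le hp M0 gp.
have [L2g sg] := L2_of_fourier G_compact G_hausdorff m_haar gi g2.
have L1g : (L1norm m g <= M%:E)%E.
  rewrite /L1norm Lnorm1 /=.
  under eq_integral do rewrite ger0_norm ?nc_ge0//.
  have ig := integrable_fin_num measurableT (integrableC_nc gi).
  rewrite -(fineK ig) lee_fin -/(Rintegral _ _ _) -(@ler_pXn2r _ 2)// ?nnegrE//.
    exact: le_trans (sqr_int_nc_le L2g) sg.
  by apply: Rintegral_ge0 => t _; exact: nc_ge0.
(* [z] is the function part of the product [mul1]. Its coefficients cancel by the choice of [g], and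
   uniqueness in L^2 gives equality almost everywhere, which is what [eq1] asks. *)
pose z t := lambda * g t + lambda^-1 * f t + Defs.conv m f g t.
have cfg := contC_conv_L2 G_compact G_hausdorff m_haar L2f L2g.
have L2fg := contC_L2 m G_compact cfg.
have L2z : L2 m z by apply: L2D => //; apply: L2D; exact: L2Z.
have nz : fourier_null m z.
  move=> chi Hc; rewrite /z fourierD//; last 2 first.
  - by apply: integrableCD; exact: integrableCZ.
  - exact: L2_integrableC.
  rewrite fourierD//; try exact: integrableCZ.
  rewrite !fourierZ// (fourier_conv_L2 G_compact G_hausdorff m_haar L2f L2g Hc).
  rewrite hatg// -/(F chi); field; by rewrite lam0 den0.
have z0 := sqn2_eq0_ae L2z (fourier_injective G_compact G_hausdorff m_haar L2z nz).
exists (lambda^-1, g); split.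
  split.
  - by split; [exact: gi|exact: (le_lt_trans lpg (ltry M))].
  - by split; [exact: (mulfV lam0)|exact: z0].
  - split; first exact: (mulVf lam0).
    have zE : (fun t => lambda^-1 * f t + lambda * g t + Defs.conv m g f t) = z.
      apply/funext => t; rewrite /z (convC G_compact G_hausdorff m_haar L2g L2f).
      by congr (_ + _); exact: addrC.
    by rewrite -zE in z0; exact: z0.
rewrite /Ap1norm /Apnorm /=.
(* The two copies of [M], for the L^1 norm of [g] and for the l^p norm of its transform, produce the
   factor 2. The rest uses P <= 1 - l <= 1 - delta and l^-1 <= delta^-1. *)
apply: (@le_trans _ _ ((l^-1)%:E + (M%:E + M%:E))%E).
  by rewrite ncV; apply: leeD => //; exact: leeD.
rewrite -!EFinD lee_fin div1r; apply: lerD; first by rewrite lef_pV2 ?posrE.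
have -> : M + M = 2 * (P * (l^-1 * delta^-1)) by rewrite /M invfM; ring.
have -> : 2 * (1 - delta) / delta ^+ 2 = 2 * ((1 - delta) * (delta^-1 * delta^-1)).
  by rewrite expr2 invfM mulrA.
apply: ler_wpM2l => //; apply: ler_pM => //.
- by rewrite mulr_ge0// invr_ge0 ltW.
- by move: lP dl; clear; lra.
- by apply: ler_wpM2r; [rewrite invr_ge0 ltW|rewrite lef_pV2 ?posrE].
Qed.
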